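(* Let $\lambda=(\lambda_1>\cdots>\lambda_n)\in\mathbb{R}^n$ be such that for all $1\le k\le n-1$ the entries of $\lambda^{(k)}$ are distinct. Given $L\in\mathcal{O}_\lambda$, let $V\in\mathrm{Fl}_n(\mathbb{C})$ denote the complete flag corresponding to $L$. Let $\mathcal{O}_\lambda'$ denote the subset of $\mathcal{O}_\lambda$ of all $L$ such that $\Delta_I(\vartheta(V))\ne0$ for all $I\subseteq[n]$. Then we have the continuous map $$\mathcal{O}_\lambda'\to\prod_{k=1}^{n-1}\mathsf{Perm}(\lambda^{(k)}),\qquad L\mapsto\Big(\mu\Big(\widetilde{\mathsf{Mos}}_{\lambda^{(k)}}\big(\Delta_I(\vartheta(V)):I\in\tbinom{[n]}{k}\big)\Big)\Big)_{1\le k\le n-1}.$$ Moreover, when this map is restricted to any subset of $\mathcal{O}_\lambda'$ which fixes the complex argument of $\Delta_I(\vartheta(V))$ for each nonempty $I\subsetneq[n]$, then it is a diffeomorphism onto its image. In particular, the map restricted to $\mathcal{O}_\lambda^{>0}$ is a diffeomorphism onto its image.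
   Context: Here $\mathrm{i}=\sqrt{-1}$, $[n]=\{1,\dots,n\}$, $\binom{[n]}{k}$ is the set of $k$-element subsets of $[n]$, $\mathrm{Diag}(c)$ is the diagonal matrix with diagonal $c$, $\mathrm{U}_n$ is the unitary group and $\mathfrak{u}_n$ its Lie algebra of skew-Hermitian matrices. Orbits and flags: for a strictly decreasing real vector $\lambda$ of length $n$, $\mathcal{O}_\lambda=\{g(\mathrm{i}\,\mathrm{Diag}(\lambda))g^{-1}:g\in\mathrm{U}_n\}$. $\mathrm{Fl}_n(\mathbb{C})=\mathrm{GL}_n(\mathbb{C})/\mathrm{B}_n(\mathbb{C})$ ($\mathrm{B}_n(\mathbb{C})$ = invertible upper-triangular matrices). The isomorphism $\mathcal{O}_\lambda\cong\mathrm{Fl}_n(\mathbb{C})$ is $g(\mathrm{i}\,\mathrm{Diag}(\lambda))g^{-1}\mapsto g$ ($g\in\mathrm{U}_n$); ''corresponding'' refers to it. For $|I|=k$, $\Delta_I(g)$ is the minor of $g$ in rows $I$ and columns $1,\dots,k$; for $V$ represented by $g$ the Plücker coordinates $(\Delta_I(V):I\in\binom{[n]}{k})=(\Delta_I(g):I\in\binom{[n]}{k})$ are well defined as a point of $\mathbb{P}^{\binom nk-1}(\mathbb{C})$ for each $k$, i.e. up to a common rescaling. Total positivity: $\mathrm{Fl}_n^{>0}$ is the set of $V\in\mathrm{Fl}_n(\mathbb{C})$ whose Plücker coordinates are all real and positive, up to rescaling, and $\mathcal{O}_\lambda^{>0}$ is the corresponding subset of $\mathcal{O}_\lambda$. Twist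 map: for $w\in\mathfrak{S}_n$, let $\mathring w$ be the signed permutation matrix with nonzero entries $\pm1$ in positions $(w(j),j)$, signs chosen so that all $\Delta_I(\mathring w)\ge0$, and $\mathring X^w=\mathrm{B}_n(\mathbb{C})\cdot\mathring w\subseteq\mathrm{Fl}_n(\mathbb{C})$; these partition $\mathrm{Fl}_n(\mathbb{C})$. Let $\delta_n=\mathrm{Diag}(1,-1,\dots,(-1)^{n-1})$ and $\iota(g)=\delta_ng^{-1}\delta_n$. For $V\in\mathring X^w$ the canonical representative is the $g\in\mathrm{U}_n$ representing $V$ such that for all $1\le k\le n$, $\Delta_{w([k])}(g)\in\mathbb{R}_{>0}$ and $\Delta_I(g)=0$ for all $I\in\binom{[n]}{k}$ lexicographically greater than $w([k])$. Then $\vartheta(V)\in\mathrm{Fl}_n(\mathbb{C})$ is the flag represented by $\iota(g)$. $\lambda^{(k)}:=(\sum_{i\in I}\lambda_i:I\in\binom{[n]}{k})\in\mathbb{R}^{\binom nk}$, where $\binom{[n]}{k}$ is ordered so that the entries are decreasing. Moser map: for strictly decreasing $\lambda\in\mathbb{R}^n$ and $x\in\mathbb{P}^{n-1}_{>0}$ (points of $\mathbb{P}^{n-1}(\mathbb{C})$ with all coordinates real and positive up to rescaling), let $\mathsf{Vand}(\lambda,x)\in\mathrm{Fl}_n(\mathbb{C})$ be the flag represented by $(\lambda_i^{j-1}x_i)_{1\le i,j\le n}$, and let $\mathsf{Mos}_\lambda(x)\in\mathcal{O}_\lambda$ be the element corresponding to $\mathsf{Vand}(\lambda,x)$. Extended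 Moser map: for $x\in\mathbb{P}^{n-1}(\mathbb{C})$ set $I=\{i:x_i\ne0\}$, $y=(|x_i|:i\in I)\in\mathbb{P}^{|I|-1}_{>0}$, $\nu=(\lambda_i:i\in I)$, and $\widetilde{\mathsf{Mos}}_\lambda(x):=\mathsf{Mos}_\nu(y)$. Moment map and permutohedron: $\mu:\mathfrak{u}_m\to\mathbb{R}^m$ sends $\mathrm{i}M$ to the vector of diagonal entries of $M$; $\mathsf{Perm}(\lambda)\subseteq\mathbb{R}^m$ is the polytope whose vertices are all permutations of $\lambda\in\mathbb{R}^m$. *)

(* Defs.v *)
(* MathComp / MathComp-Analysis over an abstract R : realType; the complex
   numbers are R[i] (mathcomp-real-closed).

   Indices run over 'I_n = {0, ..., n-1} instead of {1, ..., n}. *)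
From HB Require Import structures.
From mathcomp Require Import all_boot all_order all_algebra all_fingroup.
From mathcomp Require Import spectral complex.
From mathcomp Require Import all_classical all_reals all_analysis.

Set Implicit Arguments.
Unset Strict Implicit.
Unset Printing Implicit Defensive.

Import Order.TTheory GRing.Theory Num.Theory.
Import numFieldNormedType.Exports.

Local Open Scope classical_set_scope.
Local Open Scope ring_scope.

Section Smooth.
Variable R : realType.
Implicit Types U V : normedModType R.

(* For finite-dimensional U, a differentiable map is C^(k+1) iff all of its
   directional derivatives are C^k. *)
Fixpoint isCk U V (k : nat) (A : set U) (f : U -> V) : Prop :=
  match k with
  | 0 => forall x, A x -> {for x, continuous f}
  | k'.+1 => (forall x, A x -> differentiable f x) /\
             (forall v, isCk k' A (fun x => 'D_v f x))
  end.

Definition smooth U V (A : set U) (f : U -> V) : Prop := forall k, isCk k A f.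

(* Smoothness on an arbitrary subset S: local existence of smooth extensions
   to the ambient space. When S is an embedded submanifold this is the usual
   notion. *)
Definition smooth_on U V (S : set U) (f : U -> V) : Prop :=
  forall x, S x -> exists (A : set U) (g : U -> V),
    [/\ open A, A x, smooth A g & forall y, A y -> S y -> g y = f y].

Definition diffeo_onto_image U V (S : set U) (f : U -> V) : Prop :=
  smooth_on S f /\
  exists2 g : V -> U, (forall x, S x -> g (f x) = x) & smooth_on (f @` S) g.

Definition complexify n (P : 'M[R]_n * 'M[R]_n) : 'M[R[i]]_n :=
  \matrix_(i, j) Complex (P.1 i j) (P.2 i j).

Definition realify n (L : 'M[R[i]]_n) : 'M[R]_n * 'M[R]_n :=
  (map_mx (@complex.Re R) L, map_mx (@complex.Im R) L).

End Smooth.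

Section Flags.
Variable R : realType.
Local Notation C := R[i].

Definition strictly_decreasing n (lam : 'rV[R]_n) : Prop :=
  forall i j : 'I_n, (i < j)%N -> lam 0 j < lam 0 i.

Definition i_diag n (lam : 'rV[R]_n) : 'M[C]_n :=
  Complex 0 1 *: diag_mx (map_mx (real_complex R) lam).

Definition orbit n (lam : 'rV[R]_n) : set 'M[C]_n :=
  [set L | exists2 g, g \is unitarymx & L = g *m i_diag lam *m invmx g].

(* is_trig_mx means lower triangular, whence the transpose. *)
Definition borel n : set 'M[C]_n :=
  [set b | b \in unitmx /\ is_trig_mx b^T].

(* The point g B_n of GL_n / B_n, as a coset; g represents the flag V when
   V g. *)
Definition flag_of n (g : 'M[C]_n) : set 'M[C]_n := [set g *m b | b in @borel n].

Definition flags n : set (set 'M[C]_n) :=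
  [set V | exists2 g, g \in unitmx & V = flag_of g].

Definition corresponds n (lam : 'rV[R]_n) (L : 'M[C]_n) (V : set 'M[C]_n) :=
  exists g, [/\ g \is unitarymx, L = g *m i_diag lam *m invmx g
              & V = flag_of g].

(* For lam strictly decreasing, the relation above is the graph of a bijection
   between orbit lam and the flags; the next two functions are its two
   directions (with junk values outside of orbit lam, resp. flags). *)
Definition flag_of_orbit n (lam : 'rV[R]_n) (L : 'M[C]_n) : set 'M[C]_n :=
  xget set0 [set V | corresponds lam L V].

Definition orbit_of_flag n (lam : 'rV[R]_n) (V : set 'M[C]_n) : 'M[C]_n :=
  xget 0 [set L | corresponds lam L V].

Lemma card_set_ord n (I : {set 'I_n}) : (#|I| <= n)%N.
Proof. by rewrite -[leqRHS]card_ord max_card. Qed.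

(* enum_val lists the elements of I in increasing order. *)
Definition Delta n (I : {set 'I_n}) (g : 'M[C]_n) : C :=
  \det (mxsub (fun a : 'I_#|I| => enum_val a)
              (widen_ord (card_set_ord I)) g).

(* Computed on some representative of V, so that, for each k, the family
   (plucker V I : #|I| = k) is meaningful up to a common nonzero factor only. *)
Definition plucker n (V : set 'M[C]_n) (I : {set 'I_n}) : C :=
  Delta I (xget 1%:M V).

(* In R[i], 0 < z means that z is real and positive. *)
Definition flags_pos n : set (set 'M[C]_n) :=
  [set V | flags V /\
    forall k, (0 < k <= n)%N ->
      exists2 c : C, c != 0 &
        forall I : {set 'I_n}, #|I| = k -> 0 < c * plucker V I].

Definition orbit_pos n (lam : 'rV[R]_n) : set 'M[C]_n :=
  [set L | orbit lam L /\ flags_pos (flag_of_orbit lam L)].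

(* This determines M: the nonzero minor in rows w([k]) and columns [k] is the
   product of the first k signs, up to a sign depending on w only. *)
Definition signed_perm n (w : 'S_n) (M : 'M[C]_n) : Prop :=
  (forall i j, if i == w j then M i j = 1 \/ M i j = -1 else M i j = 0) /\
  (forall I : {set 'I_n}, 0 <= Delta I M).

Definition schubert_cell n (w : 'S_n) : set (set 'M[C]_n) :=
  [set V | exists M b, [/\ signed_perm w M, @borel n b & V = flag_of (b *m M)]].

Definition perm_prefix n (w : 'S_n) (k : nat) : {set 'I_n} :=
  w @: [set j : 'I_n | (j < k)%N]%SET.

Definition lex_lt n (I J : {set 'I_n}) : bool :=
  ((map val (enum I) : seqlexi nat) < (map val (enum J) : seqlexi nat))%O.

Definition canonical_repr n (w : 'S_n) (V : set 'M[C]_n) (g : 'M[C]_n) : Prop :=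
  [/\ g \is unitarymx, V g &
    forall k, (0 < k <= n)%N ->
      0 < Delta (perm_prefix w k) g /\
      (forall I : {set 'I_n}, #|I| = k -> lex_lt (perm_prefix w k) I ->
         Delta I g = 0)].

Definition delta_alt n : 'M[C]_n := diag_mx (\row_(j < n) (-1) ^+ j).

Definition iota_inv n (g : 'M[C]_n) : 'M[C]_n :=
  delta_alt n *m invmx g *m delta_alt n.

(* Every flag lies in exactly one cell and has exactly one canonical
   representative, so the set below is a singleton if V is a flag. *)
Definition twist n (V : set 'M[C]_n) : set 'M[C]_n :=
  xget set0 [set W | exists w g,
    [/\ schubert_cell w V, canonical_repr w V g & W = flag_of (iota_inv g)]].

End Flags.

Section Moser.
Variable R : realType.
Local Notation C := R[i].

(* Points of projective space are given by homogeneous coordinates; rescaling x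
   does not change the flag. *)
Definition vand n (lam : 'rV[R]_n) (x : 'rV[C]_n) : set 'M[C]_n :=
  flag_of (\matrix_(i < n, j < n) (((lam 0 i) ^+ j)%:C%C * x 0 i)).

Definition moser n (lam : 'rV[R]_n) (x : 'rV[C]_n) : 'M[C]_n :=
  orbit_of_flag lam (vand lam x).

Definition nonzero_coords n (x : 'rV[C]_n) : {set 'I_n} :=
  [set i : 'I_n | x 0 i != 0]%SET.

Definition moser_ext n (lam : 'rV[R]_n) (x : 'rV[C]_n) :
    'M[C]_#|nonzero_coords x| :=
  moser (\row_(a < #|nonzero_coords x|) lam 0 (enum_val a))
        (\row_(a < #|nonzero_coords x|) `|x 0 (enum_val a)|).

Definition moment n (L : 'M[C]_n) : 'rV[R]_n :=
  \row_j complex.Re (L j j / Complex 0 1).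

Definition permutohedron n (lam : 'rV[R]_n) : set 'rV[R]_n :=
  [set v | exists t : 'S_n -> R,
    [/\ forall s, 0 <= t s, \sum_s t s = 1 & v = \sum_s t s *: col_perm s lam]].

(* The k-element subsets of [n], by decreasing sum of the entries of lam. *)
Definition ksubsets n (lam : 'rV[R]_n) (k : nat) : seq {set 'I_n} :=
  sort (fun I J : {set 'I_n} => \sum_(i in J) lam 0 i <= \sum_(i in I) lam 0 i)
       (enum [set I : {set 'I_n} | #|I| == k]%SET).

Definition ksums n (lam : 'rV[R]_n) (k : nat) : 'rV[R]_'C(n, k) :=
  \row_(j < 'C(n, k)) \sum_(i in nth finset.set0 (ksubsets lam k) j) lam 0 i.

Definition kplucker n (lam : 'rV[R]_n) (k : nat) (V : set 'M[C]_n) :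
    'rV[C]_'C(n, k) :=
  \row_(j < 'C(n, k)) plucker V (nth finset.set0 (ksubsets lam k) j).

(* moser_ext has size the number of nonzero coordinates of the vector of
   Pluecker coordinates, which is 'C(n, k) on orbit_nz lam below, where
   conform_mx is thus merely a cast. *)
Definition moment_component n (lam : 'rV[R]_n) (k : nat) (L : 'M[C]_n) :
    'rV[R]_'C(n, k) :=
  conform_mx 0
    (moment (moser_ext (ksums lam k)
                       (kplucker lam k (twist (flag_of_orbit lam L))))).

(* The product of the R^'C(n, k), 0 < k < n, is the space of block row
   vectors; submxrow _ k is the projection to the factor of index k.+1. *)
Definition moment_map n (lam : 'rV[R]_n) (L : 'M[C]_n) :
    'rV[R]_(\sum_(k < n.-1) 'C(n, k.+1)) :=
  \mxrow_(k < n.-1) moment_component lam k.+1 L.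

Definition orbit_nz n (lam : 'rV[R]_n) : set 'M[C]_n :=
  [set L | orbit lam L /\
    forall I : {set 'I_n}, plucker (twist (flag_of_orbit lam L)) I != 0].

(* exp (i arg z), for z != 0 *)
Definition phase (z : C) : C := z / `|z|.

(* The complex arguments of the coordinates of the twisted flag are constant
   on S; c is the common factor up to which, for each k, these coordinates are
   defined. *)
Definition fixes_arguments n (lam : 'rV[R]_n) (S : set 'M[C]_n) : Prop :=
  exists theta : {set 'I_n} -> C, forall L, S L ->
    forall k, (0 < k < n)%N -> exists2 c : C, c != 0 &
      forall I : {set 'I_n}, #|I| = k ->
        phase (c * plucker (twist (flag_of_orbit lam L)) I) = theta I.

End Moser.

(* Main.v *)
(* Write L = g (i Diag(lam)) g^-1 with g the canonical representative, h = iota(g), and let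
   y_k be the vector of the moduli of the k-minors of h. The k-th component of the map is a
   function of y_k alone, namely y |-> mu(Mos(y)), whose i-th coordinate is an explicit linear
   combination, over m, of the probability that a random m-subset, of weight
   (Vandermonde * monomial in y)^2, contains i. It is also the image of lam^(k) under a doubly
   stochastic matrix, hence lies in the permutohedron.

   Forward smoothness: the squared moduli of the minors of h are polynomials in L, as minors of
   sums of spectral projections.

   Inverse: by Chebyshev's correlation inequality, y |-> mu(Mos(y)) is injective up to scaling,
   and so is its differential. The scale is fixed by sum_I |Delta_I(h)|^2 = 1, so the inverse
   function theorem yields a smooth inverse and recovers the moduli of all minors of h. The
   common phase is fixed because the minors of h in the last k rows are positive: the flag of g
   lies in the open cell, and by Cauchy-Binet the canonical normalization of g passes to h. So
   the prescribed arguments recover the minors themselves. Finally, since h is unitary, its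
   entries are polynomials in its minors and their conjugates, again by Cauchy-Binet. *)

(* The representative g is never chosen smoothly in L: forward, only squared moduli of minors enter,
   and these extend polynomially to all matrices; backward, g appears only through polynomials in
   recovered minors. How Chebyshev enters: passing from y to y' multiplies the weight of a subset f
   by e_f, the product over f of e_i = (y'_i / y_i)^2. Pairing the difference of the two moment
   vectors with log e gives a sum over m of the m-th gap of lam^(k) times a normalized covariance of
   e_f and log e_f. All covariances are nonnegative, the gaps are positive except possibly the last,
   and there the covariance is zero, since only one subset is left. Equal moments thus kill the
   covariance for m = 1, so e is constant. For the differential, variances replace covariances. The
   positive part has an ingredient of its own: the twist preserves positivity of all minors. For
   intervals of rows, Cauchy-Binet has no negative term; the three-term Pluecker relation extends
   this to all row sets. Sums over m-subsets are written as sums over maps from 'I_m: non-injective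
   maps contribute zero, and each subset counts m! times. *)
Require Import Defs.
From HB Require Import structures.
From mathcomp Require Import all_boot all_order all_algebra all_fingroup.
From mathcomp Require Import spectral complex.
From mathcomp Require Import all_classical all_reals all_analysis.
From mathcomp Require Import ring lra zify.

Set Implicit Arguments.
Unset Strict Implicit.
Unset Printing Implicit Defensive.

Import Order.TTheory GRing.Theory Num.Theory.
Import numFieldNormedType.Exports.

Local Open Scope classical_set_scope.
Local Open Scope ring_scope.

(** * Calculus of C^k maps *)

Section Differentiability.
Variables (R : realType) (V W : normedModType R).
Implicit Types (f g : V -> W) (x v : V).

Lemma differentiable_of_eps f x (df : {linear V -> W}) :
  continuous df ->
  (forall e, 0 < e -> \forall h \near 0, `|f (h + x) - f x - df h| <= e * `|h|) ->
  differentiable f x /\ 'd f x = df :> (V -> W).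
Proof.
move=> cdf fe.
have E : f \o shift x = cst (f x) + df +o_ 0 id.
  apply/eqaddoP => e e0; have := fe e e0; apply: filterS => h /=.
  by rewrite opprD addrA.
have dfE : 'd f x = df :> (V -> W) by exact: diff_unique.
by split=> //; apply/diff_locallyP; rewrite dfE.
Qed.

Lemma differentiable_eps f x e : differentiable f x -> 0 < e ->
  \forall h \near 0, `|f (h + x) - f x - 'd f x h| <= e * `|h|.
Proof.
move=> /diff_locallyP[_ /eqaddoP/(_ e)] H /H; apply: filterS => h /=.
by rewrite opprD addrA.
Qed.

Lemma near_eq_differentiable f g x :
  {near x, f =1 g} -> differentiable f x -> differentiable g x.
Proof.
move=> fg df; apply: (differentiable_of_eps (df := 'd f x) _ _).1.
  exact: diff_continuous.
move=> e e0; have := differentiable_eps df e0.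
have : \forall h \near (0 : V), f (h + x) = g (h + x).
  have := fg; rewrite (near_shift 0)/= subr0.
  by apply: filterS => h /=; rewrite /= /shift/=.
have fgx := nbhs_singleton fg.
by apply: filterS2 => h <-; rewrite -fgx.
Qed.

End Differentiability.

Section Ck.
Variables (R : realType).
Implicit Types U V W : normedModType R.

Lemma open_near_eq U V (A : set U) (f g : U -> V) x : open A -> A x ->
  (forall y, A y -> f y = g y) -> {near x, f =1 g}.
Proof. by move=> oA Ax fg; apply: filterS (open_nbhs_nbhs (conj oA Ax)). Qed.

(** Openness of [A] matters: continuity and derivatives at a point of [A] depend on the values in a
    whole neighbourhood. *)
Lemma eq_isCk U V k (A : set U) (f g : U -> V) : open A ->
  (forall x, A x -> f x = g x) -> isCk k A f -> isCk k A g.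
Proof.
move=> oA; elim: k f g => [|k IH] f g fg /=.
  move=> cf x Ax; have cfx : f @ x --> f x := cf x Ax.
  change (g @ x --> g x); rewrite -(fg x Ax).
  by apply: cvg_trans cfx; apply: near_eq_cvg; exact: (open_near_eq oA Ax).
move=> [df Df]; split.
  move=> x Ax; apply: near_eq_differentiable (df x Ax).
  exact: open_near_eq oA Ax fg.
move=> v; apply: IH (Df v) => x Ax.
by apply: near_eq_derive; exact: open_near_eq oA Ax fg.
Qed.

Lemma sub_isCk U V k (A B : set U) (f : U -> V) :
  A `<=` B -> isCk k B f -> isCk k A f.
Proof.
move=> AB; elim: k f => [|k IH] f /=; first by move=> H x /AB; exact: H.
by move=> [df Df]; split=> [x /AB|v]; [exact: df|exact: IH].
Qed.

Lemma isCkW U V k (A : set U) (f : U -> V) : isCk k.+1 A f -> isCk k A f.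
Proof.
elim: k f => [|k IH] f /=.
  by move=> [df _] x Ax; apply: differentiable_continuous; exact: df.
by move=> [df Df]; split=> // v; exact: (IH _ (Df v)).
Qed.

Lemma isCk_cst U V k (A : set U) (c : V) : isCk k A (fun=> c : V).
Proof.
elim: k c => [|k IH] c /=; first by move=> x _; exact: cst_continuous.
split=> [x _|v]; first exact: differentiable_cst.
rewrite (_ : (fun x => 'D_v _ x) = fun=> 0) //.
by apply/funext => x; exact: derive_cst.
Qed.

Lemma isCkD U V k (A : set U) (f g : U -> V) : open A ->
  isCk k A f -> isCk k A g -> isCk k A (fun x => f x + g x).
Proof.
move=> oA; elim: k f g => [|k IH] f g /=.
  by move=> cf cg x Ax; apply: continuousD; [exact: cf|exact: cg].
move=> [df Df] [dg Dg]; split.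
  by move=> x Ax; apply: differentiableD; [exact: df|exact: dg].
move=> v; apply: (eq_isCk oA _ (IH _ _ (Df v) (Dg v))) => x Ax.
by rewrite -deriveD//; apply: diff_derivable; [exact: df|exact: dg].
Qed.

Lemma isCkM U k (A : set U) (f g : U -> R) : open A ->
  isCk k A f -> isCk k A g -> isCk k A (fun x => f x * g x).
Proof.
move=> oA; elim: k f g => [|k IH] f g.
  by move=> /= cf cg x Ax; apply: continuousM; [exact: cf|exact: cg].
move=> Cf Cg; have cf := isCkW Cf; have cg := isCkW Cg.
case: Cf Cg => [df Df] [dg Dg]; split.
  by move=> x Ax; apply: differentiableM; [exact: df|exact: dg].
move=> v.
have := isCkD oA (IH _ _ cf (Dg v)) (IH _ _ cg (Df v)).
apply: eq_isCk => // x Ax.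
by rewrite [RHS](deriveM (f := f) (g := g))//; apply: diff_derivable; [exact: df|exact: dg].
Qed.

Lemma isCkV U k (A : set U) (f : U -> R) : open A ->
  (forall x, A x -> f x != 0) -> isCk k A f -> isCk k A (fun x => (f x)^-1).
Proof.
move=> oA f0; elim: k => [|k IH].
  by move=> /= cf x Ax; apply: continuousV; [exact: f0|exact: cf].
move=> Cf; have cf := isCkW Cf; case: Cf => [df Df]; split.
  by move=> x Ax; apply: differentiableV; [exact: df|exact: f0].
move=> v.
have := isCkM oA (isCk_cst (V := R) k A (-1)) (isCkM oA (isCkM oA (IH cf) (IH cf)) (Df v)).
apply: eq_isCk => // x Ax.
rewrite [RHS]deriveV; [|exact: f0|by apply: diff_derivable; exact: df].
by rewrite mulN1r -exprVn expr2 -mulNr.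
Qed.

Lemma isCk_linear U V k (A : set U) (f : {linear U -> V}) :
  continuous f -> isCk k A f.
Proof.
move=> cf; case: k => [|k] /=; first by move=> x _; exact: cf.
split=> [x _|v]; first exact: linear_differentiable.
rewrite (_ : (fun x => 'D_v _ x) = fun=> f v); first exact: isCk_cst.
apply/funext => x; rewrite deriveE; last exact: linear_differentiable.
by rewrite diff_lin.
Qed.

Lemma isCkZl U V k (A : set U) (f : U -> R) (c : V) : open A ->
  isCk k A f -> isCk k A (fun x => f x *: c).
Proof.
move=> oA; elim: k f => [|k IH] f /=.
  move=> cf x Ax; apply: continuousZr_tmp; exact: cf.
move=> [df Df]; split=> [x Ax|v].
  by apply: differentiableZl; exact: df.
apply: (eq_isCk oA _ (IH _ (Df v))) => x Ax.
rewrite [RHS]deriveE; last by apply: differentiableZl; exact: df.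
by rewrite diffZl ?deriveE//; exact: df.
Qed.

Lemma isCk_sum U V k (A : set U) (I : Type) (r : seq I) (P : pred I)
    (f : I -> U -> V) : open A ->
  (forall i, P i -> isCk k A (f i)) -> isCk k A (fun x => \sum_(i <- r | P i) f i x).
Proof.
move=> oA Hf; elim: r => [|i r IH].
  by apply: (eq_isCk oA _ (isCk_cst k A 0)) => x _; rewrite big_nil.
case: (boolP (P i)) => Pi.
  by apply: (eq_isCk oA _ (isCkD oA (Hf i Pi) IH)) => x _; rewrite big_cons Pi.
by apply: (eq_isCk oA _ IH) => x _; rewrite big_cons (negbTE Pi).
Qed.

Lemma isCk_prod U k (A : set U) (I : Type) (r : seq I) (P : pred I)
    (f : I -> U -> R) : open A ->
  (forall i, P i -> isCk k A (f i)) ->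
  isCk k A (fun x => \prod_(i <- r | P i) f i x).
Proof.
move=> oA Hf; elim: r => [|i r IH].
  by apply: (eq_isCk oA _ (isCk_cst (V := R) k A 1)) => x _; rewrite big_nil.
case: (boolP (P i)) => Pi.
  by apply: (eq_isCk oA _ (isCkM oA (Hf i Pi) IH)) => x _; rewrite big_cons Pi.
by apply: (eq_isCk oA _ IH) => x _; rewrite big_cons (negbTE Pi).
Qed.

Lemma isCkN U V k (A : set U) (f : U -> V) : open A ->
  isCk k A f -> isCk k A (fun x => - f x).
Proof.
move=> oA; elim: k f => [|k IH] f /=.
  by move=> cf x Ax; apply: continuousN; exact: cf.
move=> [df Df]; split=> [x Ax|v]; first by apply: differentiableN; exact: df.
apply: (eq_isCk oA _ (IH _ (Df v))) => x Ax.
by rewrite -deriveN//; apply: diff_derivable; exact: df.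
Qed.

Lemma isCk_mx U k (A : set U) m n (f : U -> 'M[R]_(m, n)) : open A ->
  (forall i j, isCk k A (fun x => f x i j)) -> isCk k A f.
Proof.
move=> oA Cf.
have := @isCk_sum U 'M[R]_(m, n) k A _ (index_enum 'I_m) xpredT
  (fun i x => \sum_j f x i j *: delta_mx i j) oA.
move=> H; apply: eq_isCk (H _) => //.
  by move=> x _; rewrite [RHS]matrix_sum_delta.
by move=> i _; apply: isCk_sum => // j _; exact: isCkZl.
Qed.

Lemma isCk_pair U V W k (A : set U) (f : U -> V) (g : U -> W) : open A ->
  isCk k A f -> isCk k A g -> isCk k A (fun x => (f x, g x)).
Proof.
move=> oA; elim: k f g => [|k IH] f g /=.
  by move=> cf cg x Ax; apply: cvg_pair; [exact: cf|exact: cg].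
move=> [df Df] [dg Dg]; split.
  by move=> x Ax; apply: differentiable_pair; [exact: df|exact: dg].
move=> v; apply: (eq_isCk oA _ (IH _ _ (Df v) (Dg v))) => x Ax.
rewrite !deriveE; [|apply: differentiable_pair; [exact: df|exact: dg]|exact: dg|exact: df].
by rewrite diff_pair; [|exact: df|exact: dg].
Qed.

Lemma isCk_post_linear U V W k (A : set U) (f : U -> V) (l : {linear V -> W}) :
  open A -> continuous l -> isCk k A f -> isCk k A (fun x => l (f x)).
Proof.
move=> oA cl; elim: k f => [|k IH] f /=.
  by move=> cf x Ax; apply: continuous_comp; [exact: cf|exact: cl].
move=> [df Df]; split=> [x Ax|v].
  by apply: differentiable_comp; [exact: df|exact: linear_differentiable].
apply: (eq_isCk oA _ (IH _ (Df v))) => x Ax.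
have dl := linear_differentiable (f x) cl.
rewrite !deriveE; [|exact: differentiable_comp (df x Ax) dl|exact: df].
by rewrite [in RHS](diff_comp (df x Ax) dl) /= diff_lin.
Qed.

Lemma isCk_coord U k (A : set U) m n (f : U -> 'M[R]_(m, n)) i j : open A ->
  isCk k A f -> isCk k A (fun x => f x i j : R).
Proof.
move=> oA Cf.
have lin : linear (fun M : 'M[R]_(m, n) => M i j : R).
  by move=> c M N; rewrite !mxE.
pose L := GRing.isLinear.Build R 'M[R]_(m, n) R _ _ lin.
pose l' : {linear 'M[R]_(m, n) -> R} := HB.pack (fun M : 'M[R]_(m, n) => M i j : R) L.
exact: (@isCk_post_linear _ _ _ _ _ _ l' oA (@coord_continuous R m n i j) Cf).
Qed.

(** Induction through the chain rule D_v (g o f) = sum_j (D_v f)_j ((D_(e_j) g) o f). Expanding in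
    the fixed basis directions e_j is what makes the inductive hypothesis applicable, as [isCk]
    speaks of derivatives in constant directions only. *)
Lemma isCk_comp U k (A : set U) m (B : set 'rV[R]_m) (f : U -> 'rV[R]_m)
    (g : 'rV[R]_m -> R) : open A -> open B -> (forall x, A x -> B (f x)) ->
  isCk k A f -> isCk k B g -> isCk k A (fun x => g (f x)).
Proof.
move=> oA oB AB; elim: k f g AB => [|k IH] f g AB.
  move=> /= cf cg x Ax; apply: continuous_comp; first exact: cf.
  by apply: cg; exact: AB.
move=> Cf Cg; have cf := isCkW Cf; case: Cf Cg => [df Df] [dg Dg].
have dgf x : A x -> differentiable (fun x => g (f x)) x.
  move=> Ax; apply: differentiable_comp; first exact: df.
  by apply: dg; exact: AB.
split=> // v.
have H : isCk k A (fun x => \sum_j ('D_v f x) 0 j * 'D_(delta_mx 0 j) g (f x)).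
  apply: isCk_sum => // j _; apply: isCkM => //.
    by apply: isCk_coord => //; exact: Df.
  exact: (IH f _ AB cf (Dg _)).
apply: (eq_isCk oA _ H) => x Ax.
rewrite [RHS]deriveE; last exact: dgf.
rewrite [in RHS](_ : (fun x => g (f x)) = g \o f)//.
rewrite diff_comp; [|exact: df|by apply: dg; exact: AB].
rewrite /=.
rewrite [in RHS](row_sum_delta ('d f x v)) linear_sum /=.
apply: eq_bigr => j _; rewrite linearZ /= (deriveE v (df x Ax)).
by rewrite (deriveE _ (dg _ (AB _ Ax))).
Qed.

Lemma isCk_id U k (A : set U) : isCk k A (fun x : U => x).
Proof. by apply: (@isCk_linear U U k A idfun) => x; exact: cvg_id. Qed.

Lemma mulmxr_continuous m n p (M : 'M[R]_(n, p)) :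
  continuous (fun h : 'M[R]_(m, n) => h *m M).
Proof.
move=> x; apply: (@isCk_mx _ 0 setT _ _ (fun h => h *m M) openT) => // i j.
have H : isCk 0 setT (fun h : 'M[R]_(m, n) => \sum_l h i l * M l j).
  apply: isCk_sum; first exact: openT.
  move=> l _; apply: isCkM; [exact: openT| |exact: isCk_cst].
  by apply: isCk_coord; [exact: openT|exact: isCk_id].
by apply: (eq_isCk openT _ H) => h _; rewrite mxE.
Qed.

Lemma isCk_det U k (A : set U) n (f : U -> 'M[R]_n) : open A ->
  (forall i j, isCk k A (fun x => f x i j : R)) -> isCk k A (fun x => \det (f x) : R).
Proof.
move=> oA Cf; apply: isCk_sum => // s _; apply: isCkM => //.
  exact: isCk_cst.
exact: isCk_prod.
Qed.

Lemma isCk_invmx U k (A : set U) n (f : U -> 'M[R]_n) : open A ->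
  (forall x, A x -> f x \in unitmx) ->
  (forall i j, isCk k A (fun x => f x i j : R)) ->
  forall i j, isCk k A (fun x => invmx (f x) i j : R).
Proof.
move=> oA uf Cf i j.
have H : isCk k A (fun x => (\det (f x))^-1 * ((-1) ^+ (j + i) *
    \det (row' j (col' i (f x))))).
  apply: isCkM => //.
    apply: isCkV => //; last exact: isCk_det.
    by move=> x Ax; have := uf x Ax; rewrite unitmxE unitfE.
  apply: isCkM => //; first exact: isCk_cst.
  apply: isCk_det => // a b.
  by apply: eq_isCk (Cf (lift j a) (lift i b)) => // x _; rewrite !mxE.
by apply: (eq_isCk oA _ H) => x Ax; rewrite /invmx uf// !mxE.
Qed.

End Ck.

(** * The inverse function theorem *)

Section InverseFunction.
Variables (R : realType) (N : nat) (F : 'rV[R]_N -> 'rV[R]_N) (D : set 'rV[R]_N).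
Hypotheses (oD : open D) (smF : smooth D F)
  (injF : forall x y, D x -> D y -> F x = F y -> x = y)
  (injdF : forall x v, D x -> 'd F x v = 0 -> v = 0).

Let dF x : D x -> differentiable F x.
Proof. by move=> Dx; have [+ _] := smF 1; exact. Qed.

Lemma jacobian_unit x : D x -> 'J F x \in unitmx.
Proof.
move=> Dx; rewrite unitmxE unitfE; apply/det0P => -[v v0 vJ]; move/eqP: v0; apply.
by apply: (injdF Dx); rewrite -vJ /jacobian mul_rV_lin1.
Qed.

Lemma center_norm_continuous (y0 : 'rV[R]_N) : continuous (fun y : 'rV[R]_N => `|y - y0|).
Proof.
move=> x.
have C := isCkD openT (@isCk_id _ 'rV[R]_N 0 setT) (@isCk_cst _ _ _ 0 setT (- y0)).
exact: cvg_norm (C x I).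
Qed.

Lemma closed_ball_compact (y0 : 'rV[R]_N) r : compact [set y | `|y - y0| <= r].
Proof.
apply: bounded_closed_compact.
  exists (r + `|y0|); split; [exact: num_real|move=> M rM y /= yr].
  rewrite -(subrK y0 y) (le_trans (ler_normD _ _))// ltW//.
  by apply: le_lt_trans rM; rewrite lerD2r.
rewrite (_ : [set y | _] = (fun y => `|y - y0|) @^-1` [set x | x <= r]) //.
apply: preimage_closed; last exact: closed_le.
by move=> x _; exact: center_norm_continuous.
Qed.

Lemma sphere_compact (y0 : 'rV[R]_N) r : compact [set y | `|y - y0| = r].
Proof.
apply: (subclosed_compact _ (@closed_ball_compact y0 r)); last by move=> y /= ->.
rewrite (_ : [set y | _] = (fun y => `|y - y0|) @^-1` [set x | x = r]) //.
apply: preimage_closed; last exact: closed_eq.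
by move=> x _; exact: center_norm_continuous.
Qed.

Lemma dist_continuous (v : 'rV[R]_N) x : D x -> {for x, continuous (fun y => `|F y - v|)}.
Proof.
move=> Dx.
have C := isCkD oD (smF 0) (@isCk_cst _ _ _ 0 D (- v)).
exact: cvg_norm (C x Dx).
Qed.

Lemma dist_within (v : 'rV[R]_N) (K : set 'rV[R]_N) : K `<=` D ->
  {within K, continuous (fun y => `|F y - v|)}.
Proof.
move=> KD; apply: continuous_in_subspaceT => x; rewrite inE => /KD.
exact: dist_continuous.
Qed.

(* Newton step: moving along the preimage of [v - F c] under the differential decreases the
   distance to [v] to first order. *)
Lemma descent c v : D c -> F c != v -> exists w : 'rV[R]_N,
  \forall t \near 0^'+, `|F (c + t *: w) - v| < `|F c - v|.
Proof.
move=> Dc Fcv; set u := v - F c.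
have u0 : 0 < `|u| by rewrite normr_gt0 subr_eq0 eq_sym.
exists (u *m invmx ('J F c)); set w := _ *m _.
have dw : 'd F c w = u.
  by rewrite -deriveE ?deriveEjacobian ?mulmxKV ?jacobian_unit//; exact: dF.
have w0 : 0 < `|w| + 1 by rewrite ltr_wpDl.
have e0 : 0 < `|u| / 2 / (`|w| + 1) by rewrite !divr_gt0.
have := differentiable_eps (dF Dc) e0.
move=> /nbhs_ballP[d /= d0 dP].
have d1 : 0 < d / (`|w| + 1) by rewrite divr_gt0.
near=> t.
have t0 : 0 < t by near: t; exact: nbhs_right_gt.
have t1 : t < 1 by near: t; exact: nbhs_right_lt.
have td : t < d / (`|w| + 1) by near: t; exact: nbhs_right_lt.
have tw : ball 0 d (t *: w).
  rewrite -ball_normE /= sub0r normrN normrZ gtr0_norm//.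
  rewrite ltr_pdivlMr// in td; apply: le_lt_trans td.
  by rewrite ler_pM2l// lerDl.
have := dP _ tw; rewrite linearZ /= dw [t *: w + c]addrC normrZ gtr0_norm// => H.
have {}H : `|F (c + t *: w) - F c - t *: u| <= t * (`|u| / 2).
  apply: (le_trans H); rewrite mulrCA ler_pM2l// mulrAC.
  by rewrite ler_pdivrMr// ler_pM2l ?divr_gt0// lerDl.
have -> : F (c + t *: w) - v = (F (c + t *: w) - F c - t *: u) - (1 - t) *: u.
  by rewrite scalerBl scale1r opprB addrA subrK /u opprB addrA subrK.
rewrite (le_lt_trans (ler_normB _ _))// normrZ ger0_norm ?subr_ge0 ?ltW//.
rewrite -[ltRHS]normrN opprB -/u.
apply: (@le_lt_trans _ _ (t * (`|u| / 2) + (1 - t) * `|u|)); first by rewrite lerD2r.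
have tu : 0 < t * `|u| by rewrite mulr_gt0.
lra.
Unshelve. all: by end_near. Qed.

(** Minimize the distance from F y to v over a small closed ball around y0. For v close to F y0 the
    minimum is not attained on the sphere, and at an interior point [descent] forbids a positive
    minimum. *)
Lemma local_surj y0 r : D y0 -> 0 < r -> exists2 e, 0 < e &
  forall v, `|v - F y0| < e -> exists y, [/\ D y, `|y - y0| < r & F y = v].
Proof.
move=> Dy0 r0.
have /nbhs_ballP[r1 /= r1_gt0 r1D] : nbhs y0 D by exact: open_nbhs_nbhs.
pose q := Num.min r r1 / 2.
have q0 : 0 < q by rewrite divr_gt0// lt_min r0.
have qr : q < r by rewrite ltr_pdivrMr// (@le_lt_trans _ _ r)// ?ltr_pMr// ?ltr1n ?ge_min ?lexx.
have qr1 : q < r1 by rewrite ltr_pdivrMr// (@le_lt_trans _ _ r1)// ?ltr_pMr// ?ltr1n ?ge_min ?lexx ?orbT.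
have KD : [set y | `|y - y0| <= q] `<=` D.
  by move=> y /= yq; apply: r1D; rewrite -ball_normE /= distrC (le_lt_trans yq).
(* The distance from F y0 to the image of the sphere is positive by compactness and injectivity; the
   sphere may be empty, which happens for N = 0. *)
have [m m0 mP] : exists2 m, 0 < m & forall y, `|y - y0| = q -> m <= `|F y - F y0|.
  have [[y1 y1q]|nS] := pselect ([set y : 'rV[R]_N | `|y - y0| = q] !=set0); last first.
    by exists 1 => // y yq; case: nS; exists y.
  have [||c cS cmin] := @EVT_min_rV _ _ (fun y => `|F y - F y0|) _ _ (@sphere_compact y0 q).
    by exists y1.
    by apply: dist_within => y /= yq; apply: KD; rewrite /= yq.
  exists `|F c - F y0|; last by move=> y yq; apply: cmin; rewrite inE.
  rewrite inE /= in cS; rewrite normr_gt0 subr_eq0; apply/eqP => FF.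
  have := injF _ Dy0 FF => E; have Dc : D c by apply: KD => /=; rewrite cS.
  by move: cS; rewrite (E Dc) subrr normr0 => /eqP; rewrite lt_eqF.
(* With v within m/2 of F y0, the centre beats every point of the sphere, since these have images at
   distance at least m from F y0. *)
exists (m / 2); first by rewrite divr_gt0.
move=> v vm.
have [||c cK cmin] := @EVT_min_rV _ _ (fun y => `|F y - v|) _ _ (@closed_ball_compact y0 q).
  by exists y0 => /=; rewrite subrr normr0 ltW.
  exact: dist_within.
rewrite inE /= in cK.
have cv : `|F c - v| < m / 2.
  by apply: le_lt_trans vm; rewrite (distrC v); apply: cmin; rewrite inE /= subrr normr0 ltW.
have cq : `|c - y0| < q.
  rewrite lt_neqAle cK andbT; apply/eqP => /mP mc.
  have : `|F c - F y0| <= `|F c - v| + `|v - F y0| by exact: ler_distD.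
  lra.
exists c; split; [exact: KD|exact: lt_trans qr|].
apply/eqP/negP => /negP Fcv.
have [w wP] := descent (KD _ cK) Fcv.
have [t [t0 tK tv]] : exists t, [/\ 0 < t, `|c + t *: w - y0| <= q & `|F (c + t *: w) - v| < `|F c - v|].
  have w0 : 0 < `|w| + 1 by rewrite ltr_wpDl.
  have d0 : 0 < (q - `|c - y0|) / (`|w| + 1) by rewrite divr_gt0// subr_gt0.
  near ((0 : R)^'+) => t; exists t; split.
  - by near: t; exact: nbhs_right_gt.
  - have t0 : 0 < t by near: t; exact: nbhs_right_gt.
    have : t < (q - `|c - y0|) / (`|w| + 1) by near: t; exact: nbhs_right_lt.
    rewrite ltr_pdivlMr// => H.
    rewrite addrAC (le_trans (ler_normD _ _))// normrZ gtr0_norm//.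
    have : t * `|w| <= t * (`|w| + 1) by rewrite ler_pM2l// lerDl.
    lra.
  - by near: t.
have := cmin (c + t *: w); rewrite inE /= => /(_ tK).
by rewrite leNgt tv.
Unshelve. all: by end_near. Qed.

Definition local_inv (v : 'rV[R]_N) : 'rV[R]_N := xget 0 [set y | D y /\ F y = v].

Lemma local_invK y : D y -> local_inv (F y) = y.
Proof.
move=> Dy; rewrite /local_inv; case: xgetP => [z _ [Dz Fz]|/(_ y)[]//].
exact: injF.
Qed.

Lemma open_image : open (F @` D).
Proof.
rewrite openE => _ [y Dy <-]; rewrite /interior.
have [e e0 eP] := local_surj Dy ltr01.
apply/nbhs_ballP; exists e => // v; rewrite -ball_normE /= distrC => /eP[z [Dz _ Fz]].
by exists z.
Qed.

Lemma local_inv_diff y : D y ->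
  differentiable local_inv (F y) /\
  forall h, 'd local_inv (F y) h = h *m invmx ('J F y).
Proof.
move=> Dy; set M := 'J F y.
pose dG : {linear 'rV[R]_N -> 'rV[R]_N} := mulmxr (invmx M).
have cdG : continuous dG by exact: mulmxr_continuous.
suff [d1 d2] : differentiable local_inv (F y) /\ 'd local_inv (F y) = dG :> (_ -> _).
  by split=> // h; rewrite d2.
have [C C0 CP] : exists2 C, 0 < C & forall h, `|dG h| <= C * `|h|.
  by have := linear_lipschitz cdG => -[C C0 CP]; exists C.
apply: differentiable_of_eps => // e e0.
(* The first bound gives C ep <= 1/2, so that the error term can be absorbed and |k| <= 2 C |h|; the
   second one then bounds the remainder C ep |k| by e |h|. *)
pose ep := Num.min (1 / (2 * C)) (e / (2 * C * C)).
have ep0 : 0 < ep by rewrite lt_min !divr_gt0// !mulr_gt0.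
have epC : C * ep <= 1 / 2.
  have : ep <= 1 / (2 * C) by rewrite ge_min lexx.
  by rewrite ler_pdivlMr ?mulr_gt0//  => H; lra.
have epe : C * ep * (2 * C) <= e.
  have : ep <= e / (2 * C * C) by rewrite ge_min lexx orbT.
  by rewrite ler_pdivlMr ?mulr_gt0// => H; rewrite (_ : C * ep * (2 * C) = ep * (2 * C * C)) //; ring.
have := differentiable_eps (dF Dy) ep0 => /nbhs_ballP[r /= r0 rP].
have [d d0 dP] := local_surj Dy r0.
apply/nbhs_ballP; exists d => // h; rewrite -ball_normE /= sub0r normrN => hd.
have [|z [Dz zy Fz]] := dP (h + F y); first by rewrite addrK.
rewrite -Fz !local_invK//; set k := z - y.
have {}rP : `|F z - F y - k *m M| <= ep * `|k|.
  have := rP k; rewrite subrK -deriveE; last exact: dF.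
  rewrite deriveEjacobian; last exact: dF.
  by apply; rewrite -ball_normE /= sub0r normrN.
have hE : F z - F y = h by rewrite Fz addrK.
rewrite hE in rP.
have kE : k - dG h = - dG (h - k *m M).
  by rewrite linearB /= mulmxK ?jacobian_unit// opprB.
have H1 : `|k - dG h| <= C * ep * `|k|.
  by rewrite kE normrN (le_trans (CP _))// -mulrA ler_pM2l.
have k0 := normr_ge0 k.
have H2 : `|k| <= 2 * C * `|h|.
  have : `|k| <= `|k - dG h| + `|dG h| by rewrite -{1}(subrK (dG h) k) ler_normD.
  have := CP h.
  have : C * ep * `|k| <= 1 / 2 * `|k| by exact: ler_wpM2r.
  lra.
apply: (le_trans H1); apply: (@le_trans _ _ (C * ep * (2 * C * `|h|))).
  by rewrite ler_wpM2l// mulr_ge0// ltW.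
by rewrite mulrA ler_wpM2r.
Qed.

(** Bootstrapping: the derivative of the inverse is the inverse Jacobian evaluated at the inverse
    itself, so C^k regularity of the inverse yields C^(k+1). *)
Theorem smooth_local_inv : smooth (F @` D) local_inv.
Proof.
have oE := open_image.
elim=> [|k IH].
  move=> _ [y Dy <-]; apply: differentiable_continuous.
  exact: (local_inv_diff Dy).1.
split=> [_ [y Dy <-]|v]; first exact: (local_inv_diff Dy).1.
apply: (@eq_isCk _ _ _ _ _ (fun x => v *m invmx ('J F (local_inv x))) _ oE).
  move=> _ [y Dy <-]; rewrite deriveE; last exact: (local_inv_diff Dy).1.
  by rewrite (local_inv_diff Dy).2 local_invK.
apply: isCk_mx => // i j.
apply: (@eq_isCk _ _ _ _ _ (fun x => \sum_l v i l * invmx ('J F (local_inv x)) l j) _ oE).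
  by move=> x _; rewrite [RHS]mxE.
apply: isCk_sum => // l _; apply: isCkM => //; first exact: isCk_cst.
have ED x : (F @` D) x -> D (local_inv x) by move=> [y Dy <-]; rewrite local_invK.
apply: isCk_invmx => // [x Ex|a b]; first by apply: jacobian_unit; exact: ED.
apply: (@isCk_comp _ _ _ _ _ D local_inv (fun y => 'J F y a b)) => //.
have [_ /(_ (delta_mx 0 a))] := smF k.+1.
move=> /(isCk_coord 0 b oD); apply: eq_isCk => // y Dy.
by rewrite deriveEjacobian; [rewrite -rowE mxE|exact: dF].
Qed.

End InverseFunction.

(** * Minors *)

Section CauchyBinet.
Variable K : comNzRingType.

Lemma det_col_mx_mul a n k (X : 'M[K]_(a, n)) (A : 'M[K]_(n, a + k)) (Y : 'M[K]_(k, a + k)) :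
  \det (col_mx (X *m A) Y) =
  \sum_(f : {ffun 'I_a -> 'I_n}) (\prod_i X i (f i)) * \det (col_mx (rowsub f A) Y).
Proof.
transitivity (\sum_(f : {ffun 'I_a -> 'I_n}) \sum_(s : 'S_(a + k))
   (-1) ^+ s * ((\prod_i (X i (f i) * A (f i) (s (lshift k i)))) *
                \prod_(i < k) Y i (s (rshift a i)))); last first.
  apply: eq_bigr => f _; rewrite big_distrr /=; apply: eq_bigr => s _.
  rewrite [RHS]mulrCA; congr (_ * _); rewrite big_split /= -mulrA; congr (_ * _).
  rewrite big_split_ord /=; congr (_ * _); apply: eq_bigr => i _.
    by rewrite col_mxEu !mxE.
  by rewrite col_mxEd.
rewrite exchange_big /=; apply: eq_bigr => s _; rewrite -big_distrr /=; congr (_ * _).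
rewrite -big_distrl /= big_split_ord /=; congr (_ * _); last first.
  by apply: eq_bigr => i _; rewrite col_mxEd.
rewrite -(bigA_distr_bigA (fun i j => X i j * A j (s (lshift k i)))) /=.
by apply: eq_bigr => i _; rewrite col_mxEu mxE.
Qed.

Lemma det_col_mx_rowsub_perm a n k (A : 'M[K]_(n, a + k)) (Y : 'M[K]_(k, a + k))
    (f : {ffun 'I_a -> 'I_n}) (s : 'S_a) :
  \det (col_mx (rowsub [ffun i => f (s i)] A) Y) = (-1) ^+ s * \det (col_mx (rowsub f A) Y).
Proof.
have -> : col_mx (rowsub [ffun i => f (s i)] A) Y =
    block_mx (perm_mx s) 0 0 1%:M *m col_mx (rowsub f A) Y.
  rewrite mul_block_col !mul0mx addr0 add0r mul1mx -row_permE; congr (col_mx _ _).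
  by apply/matrixP => i j; rewrite !mxE ffunE.
by rewrite det_mulmx det_ublock det1 mulr1 det_perm.
Qed.

(* Cauchy-Binet with the rows [Y] as spectators; summing over all maps instead
   of all subsets costs the factor [a`!]. *)
Lemma partial_Cauchy_Binet a n k (X : 'M[K]_(a, n)) (A : 'M[K]_(n, a + k)) (Y : 'M[K]_(k, a + k)) :
  \det (col_mx (X *m A) Y) *+ a`! =
  \sum_(f : {ffun 'I_a -> 'I_n}) \det (colsub f X) * \det (col_mx (rowsub f A) Y).
Proof.
transitivity (\sum_(s : 'S_a) \det (col_mx (X *m A) Y)).
  by rewrite sumr_const card_Sn.
transitivity (\sum_(s : 'S_a) \sum_(f : {ffun 'I_a -> 'I_n})
    (-1) ^+ s * (\prod_i X i (f (s i))) * \det (col_mx (rowsub f A) Y)); last first.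
  rewrite exchange_big /=; apply: eq_bigr => f _; rewrite -big_distrl /=.
  congr (_ * _); apply: eq_bigr => s _; congr (_ * _).
  by apply: eq_bigr => i _; rewrite mxE.
apply: eq_bigr => s _; rewrite det_col_mx_mul.
pose c (t : 'S_a) (f : {ffun 'I_a -> 'I_n}) : {ffun 'I_a -> 'I_n} := [ffun i => f (t i)].
have cK t : cancel (c t) (c t^-1%g) by move=> f; apply/ffunP => i; rewrite !ffunE permKV.
have cKV t : cancel (c t^-1%g) (c t) by move=> f; apply/ffunP => i; rewrite !ffunE permK.
rewrite (reindex (c s)) /=; last by exists (c s^-1%g) => f _; [exact: cK|exact: cKV].
apply: eq_bigr => f _; rewrite det_col_mx_rowsub_perm mulrA; congr (_ * _).
rewrite mulrC; congr (_ * _).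
by apply: eq_bigr => i _; rewrite ffunE.
Qed.

End CauchyBinet.

Section Minors.
Variable K : comNzRingType.
Implicit Types (A : nat -> nat -> K) (s p q : seq nat).

(* [Delta] with the row set given as a sequence, so that rows may be permuted and repeated. *)
Definition mnr A s : K :=
  \det (\matrix_(i < size s, j < size s) A (nth 0 s i) j).

Lemma mnrE m A s : size s = m ->
  mnr A s = \det (\matrix_(i < m, j < m) A (nth 0 s i) j).
Proof. by move=> <-. Qed.

Lemma mnr_nil A : mnr A [::] = 1.
Proof. by rewrite /mnr det_mx00. Qed.

Lemma nth_swap p q x y i : nth 0%N (p ++ x :: y :: q) i =
  nth 0%N (p ++ y :: x :: q) (if i == size p then i.+1 else if i == (size p).+1 then size p else i).
Proof.
rewrite !nth_cat; case: eqP => [->|i1]; first by rewrite ltnn ltnNge leqnSn subnn subSnn.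
case: eqP => [->|i2]; first by rewrite ltnn ltnNge leqnSn subnn subSnn.
case: ltnP => // pi; have : (1 < i - size p)%N by lia.
by case: (i - size p)%N => [|[|?]].
Qed.

Lemma mnr_swap A p q x y : mnr A (p ++ x :: y :: q) = - mnr A (p ++ y :: x :: q).
Proof.
set m := size (p ++ x :: y :: q).
have i1P : (size p < m)%N by rewrite /m size_cat /=; lia.
have i2P : ((size p).+1 < m)%N by rewrite /m size_cat /=; lia.
pose i1 := Ordinal i1P; pose i2 := Ordinal i2P.
rewrite (@mnrE m _ (p ++ y :: x :: q)); last by rewrite /m !size_cat.
rewrite /mnr -/m; set M1 := \matrix_(_, _) _; set M2 := \matrix_(_, _) _.
have -> : M1 = xrow i1 i2 M2.
  apply/matrixP => i j; rewrite !mxE nth_swap; congr (A _ _); congr (nth _ _ _).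
  case: tpermP => [->|->|/eqP n1 /eqP n2] /=.
  - by rewrite eqxx.
  - by rewrite eqxx ifN// gtn_eqF.
  - by rewrite ifN//= ifN//.
rewrite xrowE det_mulmx det_perm odd_tperm.
by rewrite -val_eqE /= ltn_eqF// mulN1r.
Qed.

Lemma mnr_move A p s q x :
  mnr A (p ++ x :: s ++ q) = (-1) ^+ size s * mnr A (p ++ s ++ x :: q).
Proof.
elim: s p => [|y s IH] p /=; first by rewrite expr0 mul1r.
by rewrite mnr_swap -cat_rcons IH cat_rcons exprS mulN1r mulNr.
Qed.

Lemma mnr_dup A s : ~~ uniq s -> mnr A s = 0.
Proof.
move=> /(uniqPn 0%N) [i [j [ij js E]]].
have is_ : (i < size s)%N by exact: ltn_trans js.
apply: (@determinant_alternate _ _ _ (Ordinal is_) (Ordinal js)).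
  by rewrite -val_eqE /= ltn_eqF.
by move=> l; rewrite !mxE /= E.
Qed.

(** The sign is chosen before [A] and [p]: the same sign must serve for all matrices and for the
    sequence with or without a prefix. *)
Lemma mnr_sort s : exists b : nat, forall A p,
  mnr A (p ++ s) = (-1) ^+ b * mnr A (p ++ sort leq s).
Proof.
have ins x t : exists t1 t2, t = t1 ++ t2 /\ forall (st : sorted leq t),
    sorted leq (t1 ++ x :: t2).
  elim: t => [|y t [t1 [t2 [-> IH]]]]; first by exists [::], [::].
  case: (leqP x y) => xy.
    by exists [::], (y :: t1 ++ t2); split=> //= st; rewrite xy.
  exists (y :: t1), t2; split=> //= st.
  have : sorted leq (t1 ++ x :: t2) by apply: IH; apply: path_sorted st.
  case: t1 st {IH} => [|z t1] /= st; first by rewrite (ltnW xy).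
  by case/andP: st => -> _.
elim: s => [|x s [b IH]]; first by exists 0%N => A p; rewrite expr0 mul1r.
have [t1 [t2 [E st]]] := ins x (sort leq s).
exists (b + size t1)%N => A p.
have -> : sort leq (x :: s) = t1 ++ x :: t2.
  apply: (sorted_eq leq_trans anti_leq); first exact: (sort_sorted leq_total).
    by apply: st; exact: (sort_sorted leq_total).
  by rewrite perm_sort perm_sym -cat1s perm_catCA -E /= perm_cons perm_sort.
by rewrite -cat_rcons IH cat_rcons E mnr_move exprD mulrA.
Qed.

(* The rows of a square matrix and a further vector [v] satisfy Cramer's linear relation;
   apply to it a further minor with the last column replaced by a unit vector. *)
Lemma mnr_plucker A s i j l :
  mnr A (rcons s j) * mnr A (s ++ [:: i; l]) =
  mnr A (rcons s i) * mnr A (s ++ [:: j; l]) + mnr A (rcons s l) * mnr A (s ++ [:: i; j]).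
Proof.
set m := size s.
pose B (u : nat -> 'rV[K]_(m + 2)) (v w : 'rV[K]_(m + 2)) : 'M[K]_(m + 2) :=
  \matrix_(a, b) (if (a < m)%N then u a 0 b else if a == m :> nat then v 0 b else w 0 b).
pose rw x : 'rV[K]_(m + 2) := \row_b A x b.
pose S0 a := rw (nth 0%N s a).
(* With [e] as last row, expansion removes the last column, so the smaller minors are values of [om]
   too. *)
pose e : 'rV[K]_(m + 2) := delta_mx 0 (rshift m (inord 1)).
pose om v w := \det (B S0 v w).
have omE x y : mnr A (s ++ [:: x; y]) = om (rw x) (rw y).
  rewrite (@mnrE (m + 2)); last by rewrite size_cat.
  congr (\det _); apply/matrixP => a b; rewrite !mxE nth_cat -/m.
  case: ltnP => // ma; have ha := ltn_ord a; case: eqP => [->|/eqP ne]; first by rewrite subnn.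
  by rewrite (_ : (a - m)%N = 1%N)//; lia.
have omI x : mnr A (rcons s x) = om (rw x) e.
  rewrite /om (expand_det_row _ (rshift m (inord 1))) (bigD1 (rshift m (inord 1)))//=.
  rewrite big1 ?addr0; last first.
    move=> b nb; rewrite mxE ifN ?ifN; last by rewrite /= inordK//; lia.
      by rewrite mxE eqxx (negbTE nb) mul0r.
    by rewrite /= inordK//; lia.
  rewrite mxE ifN ?ifN; [|by rewrite /= inordK//; lia|by rewrite /= inordK//; lia].
  rewrite mxE !eqxx mul1r /cofactor /= !inordK// addnn -signr_odd odd_double expr0 mul1r.
  rewrite (@mnrE (m + 2).-1); last by rewrite size_rcons addn2.
  congr (\det _); apply/matrixP => a b; rewrite !mxE /= !inordK// nth_rcons -/m.
  have ha : (a < m.+1)%N by have := ltn_ord a; lia.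
  have hb : (b < m.+1)%N by have := ltn_ord b; lia.
  have -> : bump (m + 1) a = a by rewrite /bump; case: leqP => *; lia.
  have -> : bump (m + 1) b = b by rewrite /bump; case: leqP => *; lia.
  by case: ltnP => // ma; case: eqP => // ne; lia.
rewrite !omE !omI.
set u := rw i; set v := rw j; set w := rw l.
pose M := B S0 u w.
(* By Cramer, the coefficients on the right are determinants of [M] with one row replaced by [v];
   the linear form [L] is now applied to both sides. *)
have cramer : om u w *: v = v *m \adj M *m M.
  by rewrite -mulmxA mul_adj_mx mul_mx_scalar.
pose L (x : 'rV[K]_(m + 2)) : K := om x e.
have omL x : om x e = \sum_b x 0 b * cofactor (B S0 0 e) (rshift m (inord 0)) b.
  rewrite /om (expand_det_row _ (rshift m (inord 0))); apply: eq_bigr => b _.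
  rewrite mxE /= inordK// addn0 ltnn eqxx; congr (_ * _).
  rewrite /cofactor; congr (_ * \det _); apply/matrixP => a c; rewrite !mxE.
  case: ltnP => // h1; case: eqP => // h2; exfalso; move: h2.
  rewrite /= inordK// addn0 => h2; have := neq_bump m a; rewrite /= h2 eqxx //.
have LZ c x : L (c *: x) = c * L x.
  by rewrite /L !omL big_distrr /=; apply: eq_bigr => b _; rewrite mxE mulrA.
have LD (I : finType) (F : I -> 'rV_(m + 2)) : L (\sum_c F c) = \sum_c L (F c).
  rewrite /L omL; under eq_bigr do rewrite summxE big_distrl /=.
  by rewrite exchange_big /=; apply: eq_bigr => c _; rewrite omL.
have := congr1 L cramer; rewrite LZ mulmx_sum_row LD.
under eq_bigr do rewrite LZ.
have adjE c : (v *m \adj M) 0 c = \det (\matrix_(a, b) if a == c then v 0 b else M a b).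
  rewrite mxE (expand_det_row _ c); apply: eq_bigr => b _.
  rewrite !mxE eqxx; congr (_ * _); rewrite /cofactor; congr (_ * \det _).
  apply/matrixP => a d; rewrite !mxE.
  by rewrite [lift c a == c]eq_sym (negbTE (neq_lift c a)) ?mxE.
(* [L] vanishes on the rows coming from [s], as they repeat a row; only the rows [u] and [w] remain,
   which gives the two terms on the right. *)
rewrite big_split_ord /= big1 ?add0r; last first.
  move=> c _; rewrite [X in _ * X](_ : _ = 0) ?mulr0// /L.
  have im : (m < m + 2)%N by lia.
  apply: (@determinant_alternate _ _ _ (lshift 2 c) (Ordinal im)).
    by rewrite -val_eqE /= ltn_eqF.
  have cm := ltn_ord c.
  by move=> b; rewrite !mxE /= ?cm ?ltnn ?eqxx ?mxE /= ?cm.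
rewrite big_ord_recl big_ord1 /= => H.
rewrite mulrC; move: H; rewrite /L => ->.
have rM0 : row (rshift m ord0) M = u.
  by apply/rowP => b; rewrite !mxE /= addn0 ltnn eqxx ?mxE.
have rM1 : row (rshift m (lift ord0 ord0)) M = w.
  apply/rowP => b; rewrite !mxE /= /bump /= addn1 ifN ?ifN -?leqNgt ?leqnSn// ?mxE// gtn_eqF//.
rewrite rM0 rM1 !adjE; congr (_ + _); rewrite mulrC; congr (_ * _).
  congr (\det _); apply/matrixP => a b; rewrite !mxE -val_eqE /= addn0.
  case: (ltnP a m) => h; first by rewrite ltn_eqF.
  by case: eqP.
congr (\det _); apply/matrixP => a b; rewrite !mxE -val_eqE /= /bump /= addn1.
case: (ltnP a m) => h; first by rewrite ltn_eqF// ltnW.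
have ha := ltn_ord a; have [->|/eqP ne] := eqVneq (a : nat) m; first by rewrite ltn_eqF.
by rewrite (_ : (a == m.+1 :> nat) = true)//; lia.
Qed.

Lemma mnr_catC A s t : mnr A (s ++ t) = (-1) ^+ (size s * size t) * mnr A (t ++ s).
Proof.
suff H p : mnr A (p ++ s ++ t) = (-1) ^+ (size s * size t) * mnr A (p ++ t ++ s) by exact: (H [::]).
elim: s p => [|x s IH] p /=; first by rewrite mul0n expr0 mul1r cats0.
by rewrite -cat_rcons IH cat_rcons mnr_move mulrA -exprD mulSn addnC.
Qed.

Lemma det_scale n (c d : 'I_n -> K) (M : 'M[K]_n) :
  \det (\matrix_(i, j) (c i * d j * M i j)) = \prod_i c i * \prod_i d i * \det M.
Proof.
have -> : \matrix_(i, j) (c i * d j * M i j) =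
    diag_mx (\row_i c i) *m M *m diag_mx (\row_i d i).
  by apply/matrixP => i j; rewrite mul_mx_diag mul_diag_mx !mxE mulrAC.
rewrite !det_mulmx !det_diag mulrAC; congr (_ * _ * _);
  by apply: eq_bigr => i _; rewrite mxE.
Qed.

End Minors.

Lemma sorted_ltn_eq (s t : seq nat) : sorted ltn s -> sorted ltn t -> s =i t -> s = t.
Proof. exact: (irr_sorted_eq ltn_trans ltnn). Qed.

Lemma sign_cancel (K : comNzRingType) (e e' a b c d f g : K) :
  e * e = 1 -> e' * e' = 1 ->
  e' * a * (e * b) = e * c * (e' * d) + f * (e * (e' * g)) -> a * b = c * d + f * g.
Proof.
move=> ee ee' H; have -> : a * b = e * e' * (e' * a * (e * b)).
  rewrite (_ : _ * (_ * _) = (e * e) * (e' * e') * (a * b)); last by ring.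
  by rewrite ee ee' !mul1r.
rewrite H (_ : _ * (_ + _) = (e * e) * (e' * e') * (c * d + f * g)); last by ring.
by rewrite ee ee' !mul1r.
Qed.

(** Induction on the length of a window containing the rows. If both ends lo, hi occur but some
    inner j is missing, let t be the remaining rows. Up to sorting, the three-term relation reads
    [t j][lo t hi] = [lo t][t j hi] + [t hi][lo t j], and every minor except the wanted [lo t hi]
    lies in a shorter window, hence is positive. *)
Lemma interval_minors_gt0 (K : numFieldType) (A : nat -> nat -> K) n :
  (forall a k, (a + k <= n)%N -> 0 < mnr A (iota a k)) ->
  forall s, sorted ltn s -> all (fun i => i < n)%N s -> 0 < mnr A s.
Proof.
move=> Aint s ss sn.
suff H d lo : (lo + d <= n)%N -> forall s, sorted ltn s ->
    (forall z, z \in s -> lo <= z < lo + d)%N -> 0 < mnr A s.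
  by apply: (H n 0%N) => // z zs; rewrite add0n (allP sn).
elim: d lo {s ss sn} => [|d IH] lo lon s ss sd.
  case: s ss sd => [|x s] _ sd; first by rewrite mnr_nil.
  by have := sd x (mem_head _ _); lia.
have [lo_s|lo_s] := boolP (lo \in s); last first.
  apply: (IH lo.+1) => // [|z zs]; first lia.
  have := sd z zs; have : z != lo by apply: contraNneq lo_s => <-.
  lia.
have [hi_s|hi_s] := boolP ((lo + d)%N \in s); last first.
  apply: (IH lo) => // [|z zs]; first lia.
  have := sd z zs; have : z != (lo + d)%N by apply: contraNneq hi_s => <-.
  lia.
have [full|] := boolP (all (mem s) (iota lo d.+1)).
  rewrite (_ : s = iota lo d.+1); first exact: Aint.
  apply: sorted_ltn_eq => //; first exact: iota_ltn_sorted.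
  move=> z; apply/idP/idP => [/sd|/(allP full)//].
  by rewrite mem_iota.
move=> /allPn[j]; rewrite mem_iota => jd js.
have jlo : j != lo by apply: contraNneq js => ->.
have jhi : j != (lo + d)%N by apply: contraNneq js => ->.
have {}jd : (lo < j < lo + d)%N by lia.
have ps : pairwise ltn s by rewrite -sorted_pairwise//; exact: ltn_trans.
pose t1 := [seq z <- s | (lo < z < j)%N]; pose t2 := [seq z <- s | (j < z < lo + d)%N].
have t1P z : z \in t1 -> (lo < z < j)%N by rewrite mem_filter => /andP[].
have t2P z : z \in t2 -> (j < z < lo + d)%N by rewrite mem_filter => /andP[].
have p1 : pairwise ltn t1 by exact: pairwise_filter.
have p2 : pairwise ltn t2 by exact: pairwise_filter.
have pw2 q1 q2 x : (forall z, z \in q1 -> z < x)%N -> (forall z, z \in q2 -> x < z)%N ->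
    pairwise ltn q1 -> pairwise ltn q2 -> pairwise ltn (q1 ++ x :: q2).
  move=> q1x q2x pq1 pq2; rewrite pairwise_cat pq1 /= pq2 andbT; apply/andP; split.
    apply/allrelP => y z /q1x yx; rewrite inE => /predU1P[->//|/q2x]; exact: ltn_trans.
  by apply/allP => z /q2x.
have pw q1 q2 : (forall y z, y \in q1 -> z \in q2 -> y < z)%N ->
    pairwise ltn q1 -> pairwise ltn q2 -> pairwise ltn (q1 ++ q2).
  move=> q12 pq1 pq2; rewrite pairwise_cat pq1 pq2 !andbT.
  by apply/allrelP => y z; exact: q12.
have ptt : pairwise ltn (t1 ++ t2).
  by apply: pw => // y z /t1P + /t2P; clear; lia.
have ptj : pairwise ltn (t1 ++ j :: t2).
  by apply: pw2 => // z => [/t1P|/t2P]; clear; lia.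
have memtt z : z \in t1 ++ t2 -> (lo < z < lo + d)%N.
  by rewrite mem_cat => /orP[/t1P|/t2P]; move: jd; clear; lia.
have memtj z : z \in t1 ++ j :: t2 -> (lo < z < lo + d)%N.
  by rewrite mem_cat inE => /or3P[/t1P|/eqP ->|/t2P]; move: jd; clear; lia.
have srt q : pairwise ltn q -> sorted ltn q by rewrite -sorted_pairwise//; exact: ltn_trans.
have sE : s = lo :: (t1 ++ t2) ++ [:: (lo + d)%N].
  apply: sorted_ltn_eq => //.
    apply: srt; apply: (pw [:: lo]) => //.
      move=> y z; rewrite inE => /eqP ->; rewrite mem_cat inE => /orP[/memtt|/eqP ->]; move: jd; clear; lia.
    by apply: pw => // y z /memtt + /[!inE] /eqP ->; clear; lia.
  move=> z; rewrite inE !mem_cat inE !mem_filter.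
  apply/idP/idP => [zs|].
    have := sd z zs; rewrite zs !andbT.
    have : z != j by apply: contraNneq js => <-.
    by clear; lia.
  by case/predU1P => [->//|/orP[/orP[]/andP[]//|/eqP ->]].
pose e : K := (-1) ^+ size (t1 ++ t2); pose e2 : K := (-1) ^+ size t2.
have ee : e * e = 1 by rewrite /e -expr2 sqrr_sign.
have ee2 : e2 * e2 = 1 by rewrite /e2 -expr2 sqrr_sign.
have mv x q : mnr A ((t1 ++ t2) ++ x :: q) = e * mnr A (x :: (t1 ++ t2) ++ q).
  by rewrite [in RHS](mnr_move A [::]) mulrA ee mul1r.
have mvj p q : mnr A (p ++ (t1 ++ t2) ++ j :: q) = e2 * mnr A ((p ++ t1 ++ j :: t2) ++ q).
  by rewrite -!catA [in RHS]catA /= mnr_move mulrA ee2 mul1r -!catA.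
have pl : mnr A (t1 ++ j :: t2) * mnr A s =
    mnr A (lo :: t1 ++ t2) * mnr A ((t1 ++ j :: t2) ++ [:: (lo + d)%N]) +
    mnr A ((t1 ++ t2) ++ [:: (lo + d)%N]) * mnr A (lo :: t1 ++ j :: t2).
  have h1 : mnr A (rcons (t1 ++ t2) j) = e2 * mnr A (t1 ++ j :: t2).
    by rewrite -cats1; have := mvj [::] [::]; rewrite cats0.
  have h3 : mnr A (rcons (t1 ++ t2) lo) = e * mnr A (lo :: t1 ++ t2).
    by rewrite -cats1 mv cats0.
  have h4 := mvj [::] [:: (lo + d)%N].
  have h6 : mnr A ((t1 ++ t2) ++ [:: lo; j]) = e * (e2 * mnr A (lo :: t1 ++ j :: t2)).
    by rewrite mv; have := mvj [:: lo] [::]; rewrite cats0 /= => <-.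
  have := mnr_plucker A (t1 ++ t2) lo j (lo + d).
  rewrite -(cats1 _ (lo + d)%N) h1 h3 h6 mv -sE h4 => pl.
  exact: sign_cancel ee ee2 pl.
have lo1 : (lo.+1 + d <= n)%N by rewrite addSnnS.
have lo0 : (lo + d <= n)%N by exact: leq_trans (leq_addl 1 _) lo1.
have mem1 z : (lo < z < lo + d)%N -> (lo < z < lo.+1 + d)%N by clear; lia.
have mem0 z : (lo < z < lo + d)%N -> (lo <= z < lo + d)%N by clear; lia.
have lod : (lo < lo + d)%N by case/andP: jd => /ltn_trans h /h.
have lom : (lo <= lo < lo + d)%N by rewrite leqnn.
have him : (lo < lo + d < lo.+1 + d)%N by rewrite lod addSn ltnSn.
have pos1 : 0 < mnr A (t1 ++ j :: t2).
  by apply: (IH lo.+1) => // [|z /memtj/mem1//]; exact: srt.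
rewrite -(pmulr_rgt0 _ pos1) pl addr_gt0// mulr_gt0//.
- apply: (IH lo) => // [|z].
    by apply: srt; apply: (pw [:: lo]) => // y z; rewrite inE => /eqP -> /memtt/andP[].
  by rewrite inE => /predU1P[->|/memtt/mem0].
- apply: (IH lo.+1) => // [|z].
    by apply: srt; apply: pw => // y z /memtj/andP[_ yP]; rewrite inE => /eqP ->.
  by rewrite mem_cat inE => /orP[/memtj/mem1|/eqP ->].
- apply: (IH lo.+1) => // [|z].
    by apply: srt; apply: pw => // y z /memtt/andP[_ yP]; rewrite inE => /eqP ->.
  by rewrite mem_cat inE => /orP[/memtt/mem1|/eqP ->].
- apply: (IH lo) => // [|z].
    by apply: srt; apply: (pw [:: lo]) => // y z; rewrite inE => /eqP -> /memtj/andP[].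
  by rewrite inE => /predU1P[->|/memtj/mem0].
Qed.

(** * Translation between matrices, maps, sets and sequences of row indices *)

Section Entries.
Variable K : comNzRingType.

(** Indexed by [nat] with value 0 outside of the matrix, so that minors along arbitrary sequences
    carry no bounds in their types. *)
Definition ent n (g : 'M[K]_n) (i j : nat) : K :=
  if (insub i : option 'I_n, insub j : option 'I_n) is (Some i', Some j') then g i' j' else 0.

Lemma ent_ord n (g : 'M[K]_n) (i j : 'I_n) : ent g i j = g i j.
Proof. by rewrite /ent !valK. Qed.

Lemma entE n (g : 'M[K]_n) i j (hi : (i < n)%N) (hj : (j < n)%N) :
  ent g i j = g (Ordinal hi) (Ordinal hj).
Proof. by rewrite -ent_ord. Qed.

Lemma ent_out n (g : 'M[K]_n) i j : (n <= i)%N || (n <= j)%N -> ent g i j = 0.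
Proof.
rewrite /ent; case: insubP => [i' hi Ei|//]; case: insubP => [j' hj Ej|//].
by move=> /orP[ni|nj]; [move: hi; rewrite ltnNge ni|move: hj; rewrite ltnNge nj].
Qed.

Definition fseq a n (f : 'I_a -> 'I_n) : seq nat := [seq val (f i) | i <- enum 'I_a].

Lemma size_fseq a n (f : 'I_a -> 'I_n) : size (fseq f) = a.
Proof. by rewrite size_map size_enum_ord. Qed.

Lemma nth_fseq a n (f : 'I_a -> 'I_n) (i : 'I_a) : nth 0%N (fseq f) i = f i.
Proof. by rewrite (nth_map i) ?size_enum_ord// nth_ord_enum. Qed.

Lemma fseq_lt a n (f : 'I_a -> 'I_n) : all (fun i => i < n)%N (fseq f).
Proof. by apply/allP => _ /mapP[i _ ->]; exact: ltn_ord. Qed.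

Lemma fseq_onto n s : all (fun i => i < n)%N s ->
  exists f : {ffun 'I_(size s) -> 'I_n}, fseq f = s.
Proof.
move=> /allP sn; have h (i : 'I_(size s)) : (nth 0%N s i < n)%N by apply: sn; rewrite mem_nth.
exists [ffun i => Ordinal (h i)]; apply: (@eq_from_nth _ 0%N); first by rewrite size_fseq.
rewrite size_fseq => i hi.
by rewrite (nth_fseq _ (Ordinal hi)) ffunE.
Qed.

Definition sseq n (I : {set 'I_n}) : seq nat := map val (enum I).

Lemma size_sseq n (I : {set 'I_n}) : size (sseq I) = #|I|.
Proof. by rewrite size_map -cardE. Qed.

Lemma sseq_sorted n (I : {set 'I_n}) : sorted ltn (sseq I).
Proof.
rewrite sorted_map /enum_mem; apply: sorted_filter; first by move=> x y z; exact: ltn_trans.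
by rewrite -enumT -sorted_map val_enum_ord; exact: iota_ltn_sorted.
Qed.

Lemma sseq_lt n (I : {set 'I_n}) : all (fun i => i < n)%N (sseq I).
Proof. by apply/allP => _ /mapP[i _ ->]; exact: ltn_ord. Qed.

Lemma mem_sseq n (I : {set 'I_n}) (i : 'I_n) : (val i \in sseq I) = (i \in I).
Proof. by rewrite mem_map ?mem_enum//; exact: val_inj. Qed.

Lemma sseq_onto n s : sorted ltn s -> all (fun i => i < n)%N s ->
  exists I : {set 'I_n}, sseq I = s.
Proof.
move=> ss /allP sn; exists [set i : 'I_n | val i \in s]%SET.
apply: sorted_ltn_eq => //; first exact: sseq_sorted.
move=> x; apply/idP/idP => [/mapP[i + ->]|xs]; first by rewrite mem_enum inE.
by rewrite -[x]/(val (Ordinal (sn _ xs))) mem_sseq inE.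
Qed.

End Entries.

Lemma DeltaE (R : realType) n (I : {set 'I_n}) (g : 'M[R[i]]_n) : Delta I g = mnr (ent g) (sseq I).
Proof.
rewrite (@mnrE _ #|I|) ?size_sseq//; congr (\det _); apply/matrixP => i j; rewrite !mxE.
have -> : nth 0%N (sseq I) i = enum_val i.
  by rewrite (enum_val_nth (enum_val i)) (nth_map (enum_val i))// -cardE.
by rewrite -(ent_ord g).
Qed.

(** * Minors of unitary matrices and the map iota *)

Section UnitaryMinors.
Variable C : numClosedFieldType.
Local Notation "z ^*" := (Num.conj z).

Lemma unitary_cols n (h : 'M[C]_n) (i j : 'I_n) : h \is unitarymx ->
  \sum_l (h l i)^* * h l j = (i == j)%:R.
Proof.
rewrite -trmxC_unitary => /unitarymxP/matrixP/(_ i j).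
rewrite !mxE => <-; apply: eq_bigr => l _; rewrite !mxE.
by rewrite conjCK.
Qed.

(** Expresses a minor in the columns a, ..., a+k-1 through minors in initial columns. Let X be the
    conjugate transpose of the first a columns and A the first a+k columns; orthonormality gives X A
    = (1 | 0), so the determinant with the rows [r] below X A is the wanted minor, and partial
    Cauchy-Binet expands it. *)
Lemma unitary_minor n (h : 'M[C]_n) a k r : h \is unitarymx -> (a + k <= n)%N -> size r = k ->
  \det (\matrix_(i < k, j < k) ent h (nth 0%N r i) (a + j)) *+ a`! =
  \sum_(f : {ffun 'I_a -> 'I_n}) (mnr (ent h) (fseq f))^* * mnr (ent h) (fseq f ++ r).
Proof.
move=> hu akn rk.
have an : (a <= n)%N by exact: leq_trans (leq_addr _ _) akn.
pose X : 'M[C]_(a, n) := \matrix_(i, l) (h l (widen_ord an i))^*.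
pose A : 'M[C]_(n, a + k) := \matrix_(l, j) h l (widen_ord akn j).
pose Y : 'M[C]_(k, a + k) := \matrix_(i, j) ent h (nth 0%N r i) j.
have -> : \det (\matrix_(i < k, j < k) ent h (nth 0%N r i) (a + j)) = \det (col_mx (X *m A) Y).
  rewrite -[Y]hsubmxK (_ : X *m A = row_mx 1%:M 0).
    rewrite -[col_mx _ _]/(block_mx _ _ _ _) det_lblock det1 mul1r; congr (\det _).
    by apply/matrixP => i j; rewrite !mxE.
  apply/matrixP => i j; rewrite mxE.
  under eq_bigr do rewrite !mxE.
  rewrite unitary_cols//; case: (split_ordP j) => j' ->.
    by rewrite row_mxEl mxE.
  rewrite row_mxEr mxE -val_eqE /=; have := ltn_ord i.
  by case: eqP => // ->; rewrite ltnNge leq_addr.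
rewrite partial_Cauchy_Binet; apply: eq_bigr => f _; congr (_ * _).
  rewrite (@mnrE _ a) ?size_fseq// -det_map_mx -det_tr; congr (\det _).
  apply/matrixP => i j; rewrite !mxE nth_fseq; congr (_^*).
  by rewrite -ent_ord.
rewrite (@mnrE _ (a + k)) ?size_cat ?size_fseq ?rk//; congr (\det _).
apply/matrixP => i j; rewrite [RHS]mxE nth_cat size_fseq; case: (split_ordP i) => i' ->.
  by rewrite col_mxEu !mxE -[nth _ _ _]/(nth 0%N (fseq f) i') nth_fseq -ent_ord.
by rewrite col_mxEd mxE /= addKn.
Qed.

(** The case k = 1, through which a unitary matrix is reconstructed from its minors in initial
    columns. *)
Lemma unitary_entry n (h : 'M[C]_n) i (a : 'I_n) : h \is unitarymx ->
  ent h i a *+ a`! =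
  \sum_(f : {ffun 'I_a -> 'I_n}) (mnr (ent h) (fseq f))^* * mnr (ent h) (rcons (fseq f) i).
Proof.
move=> hu; have an : (a + 1 <= n)%N by rewrite addn1.
have := @unitary_minor n h a 1 [:: i] hu an erefl.
by rewrite det_mx11 mxE /= addn0 => ->; under eq_bigr do rewrite cats1.
Qed.

(** The case k = 0. *)
Lemma unitary_minors_norm n (h : 'M[C]_n) a : h \is unitarymx -> (a <= n)%N ->
  \sum_(f : {ffun 'I_a -> 'I_n}) `|mnr (ent h) (fseq f)| ^+ 2 = (a`!)%:R.
Proof.
move=> hu an; have an0 : (a + 0 <= n)%N by rewrite addn0.
have := @unitary_minor n h a 0 [::] hu an0 erefl.
rewrite det_mx00 => ->; apply: eq_bigr => f _; rewrite cats0.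
by rewrite normCK mulrC.
Qed.

Lemma det_conj_sign k a (M : 'M[C]_k) :
  \det (\matrix_(i < k, j < k) ((-1) ^+ (a + i) * (-1) ^+ j * (M j i)^*)) =
  (-1) ^+ (a * k) * (\det M)^*.
Proof.
rewrite -det_map_mx -det_tr.
transitivity (\prod_(i < k) ((-1) ^+ (a + i) : C) * \prod_(i < k) (-1) ^+ i *
    \det (map_mx Num.conj M)^T).
  by rewrite -det_scale -det_tr; congr (\det _); apply/matrixP => i j; rewrite !mxE.
rewrite !det_tr; congr (_ * _); rewrite -big_split /= (eq_bigr (fun=> (-1) ^+ a)).
  by rewrite prodr_const card_ord exprM.
by move=> i _; rewrite exprD -mulrA -expr2 sqrr_sign mulr1.
Qed.

End UnitaryMinors.

(** * Signs and positivity of the minors of iota(g) *)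

Section TwistMinors.
Variable R : realType.
Local Notation C := R[i].
Local Notation "z ^*" := (Num.conj z).

Lemma iota_invE n (g : 'M[C]_n) i j : g \is unitarymx ->
  iota_inv g i j = (-1) ^+ i * (-1) ^+ j * (g j i)^*.
Proof.
move=> gu; rewrite /iota_inv invmx_unitary// /delta_alt mul_mx_diag mul_diag_mx !mxE.
by rewrite mulrAC.
Qed.

Lemma delta_alt_unitary n : delta_alt R n \is unitarymx.
Proof.
apply/unitarymxP; rewrite /delta_alt tr_diag_mx map_diag_mx /= mulmx_diag.
rewrite -[RHS]diag_const_mx; congr diag_mx; apply/rowP => j; rewrite !mxE.
by rewrite rmorphXn rmorphN1 -expr2 sqrr_sign.
Qed.

Lemma iota_inv_unitary n (g : 'M[C]_n) : g \is unitarymx -> iota_inv g \is unitarymx.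
Proof.
move=> gu; rewrite /iota_inv (invmx_unitary gu).
apply: mul_unitarymx (delta_alt_unitary n); apply: mul_unitarymx (delta_alt_unitary n) _.
by rewrite trmxC_unitary.
Qed.

(* The signs in the definition of [iota] are such that no sign is left here. *)
Lemma twist_minor n (g : 'M[C]_n) a k : g \is unitarymx -> (a + k <= n)%N ->
  mnr (ent (iota_inv g)) (iota a k) *+ a`! =
  \sum_(f : {ffun 'I_a -> 'I_n}) mnr (ent g) (fseq f) * (mnr (ent g) (iota 0 k ++ fseq f))^*.
Proof.
move=> gu akn.
have -> : mnr (ent (iota_inv g)) (iota a k) =
    (-1) ^+ (a * k) * (\det (\matrix_(i < k, j < k) ent g (nth 0%N (iota 0 k) i) (a + j)))^*.
  rewrite (@mnrE _ k) ?size_iota//; apply: etrans (det_conj_sign _ _).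
  congr (\det _); apply/matrixP => i j; rewrite !mxE !nth_iota// add0n.
  have hi : (a + i < n)%N by apply: leq_trans akn; rewrite ltn_add2l.
  have hj : (j < n)%N by apply: leq_trans (leq_trans (leq_addl _ _) akn).
  by rewrite !entE iota_invE.
rewrite -mulrnAr -rmorphMn /= unitary_minor ?size_iota// rmorph_sum mulr_sumr /=.
apply: eq_bigr => f _; rewrite rmorphM /= conjCK mulrCA; congr (_ * _).
rewrite mnr_catC size_fseq size_iota rmorphM rmorphXn rmorphN1 /= mulrA.
by rewrite -expr2 sqrr_sign mul1r.
Qed.

(** Reordering the rows of [f] changes both factors by the same sign, so a summand depends only on
    the set of rows; it vanishes if [f] repeats a row or meets the first k rows. *)
Lemma twist_term n (g : 'M[C]_n) a k (f : {ffun 'I_a -> 'I_n}) :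
  mnr (ent g) (fseq f) * (mnr (ent g) (iota 0 k ++ fseq f))^* = 0 \/
  exists s, [/\ sorted ltn s, size s = a, all (fun i => k <= i < n)%N s &
    mnr (ent g) (fseq f) * (mnr (ent g) (iota 0 k ++ fseq f))^* =
    mnr (ent g) s * (mnr (ent g) (iota 0 k ++ s))^*].
Proof.
have [u|nu] := boolP (uniq (iota 0 k ++ fseq f)); last first.
  by left; rewrite [X in _ * X^*]mnr_dup// rmorph0 mulr0.
right; exists (sort leq (fseq f)); move: u; rewrite cat_uniq => /and3P[_ /hasPn h u].
split; [|by rewrite size_sort size_fseq| |].
- by rewrite ltn_sorted_uniq_leq sort_uniq u (sort_sorted leq_total).
- apply/allP => x; rewrite mem_sort => xf; rewrite (allP (fseq_lt f))// andbT.
  by have := h x xf; rewrite mem_iota add0n leq0n -leqNgt.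
- have [b bP] := mnr_sort C (fseq f).
  rewrite (bP (ent g) (iota 0 k)) (bP (ent g) [::]) rmorphM rmorphXn rmorphN1.
  by rewrite mulrACA -expr2 sqrr_sign mul1r.
Qed.

Lemma conj_gt0 (x : C) : (0 < x^*) = (0 < x).
Proof. by rewrite !lt_def conjC_eq0 conjC_ge0. Qed.

Lemma natmul_fact_gt0 (x : C) a : (0 < x *+ a`!) = (0 < x).
Proof. by rewrite pmulrn_lgt0// fact_gt0. Qed.

Lemma twist_interval_gt0 n (g : 'M[C]_n) a k : g \is unitarymx -> (a + k <= n)%N ->
  (forall s, sorted ltn s -> all (fun i => i < n)%N s -> 0 < mnr (ent g) s) ->
  0 < mnr (ent (iota_inv g)) (iota a k).
Proof.
move=> gu akn gpos; rewrite -(natmul_fact_gt0 _ a) twist_minor//.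
have termP s : sorted ltn s -> all (fun i => k <= i < n)%N s ->
    0 < mnr (ent g) s * (mnr (ent g) (iota 0 k ++ s))^*.
  move=> ss sn; have sn' : all (fun i => i < n)%N s by apply: sub_all sn => x /andP[].
  apply: mulr_gt0; first exact: gpos.
  rewrite conj_gt0; apply: gpos; last first.
    rewrite all_cat sn' andbT; apply/allP => x; rewrite mem_iota add0n => /andP[_] /leq_trans; apply.
    by apply: leq_trans akn; exact: leq_addl.
  rewrite sorted_pairwise; last exact: ltn_trans.
  rewrite pairwise_cat -!sorted_pairwise ?iota_ltn_sorted ?ss ?andbT; try exact: ltn_trans.
  apply/allrelP => x y; rewrite mem_iota add0n => /andP[_ xk] /(allP sn)/andP[ky _].
  exact: leq_trans ky.
(* All summands are nonnegative; strictness needs one that is positive, and the rows k, ..., k+a-1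
   avoid the first k rows. *)
have [f0 f0P] : exists f : {ffun 'I_a -> 'I_n}, fseq f = iota k a.
  have [|f fP] := @fseq_onto n (iota k a).
    apply/allP => x; rewrite mem_iota => /andP[_] /leq_trans; apply.
    by rewrite addnC.
  by move: f fP; rewrite size_iota => f fP; exists f.
rewrite (bigD1 f0)//= ltr_wpDr//.
  apply: sumr_ge0 => f _; have [->//|[s [ss _ sn ->]]] := @twist_term n g a k f.
  exact: ltW (termP _ ss sn).
rewrite f0P; apply: termP; first exact: iota_ltn_sorted.
by apply/allP => x; rewrite mem_iota => /andP[-> /leq_trans]; apply; rewrite addnC.
Qed.

Lemma twist_minors_gt0 n (g : 'M[C]_n) : g \is unitarymx ->
  (forall s, sorted ltn s -> all (fun i => i < n)%N s -> 0 < mnr (ent g) s) ->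
  forall s, sorted ltn s -> all (fun i => i < n)%N s -> 0 < mnr (ent (iota_inv g)) s.
Proof. by move=> gu gpos; apply: interval_minors_gt0 => a k akn; exact: twist_interval_gt0. Qed.

Lemma sorted_last_interval n k a s : (k + a = n)%N -> sorted ltn s -> size s = a ->
  all (fun i => k <= i < n)%N s -> s = iota k a.
Proof.
move=> kan ss sa sn; apply: sorted_ltn_eq => //; first exact: iota_ltn_sorted.
have us : uniq s by move: ss; rewrite ltn_sorted_uniq_leq => /andP[].
have [||//] := uniq_min_size us (s2 := iota k a); last by rewrite size_iota sa.
by move=> x /(allP sn); rewrite mem_iota kan.
Qed.

(** For a + k = n the only a rows avoiding the first k are the last a, so all nonzero summands
    coincide; [m] counts them. *)
Lemma twist_last_minor n (g : 'M[C]_n) a k : g \is unitarymx -> (a + k = n)%N ->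
  exists m : nat, mnr (ent (iota_inv g)) (iota a k) *+ a`! =
    (mnr (ent g) (iota k a) * (mnr (ent g) (iota 0 n))^*) *+ m.
Proof.
move=> gu akn; rewrite twist_minor ?akn//.
elim/big_rec: _ => [|f x _ [m ->]]; first by exists 0%N; rewrite mulr0n.
have [->|[s [ss sa sn ->]]] := @twist_term n g a k f; first by exists m; rewrite add0r.
have -> : s = iota k a by apply: (@sorted_last_interval n) => //; rewrite addnC.
exists m.+1; rewrite mulrS; congr (_ * (mnr _ _)^* + _).
by rewrite -{2}[k]add0n -iotaD addnC akn.
Qed.

Lemma twist_last_eq0 n (g : 'M[C]_n) a k : g \is unitarymx -> (a + k = n)%N ->
  mnr (ent g) (iota k a) = 0 -> mnr (ent (iota_inv g)) (iota a k) = 0.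
Proof.
move=> gu akn g0; have [m] := twist_last_minor gu akn.
rewrite g0 mul0r mul0rn => /eqP; rewrite mulrn_eq0 => /orP[|/eqP//].
by rewrite eqn0Ngt fact_gt0.
Qed.

Lemma twist_last_gt0 n (g : 'M[C]_n) a k : g \is unitarymx -> (a + k = n)%N ->
  0 < mnr (ent g) (iota k a) -> 0 < mnr (ent g) (iota 0 n) ->
  mnr (ent (iota_inv g)) (iota a k) != 0 -> 0 < mnr (ent (iota_inv g)) (iota a k).
Proof.
move=> gu akn g0 d0 nz; have [m E] := twist_last_minor gu akn.
rewrite -(natmul_fact_gt0 _ a) E lt_neqAle -E eq_sym mulrn_eq0 (negbTE nz) orbF.
rewrite -lt0n fact_gt0 E mulrn_wge0// ltW// mulr_gt0// conj_gt0//.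
Qed.

End TwistMinors.

(** * Moments of the Moser map *)

(** The covariance written over pairs of independent samples, which makes its sign visible when e
    and s are similarly ordered. *)
Lemma chebyshev_sum (R : realFieldType) (I : finType) (w e s : I -> R) :
  ((\sum_f w f * (e f * s f)) * (\sum_f w f) - (\sum_f w f * e f) * (\sum_f w f * s f)) *+ 2 =
  \sum_f \sum_g w f * w g * ((e f - e g) * (s f - s g)).
Proof.
pose T (a b : I -> R) := \sum_f \sum_g (w f * a f) * (w g * b g).
have TE a b : (\sum_f w f * a f) * (\sum_f w f * b f) = T a b.
  by rewrite mulr_suml; apply: eq_bigr => f _; rewrite mulr_sumr.
have -> : \sum_f w f = \sum_f w f * 1 by apply: eq_bigr => f _; rewrite mulr1.
have -> : \sum_f \sum_g w f * w g * ((e f - e g) * (s f - s g)) =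
    T (fun f => e f * s f) (fun=> 1) - T e s - T s e + T (fun=> 1) (fun f => e f * s f).
  rewrite /T -!sumrB -big_split /=; apply: eq_bigr => f _.
  by rewrite -!sumrB -big_split /=; apply: eq_bigr => g _; ring.
by rewrite -!TE; ring.
Qed.

Lemma chebyshev_ge0 (R : realFieldType) (I : finType) (w e s : I -> R) :
  (forall f, 0 <= w f) -> (forall f g, 0 <= (e f - e g) * (s f - s g)) ->
  (\sum_f w f * e f) * (\sum_f w f * s f) <= (\sum_f w f * (e f * s f)) * (\sum_f w f).
Proof.
move=> w0 es; rewrite -subr_ge0 -(pmulrn_lge0 _ (ltn0Sn 1)) chebyshev_sum.
by apply: sumr_ge0 => f _; apply: sumr_ge0 => g _; exact: (mulr_ge0 (mulr_ge0 (w0 f) (w0 g)) (es f g)).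
Qed.

Lemma chebyshev_eq (R : realFieldType) (I : finType) (w e s : I -> R) f g :
  (forall f, 0 <= w f) -> (forall f g, 0 <= (e f - e g) * (s f - s g)) ->
  (\sum_f w f * (e f * s f)) * (\sum_f w f) = (\sum_f w f * e f) * (\sum_f w f * s f) ->
  0 < w f -> 0 < w g -> (e f - e g) * (s f - s g) = 0.
Proof.
move=> w0 es /eqP; rewrite -subr_eq0 => /eqP E wf wg.
have := chebyshev_sum w e s; rewrite E mul0rn => /esym/eqP.
rewrite psumr_eq0; last by move=> i _; apply: sumr_ge0 => j _; exact: (mulr_ge0 (mulr_ge0 (w0 i) (w0 j)) (es i j)).
move=> /allP/(_ f (mem_index_enum _))/= H.
move: H; rewrite psumr_eq0; last by move=> j _; exact: (mulr_ge0 (mulr_ge0 (w0 f) (w0 j)) (es f j)).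
move=> /allP/(_ g (mem_index_enum _))/=.
by rewrite mulf_eq0 (gt_eqF (mulr_gt0 wf wg)) => /eqP.
Qed.

Section DirectionalDerivative.
Variables (R : realType) (U : normedModType R) (y v : U).
Implicit Types f g : U -> R.

Definition has_der f (d : R) := derivable f y v /\ 'D_v f y = d.

Lemma has_der_cst (c : R) : has_der (fun=> c) 0.
Proof. by split; [exact: derivable_cst|exact: derive_cst]. Qed.

Lemma has_derD f g a b : has_der f a -> has_der g b -> has_der (fun x => f x + g x) (a + b).
Proof. by move=> [df <-] [dg <-]; split; [exact: (derivableD df dg)|exact: (deriveD df dg)]. Qed.

Lemma has_derM f g a b : has_der f a -> has_der g b ->
  has_der (fun x => f x * g x) (f y * b + g y * a).
Proof. by move=> [df <-] [dg <-]; split; [exact: (derivableM df dg)|exact: (deriveM df dg)]. Qed.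

Lemma has_derV f a : f y != 0 -> has_der f a -> has_der (fun x => (f x)^-1) (- a / f y ^+ 2).
Proof.
move=> f0 [df <-]; split; first exact: derivableV.
by rewrite [LHS](deriveV f0 df) -[LHS]/(_ * _) mulrC mulrN mulNr.
Qed.

Lemma has_der_eq f g a b : f =1 g -> a = b -> has_der f a -> has_der g b.
Proof. by move=> /funext -> ->. Qed.

Lemma has_der_sum (I : Type) (r : seq I) (P : pred I) (f : I -> U -> R) (a : I -> R) :
  (forall i, P i -> has_der (f i) (a i)) ->
  has_der (fun x => \sum_(i <- r | P i) f i x) (\sum_(i <- r | P i) a i).
Proof.
move=> fa; elim: r => [|i r IH].
  by apply: has_der_eq (has_der_cst 0) => [x|]; rewrite big_nil.
have [Pi|nPi] := boolP (P i).
  by apply: has_der_eq (has_derD (fa i Pi) IH) => [x|]; rewrite big_cons Pi.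
by apply: has_der_eq IH => [x|]; rewrite big_cons (negbTE nPi).
Qed.

(** Stated with the logarithmic derivatives [l], so that no product with an omitted factor
    occurs. *)
Lemma has_der_prod (I : Type) (r : seq I) (f : I -> U -> R) (l : I -> R) :
  (forall i, has_der (f i) (f i y * l i)) ->
  has_der (fun x => \prod_(i <- r) f i x) (\prod_(i <- r) f i y * \sum_(i <- r) l i).
Proof.
move=> fa; elim: r => [|i r IH].
  by apply: has_der_eq (has_der_cst 1) => [x|]; rewrite !big_nil ?mulr0.
apply: has_der_eq (has_derM (fa i) IH) => [x|]; rewrite !big_cons//; ring.
Qed.

End DirectionalDerivative.

(** * The moment vector as a function of positive coordinates: injectivity, differential, smooth
    inverse *)

Section MomentCoordinates.
Variables (R : realType) (N : nat) (nu : 'rV[R]_N).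
Hypothesis nu_decr : strictly_decreasing nu.
Implicit Types (y v : 'rV[R]_N) (i j : 'I_N).

Definition vdm k (f : {ffun 'I_k -> 'I_N}) : R := \det (\matrix_(a < k, b < k) nu 0 (f a) ^+ b).

(** The squared minor of the matrix (nu_i^j y_i) in the rows [f] and the first k columns.
    Normalized, these are the probabilities of the random subset, and [wsum] below is an
    unnormalized expectation. *)
Definition wt k (f : {ffun 'I_k -> 'I_N}) y : R := (vdm f * \prod_a y 0 (f a)) ^+ 2.

Definition wsum k y (h : {ffun 'I_k -> 'I_N} -> R) : R := \sum_f wt f y * h f.

Definition cnt k i (f : {ffun 'I_k -> 'I_N}) : R := \sum_a (f a == i)%:R.

Definition nun (k : nat) : R := if (insub k : option 'I_N) is Some k' then nu 0 k' else 0.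

Definition gap (k : nat) : R := nun k - nun k.+1.

(* mu(Mos_nu(y)): Abel summation over the gaps of [nu] of the diagonals of the orthogonal
   projections to the spans of the first columns, computed by Cauchy-Binet. Summing over maps
   'I_k -> 'I_N instead of k-subsets multiplies numerator and denominator by k!; the gap at
   [N.-1] is [nu 0 N.-1] and contributes a constant. *)
Definition mmu y : 'rV[R]_N :=
  \row_i \sum_(k < N) gap k * (wsum y (@cnt k.+1 i) / wsum y (fun _ : {ffun 'I_k.+1 -> 'I_N} => 1)).

Definition pos_orthant : set 'rV[R]_N := [set y | forall i, 0 < y 0 i].

Lemma nu_inj : injective (nu 0).
Proof.
move=> i j E; apply/val_inj/eqP; case: ltngtP => // h.
  by have := nu_decr h; rewrite E ltxx.
by have := nu_decr h; rewrite E ltxx.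
Qed.

Lemma nunE i : nun i = nu 0 i.
Proof. by rewrite /nun valK. Qed.

Lemma gap_gt0 (k : nat) : (k.+1 < N)%N -> 0 < gap k.
Proof.
move=> kN; have kN' := ltnW kN; rewrite /gap -[k]/(val (Ordinal kN')) -[k.+1]/(val (Ordinal kN)).
by rewrite !nunE subr_gt0; exact: nu_decr.
Qed.

Lemma vdm_neq0 k (f : {ffun 'I_k -> 'I_N}) : injective f -> vdm f != 0.
Proof.
move=> fi; have -> : vdm f = \det (Vandermonde k (\row_a nu 0 (f a))).
  by rewrite -det_tr; congr (\det _); apply/matrixP => a b; rewrite !mxE.
rewrite det_Vandermonde; apply/prodf_neq0 => a _; apply/prodf_neq0 => b ab.
rewrite !mxE subr_eq0; apply/eqP => /nu_inj/fi E; by rewrite E ltnn in ab.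
Qed.

Lemma wt_ge0 k (f : {ffun 'I_k -> 'I_N}) y : 0 <= wt f y.
Proof. exact: sqr_ge0. Qed.

Lemma wt_gt0 k (f : {ffun 'I_k -> 'I_N}) y : pos_orthant y -> injective f -> 0 < wt f y.
Proof.
move=> y0 fi; rewrite /wt exprn_even_gt0//= mulf_neq0 ?vdm_neq0//.
by apply/prodf_neq0 => a _; rewrite gt_eqF.
Qed.

Lemma wt_ninj k (f : {ffun 'I_k -> 'I_N}) y : ~ injective f -> wt f y = 0.
Proof.
move=> /injectiveP/injectivePn[a [b ab E]]; rewrite /wt /vdm.
by rewrite (@determinant_alternate _ _ _ a b)// ?mul0r ?expr0n// => c; rewrite !mxE E.
Qed.

Lemma wsum1_gt0 k y : (k <= N)%N -> pos_orthant y ->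
  0 < wsum y (fun _ : {ffun 'I_k -> 'I_N} => 1).
Proof.
move=> kN y0; pose f0 : {ffun 'I_k -> 'I_N} := [ffun a => widen_ord kN a].
rewrite /wsum (bigD1 f0)//= mulr1 ltr_wpDr//.
  by apply: sumr_ge0 => f _; rewrite mulr1 wt_ge0.
apply: wt_gt0 => // a b; rewrite !ffunE => /(congr1 val) /= ab; exact: val_inj.
Qed.

Lemma sum_cnt k (s : 'I_N -> R) (f : {ffun 'I_k -> 'I_N}) :
  \sum_i s i * cnt i f = \sum_a s (f a).
Proof.
under eq_bigr do rewrite /cnt mulr_sumr.
rewrite exchange_big /=; apply: eq_bigr => a _.
by rewrite (bigD1 (f a))//= eqxx mulr1 big1 ?addr0// => i ni; rewrite eq_sym (negbTE ni) mulr0.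
Qed.

Lemma sum_wsum_cnt k (s : 'I_N -> R) y :
  \sum_i s i * wsum y (@cnt k i) = wsum y (fun f : {ffun 'I_k -> 'I_N} => \sum_a s (f a)).
Proof.
under eq_bigr do rewrite /wsum mulr_sumr.
rewrite exchange_big /=; apply: eq_bigr => f _; rewrite -sum_cnt mulr_sumr.
by apply: eq_bigr => i _; rewrite mulrCA.
Qed.

Lemma sum_mmu (s : 'I_N -> R) y :
  \sum_i s i * mmu y 0 i = \sum_(k < N) gap k *
    (wsum y (fun f : {ffun 'I_k.+1 -> 'I_N} => \sum_a s (f a)) /
     wsum y (fun _ : {ffun 'I_k.+1 -> 'I_N} => 1)).
Proof.
under eq_bigr do rewrite mxE mulr_sumr.
rewrite exchange_big /=; apply: eq_bigr => k _; rewrite -sum_wsum_cnt mulr_suml mulr_sumr.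
by apply: eq_bigr => i _; rewrite mulrCA; congr (_ * _); rewrite mulrA.
Qed.

Lemma sum_full (s : 'I_N -> R) k (f : {ffun 'I_k -> 'I_N}) : k = N -> injective f ->
  \sum_a s (f a) = \sum_i s i.
Proof.
move=> kN; subst k => fi; rewrite [RHS](reindex f)//=.
by apply: onW_bij; exact: injF_bij.
Qed.

Lemma fun1_inj (f : {ffun 'I_1 -> 'I_N}) : injective f.
Proof. by move=> a b _; rewrite !ord1. Qed.

Lemma mmu_inj y y' : pos_orthant y -> pos_orthant y' -> mmu y = mmu y' ->
  exists2 t, 0 < t & y' = t *: y.
Proof.
move=> y0 y'0 E.
(* Replacing y by y' multiplies the weight of [f] by [ef k f], and [sf k f] is its logarithm, hence
   similarly ordered. *)
pose e i := (y' 0 i / y 0 i) ^+ 2; pose s i := ln (e i).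
have r0 i : 0 < y' 0 i / y 0 i by rewrite divr_gt0.
have e0 i : 0 < e i by rewrite exprn_gt0.
pose ef k (f : {ffun 'I_k -> 'I_N}) := \prod_a e (f a).
pose sf k (f : {ffun 'I_k -> 'I_N}) := \sum_a s (f a).
have ef0 k (f : {ffun 'I_k -> 'I_N}) : 0 < ef k f by apply: prodr_gt0.
have sfE k (f : {ffun 'I_k -> 'I_N}) : sf k f = ln (ef k f).
  suff [] : 0 < ef k f /\ sf k f = ln (ef k f) by [].
  rewrite /ef /sf; elim/big_rec2: _ => [|a u v _ [v0 ->]]; first by rewrite ln1.
  by rewrite lnM ?posrE// mulr_gt0.
have wE k (f : {ffun 'I_k -> 'I_N}) : wt f y' = wt f y * ef k f.
  rewrite /wt /ef /e prodrXl -exprMn -mulrA; congr ((_ * _) ^+ 2).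
  by rewrite -big_split /=; apply: eq_bigr => a _; rewrite mulrC divfK ?gt_eqF.
have mono k (f g : {ffun 'I_k -> 'I_N}) : 0 <= (ef k f - ef k g) * (sf k f - sf k g).
  have [fg|fg] := leP (ef k f) (ef k g).
    rewrite mulr_le0// subr_le0// !sfE ler_ln// posrE//.
  by rewrite mulr_ge0// subr_ge0 ?ltW// !sfE ltr_ln// posrE.
have Z'E k : wsum y' (fun _ : {ffun 'I_k -> 'I_N} => 1) = \sum_f wt f y * ef k f.
  by apply: eq_bigr => f _; rewrite mulr1 wE.
have ZE k : wsum y (fun _ : {ffun 'I_k -> 'I_N} => 1) = \sum_(f : {ffun 'I_k -> 'I_N}) wt f y.
  by apply: eq_bigr => f _; rewrite mulr1.
have S'E k : wsum y' (sf k) = \sum_f wt f y * (ef k f * sf k f).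
  by apply: eq_bigr => f _; rewrite wE mulrA.
(* The change in the expectation of [sf]; it is the covariance of [ef] and [sf] under the weights of
   y, divided by positive normalizations. *)
pose df k := wsum y' (sf k) / wsum y' (fun _ : {ffun 'I_k -> 'I_N} => 1) -
             wsum y (sf k) / wsum y (fun _ : {ffun 'I_k -> 'I_N} => 1).
have dfE k : (k <= N)%N -> df k =
    ((\sum_f wt f y * (ef k f * sf k f)) * (\sum_(f : {ffun 'I_k -> 'I_N}) wt f y) -
     (\sum_f wt f y * ef k f) * (\sum_f wt f y * sf k f)) /
    ((\sum_f wt f y * ef k f) * (\sum_(f : {ffun 'I_k -> 'I_N}) wt f y)).
  move=> kN; rewrite /df S'E Z'E ZE.
  have h1 : \sum_(f : {ffun 'I_k -> 'I_N}) wt f y != 0 by rewrite -ZE gt_eqF// wsum1_gt0.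
  have h2 : \sum_(f : {ffun 'I_k -> 'I_N}) wt f y * ef k f != 0 by rewrite -Z'E gt_eqF// wsum1_gt0.
  by rewrite /wsum; field; rewrite h1 h2.
have Zpos k : (k <= N)%N -> 0 < (\sum_f wt f y * ef k f) * (\sum_(f : {ffun 'I_k -> 'I_N}) wt f y).
  by move=> kN; rewrite -Z'E -ZE mulr_gt0// wsum1_gt0.
have df_ge0 k : (k <= N)%N -> 0 <= df k.
  move=> kN; rewrite dfE// divr_ge0 ?(ltW (Zpos _ kN))// subr_ge0 chebyshev_ge0// => f.
  exact: wt_ge0.
(* For k = N the sum of s over [f] is the same for every [f] of nonzero weight. This disposes of the
   last gap, whose sign is unknown. *)
have df_full : df N = 0.
  have full y1 : pos_orthant y1 ->
      wsum y1 (sf N) / wsum y1 (fun _ : {ffun 'I_N -> 'I_N} => 1) = \sum_i s i.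
    move=> y10; have -> : wsum y1 (sf N) =
        (\sum_i s i) * wsum y1 (fun _ : {ffun 'I_N -> 'I_N} => 1).
      rewrite mulr_sumr; apply: eq_bigr => f _; rewrite mulr1 mulrC.
      have [fi|nfi] := pselect (injective f); first by rewrite /sf sum_full.
      by rewrite wt_ninj// !mulr0.
    by rewrite mulfK// gt_eqF// wsum1_gt0.
  by rewrite /df !full// subrr.
have sum0 : \sum_(k < N) gap k * df k.+1 = 0.
  under eq_bigr do rewrite /df mulrBr.
  by rewrite sumrB -!sum_mmu E subrr.
have s_const i j : s i = s j.
  have [N1|N1] := leqP N 1.
    congr s; apply: val_inj; have := ltn_ord i; have := ltn_ord j.
    by case: (N) N1 i j => [|[|//]] _ [[]//] ? [[]//] ?.
  have N0 : (0 < N)%N by exact: ltnW.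
  (* A vanishing sum of nonnegative terms, with a positive first gap. Any two indices i, j are maps
     from 'I_1 of positive weight, so the equality case compares all of them. *)
  have df1 : df 1 = 0.
    have := sum0; rewrite (bigD1 (Ordinal N0))//= => /eqP.
    rewrite paddr_eq0.
    - by case/andP; rewrite mulf_eq0 gt_eqF ?gap_gt0//= => /eqP.
    - by rewrite mulr_ge0 ?df_ge0// ltW// gap_gt0.
    - apply: sumr_ge0 => k _; have [kN|kN] := ltnP k.+1 N.
        by rewrite mulr_ge0 ?df_ge0// ltW// gap_gt0.
      have -> : k.+1 = N by apply/eqP; rewrite eqn_leq kN ltn_ord.
      by rewrite df_full mulr0.
  move: df1; rewrite dfE// => /eqP; rewrite mulf_eq0 invr_eq0 (gt_eqF (Zpos _ N0)) orbF subr_eq0.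
  move=> /eqP cheb.
  pose fi : {ffun 'I_1 -> 'I_N} := [ffun=> i]; pose fj : {ffun 'I_1 -> 'I_N} := [ffun=> j].
  have := chebyshev_eq (f := fi) (g := fj) (fun f => wt_ge0 f y) (mono 1) cheb.
  move=> /(_ (wt_gt0 y0 (@fun1_inj _)) (wt_gt0 y0 (@fun1_inj _)))/eqP.
  rewrite mulf_eq0 => /orP[].
    rewrite subr_eq0 => /eqP ee.
    by have := sfE 1 fi; rewrite ee -sfE /sf !big_ord1 !ffunE.
  by rewrite subr_eq0 /sf !big_ord1 !ffunE => /eqP.
have rc i j : y' 0 i / y 0 i = y' 0 j / y 0 j.
  have : e i = e j by apply: ln_inj; rewrite ?posrE//; exact: s_const.
  by move/eqP; rewrite /e eqrXn2 ?(ltW (r0 _))// => /eqP.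
have [N0|N0] := posnP N.
  by exists 1 => //; apply/rowP => i; have := ltn_ord i; rewrite {2}N0.
exists (y' 0 (Ordinal N0) / y 0 (Ordinal N0)) => //.
by apply/rowP => i; rewrite mxE (rc _ i) divfK ?gt_eqF.
Qed.

Lemma pos_orthant_open : open pos_orthant.
Proof.
rewrite openE => y y0; rewrite /interior.
apply: (@filter_forall _ 'I_N (fun i (z : 'rV[R]_N) => 0 < z 0 i) (nbhs y) (nbhs_filter y)) => i.
have C : (fun z : 'rV[R]_N => z 0 i : R) @ y --> y 0 i by exact: coord_continuous.
exact: (C [set x | 0 < x] (lt_nbhsr (y0 i))).
Qed.

Lemma isCk_wsum k m (h : {ffun 'I_m -> 'I_N} -> R) : isCk k pos_orthant (fun y => wsum y h).
Proof.
have oP := pos_orthant_open.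
apply: isCk_sum => // f _; apply: isCkM; [exact: oP| |exact: isCk_cst].
have Cw : isCk k pos_orthant (fun y : 'rV[R]_N => vdm f * \prod_a y 0 (f a)).
  apply: isCkM; [exact: oP|exact: isCk_cst|apply: isCk_prod; first exact: oP].
  by move=> a _; apply: isCk_coord; [exact: oP|exact: isCk_id].
apply: (eq_isCk oP _ (isCkM oP Cw Cw)) => y _; rewrite /wt expr2 //.
Qed.

Section Normalized.
Variable a : 'I_N -> R.
Hypothesis a_gt0 : forall i, 0 < a i.

Definition nrm2 y : R := \sum_i a i * y 0 i ^+ 2.

(* [mmu] is invariant under rescaling of [y]; the constant vector records the scale. *)
Definition mmu_nrm y : 'rV[R]_N := mmu y + const_mx (nrm2 y).

Lemma smooth_mmu_nrm : smooth pos_orthant mmu_nrm.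
Proof.
have oP := pos_orthant_open => k; apply: isCk_mx => // i0 i; rewrite ord1.
have C1 : isCk k pos_orthant (fun y => \sum_(m < N) gap m * (wsum y (@cnt m.+1 i) *
    (wsum y (fun _ : {ffun 'I_m.+1 -> 'I_N} => 1))^-1)).
  apply: isCk_sum => // m _; apply: isCkM; [exact: oP|exact: isCk_cst|].
  apply: isCkM; [exact: oP|exact: isCk_wsum|apply: isCkV; [exact: oP| |exact: isCk_wsum]].
  by move=> y y0; rewrite gt_eqF// wsum1_gt0.
have C2 : isCk k pos_orthant nrm2.
  apply: isCk_sum => // j _; apply: isCkM; [exact: oP|exact: isCk_cst|].
  have Cj : isCk k pos_orthant (fun y : 'rV[R]_N => y 0 j : R).
    by apply: isCk_coord; [exact: oP|exact: isCk_id].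
  by apply: (eq_isCk oP _ (isCkM oP Cj Cj)) => y _; rewrite expr2.
by apply: (eq_isCk oP _ (isCkD oP C1 C2)) => y _; rewrite !mxE.
Qed.

Lemma wsum_full k y : k = N -> pos_orthant y -> forall s : 'I_N -> R,
  wsum y (fun f : {ffun 'I_k -> 'I_N} => \sum_a s (f a)) =
  (\sum_i s i) * wsum y (fun _ : {ffun 'I_k -> 'I_N} => 1).
Proof.
move=> kN y0 s; rewrite mulr_sumr; apply: eq_bigr => f _; rewrite mulr1 mulrC.
have [fi|nfi] := pselect (injective f); first by rewrite (sum_full _ kN fi).
by rewrite wt_ninj// !mulr0.
Qed.

(** The coordinate sum of [mmu] does not depend on y, hence that of [mmu_nrm] reveals the scale
    [nrm2]: adding a constant vector mixes up no information. *)
Lemma sum_mmu1 y : pos_orthant y -> \sum_i mmu y 0 i = \sum_(k < N) gap k * k.+1%:R.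
Proof.
move=> y0; under eq_bigr do rewrite -[mmu y 0 _]mul1r.
rewrite (sum_mmu (fun=> 1)); apply: eq_bigr => k _; congr (_ * _).
rewrite -[RHS](@mulfK _ (wsum y (fun _ : {ffun 'I_k.+1 -> 'I_N} => 1))).
  congr (_ / _); rewrite /wsum mulr_sumr; apply: eq_bigr => f _.
  by rewrite sumr_const card_ord mulr1 mulrC.
by rewrite gt_eqF// wsum1_gt0.
Qed.

Lemma nrm2_gt0 y : (0 < N)%N -> pos_orthant y -> 0 < nrm2 y.
Proof.
move=> N0 y0; rewrite /nrm2 (bigD1 (Ordinal N0))//= ltr_wpDr//.
  by apply: sumr_ge0 => i _; rewrite mulr_ge0 ?sqr_ge0// ltW.
by rewrite mulr_gt0// exprn_gt0.
Qed.

Lemma mmu_nrm_inj y y' : pos_orthant y -> pos_orthant y' -> mmu_nrm y = mmu_nrm y' -> y = y'.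
Proof.
move=> y0 y'0 E; have [N0|N0] := posnP N.
  by apply/rowP => i; have := ltn_ord i; rewrite {2}N0.
have S z : pos_orthant z -> \sum_i mmu_nrm z 0 i =
    \sum_(k < N) gap k * k.+1%:R + nrm2 z *+ N.
  move=> z0; under eq_bigr do rewrite mxE [X in _ + X]mxE.
  by rewrite big_split /= sum_mmu1// sumr_const card_ord.
have nE : nrm2 y = nrm2 y'.
  have := S y' y'0; rewrite -E S// => /addrI/eqP.
  by rewrite -subr_eq0 -mulrnBl mulrn_eq0 eqn0Ngt N0 subr_eq0 => /eqP.
have mE : mmu y = mmu y' by move: E; rewrite /mmu_nrm nE => /addIr.
have [t t0 yt] := mmu_inj y0 y'0 mE.
have nt : nrm2 y' = t ^+ 2 * nrm2 y.
  by rewrite yt mulr_sumr; apply: eq_bigr => i _; rewrite mxE exprMn mulrCA.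
have t1 : t ^+ 2 = 1 by apply: (mulIf (lt0r_neq0 (nrm2_gt0 N0 y0))); rewrite mul1r -nt nE.
have -> : y = 1 *: y by rewrite scale1r.
rewrite yt; congr (_ *: _); apply/esym/eqP; rewrite -(eqrXn2 (n := 2))// ?(ltW t0)// t1 expr1n//.
Qed.

Lemma has_der_coord y v j : has_der y v (fun x : 'rV[R]_N => x 0 j : R) (v 0 j).
Proof.
split; first by apply: diff_derivable; exact: differentiable_coord.
have := derive_mx (@derivable_id _ _ y v); rewrite derive_id => /matrixP/(_ 0 j).
by rewrite mxE.
Qed.

Lemma has_der_wsum k y v (h : {ffun 'I_k -> 'I_N} -> R) : pos_orthant y ->
  has_der y v (fun x => wsum x h)
    (wsum y (fun f => (\sum_a 2 * v 0 (f a) / y 0 (f a)) * h f)).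
Proof.
move=> y0; apply: has_der_sum => f _.
have P : has_der y v (fun x : 'rV[R]_N => \prod_a (x 0 (f a) * x 0 (f a)))
    (\prod_a (y 0 (f a) * y 0 (f a)) * \sum_a 2 * v 0 (f a) / y 0 (f a)).
  apply: (@has_der_prod _ _ _ _ _ _ (fun a (x : 'rV[R]_N) => x 0 (f a) * x 0 (f a))) => b.
  have Hc := has_der_coord y v (f b).
  apply: has_der_eq (has_derM Hc Hc) => //.
  by field; rewrite gt_eqF.
have Q := has_derM (has_der_cst y v (vdm f ^+ 2 * h f)) P.
have wE x : wt f x = vdm f ^+ 2 * \prod_a (x 0 (f a) * x 0 (f a)).
  by rewrite /wt exprMn -prodrXl.
apply: has_der_eq Q => [x|]; rewrite wE; ring.
Qed.

(** Here [s] is the logarithmic derivative of the squared coordinates, so the quotient rule turns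
    each summand into a covariance of the sum of s over f with [cnt i]. *)
Lemma has_der_mmu y v i : pos_orthant y ->
  let s j := 2 * v 0 j / y 0 j in
  has_der y v (fun x => mmu x 0 i) (\sum_(k < N) gap k *
    ((wsum y (fun f : {ffun 'I_k.+1 -> 'I_N} => (\sum_a s (f a)) * cnt i f) *
      wsum y (fun _ : {ffun 'I_k.+1 -> 'I_N} => 1) -
      wsum y (@cnt k.+1 i) * wsum y (fun f : {ffun 'I_k.+1 -> 'I_N} => \sum_a s (f a))) /
     wsum y (fun _ : {ffun 'I_k.+1 -> 'I_N} => 1) ^+ 2)).
Proof.
move=> y0 s.
apply: (@has_der_eq _ _ _ _ (fun x => \sum_(k < N) gap k * (wsum x (@cnt k.+1 i) *
   (wsum x (fun _ : {ffun 'I_k.+1 -> 'I_N} => 1))^-1)) _ _ _ _ erefl).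
  by move=> x; rewrite mxE.
apply: has_der_sum => k _.
have Z0 : wsum y (fun _ : {ffun 'I_k.+1 -> 'I_N} => 1) != 0 by rewrite gt_eqF// wsum1_gt0.
have dA := has_der_wsum v (@cnt k.+1 i) y0.
have dZ := has_der_wsum v (fun _ : {ffun 'I_k.+1 -> 'I_N} => 1) y0.
apply: has_der_eq (has_derM (has_der_cst y v (gap k)) (has_derM dA (has_derV Z0 dZ))) => //.
rewrite mulr0 addr0; congr (_ * _).
have -> : wsum y (fun f : {ffun 'I_k.+1 -> 'I_N} => (\sum_a s (f a)) * 1) =
    wsum y (fun f : {ffun 'I_k.+1 -> 'I_N} => (\sum_a s (f a))).
  by apply: eq_bigr => f _; rewrite mulr1.
by field.
Qed.

(** The infinitesimal form of [mmu_inj]: pairing the derivative with [s] gives gaps times variances,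
    so [s] is constant, that is, v is a multiple of y. The vanishing derivative of [nrm2] then
    excludes a nonzero multiple. *)
Lemma dmmu_nrm_inj y v : pos_orthant y -> 'd mmu_nrm y v = 0 -> v = 0.
Proof.
move=> y0 dv; have oP := pos_orthant_open.
have [N0|N0] := posnP N.
  by apply/rowP => i; have := ltn_ord i; rewrite {2}N0.
have dF : differentiable mmu_nrm y by have [+ _] := smooth_mmu_nrm 1; exact.
have D0 i : 'D_v (fun x => mmu_nrm x 0 i) y = 0.
  have := derive_mx (diff_derivable (v := v) dF); rewrite deriveE// dv => /matrixP/(_ 0 i).
  by rewrite !mxE.
pose s j := 2 * v 0 j / y 0 j.
have dn : has_der y v nrm2 (\sum_i a i * (y 0 i ^+ 2 * s i)).
  apply: has_der_sum => i _; have Hc := has_der_coord y v i.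
  apply: has_der_eq (has_derM (has_der_cst y v (a i)) (has_derM Hc Hc)) => [x|].
    by rewrite expr2.
  by rewrite /s; field; rewrite gt_eqF.
set dN := \sum_i _ in dn.
pose Z k := wsum y (fun _ : {ffun 'I_k -> 'I_N} => 1).
pose sf k (f : {ffun 'I_k -> 'I_N}) := \sum_a s (f a).
pose dm i := \sum_(k < N) gap k * ((wsum y (fun f : {ffun 'I_k.+1 -> 'I_N} => sf k.+1 f * cnt i f) *
   Z k.+1 - wsum y (@cnt k.+1 i) * wsum y (sf k.+1)) / Z k.+1 ^+ 2).
have dmE i : dm i + dN = 0.
  rewrite -(D0 i).
  have [_ H] := has_derD (has_der_mmu v i y0) dn; rewrite -[LHS]H.
  by congr ('D_v _ y); apply/funext => x; rewrite [RHS]mxE [X in _ = _ + X]mxE.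
have sum_dm (t : 'I_N -> R) : \sum_i t i * dm i = \sum_(k < N) gap k *
   ((wsum y (fun f : {ffun 'I_k.+1 -> 'I_N} => sf k.+1 f * \sum_a t (f a)) * Z k.+1 -
    wsum y (fun f : {ffun 'I_k.+1 -> 'I_N} => \sum_a t (f a)) * wsum y (sf k.+1)) / Z k.+1 ^+ 2).
  under eq_bigr do rewrite mulr_sumr; rewrite exchange_big /=; apply: eq_bigr => k _.
  under eq_bigr do rewrite mulrCA; rewrite -mulr_sumr; congr (_ * _).
  under eq_bigr do rewrite mulrA; rewrite -mulr_suml; congr (_ / _).
  under eq_bigr do rewrite mulrBr !mulrA.
  rewrite sumrB -!mulr_suml sum_wsum_cnt; congr (_ * _ - _).
  under eq_bigr do rewrite mulr_sumr; rewrite exchange_big /=; apply: eq_bigr => f _.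
  by rewrite -sum_cnt !mulr_sumr; apply: eq_bigr => i _; ring.
(* Pairing with the vector of ones separates the two parts of the differential: the coordinate sum
   of [dm] is zero. *)
have dN0 : dN = 0.
  have : \sum_i dm i = 0.
    under eq_bigr do rewrite -[dm _]mul1r; rewrite (sum_dm (fun=> 1)) big1// => k _.
    have -> : wsum y (fun f : {ffun 'I_k.+1 -> 'I_N} => sf k.+1 f * (\sum_(a < k.+1) 1)) =
        k.+1%:R * wsum y (sf k.+1).
      by rewrite mulr_sumr; apply: eq_bigr => f _; rewrite sumr_const card_ord; ring.
    have -> : wsum y (fun _ : {ffun 'I_k.+1 -> 'I_N} => (\sum_(a < k.+1) 1)) = k.+1%:R * Z k.+1.
      by rewrite mulr_sumr; apply: eq_bigr => f _; rewrite sumr_const card_ord; ring.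
    by rewrite (_ : _ - _ = 0) ?mul0r ?mulr0//; ring.
  have : \sum_i (dm i + dN) = 0 by rewrite big1.
  rewrite big_split /= => /[swap] ->; rewrite add0r sumr_const card_ord => /eqP.
  by rewrite mulrn_eq0 eqn0Ngt N0 => /eqP.
have dm0 i : dm i = 0 by have := dmE i; rewrite dN0 addr0.
pose cv k := (wsum y (fun f : {ffun 'I_k -> 'I_N} => sf k f * sf k f) * Z k -
    wsum y (sf k) * wsum y (sf k)) / Z k ^+ 2.
have cv_ge0 k : (k <= N)%N -> 0 <= cv k.
  move=> kN; rewrite divr_ge0 ?sqr_ge0// subr_ge0.
  have -> : Z k = \sum_(f : {ffun 'I_k -> 'I_N}) wt f y by apply: eq_bigr => f _; rewrite mulr1.
  by apply: chebyshev_ge0 => [f|f g]; [exact: wt_ge0|rewrite -expr2 sqr_ge0].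
have sumcv : \sum_(k < N) gap k * cv k.+1 = 0.
  by rewrite -(sum_dm s) big1// => i _; rewrite dm0 mulr0.
have s_const i j : s i = s j.
  have [N1|N1] := leqP N 1.
    congr s; apply: val_inj; have := ltn_ord i; have := ltn_ord j.
    by case: (N) N1 i j => [|[|//]] _ [[]//] ? [[]//] ?.
  have cvN : cv N = 0.
    rewrite /cv wsum_full//.
    have -> : wsum y (fun f : {ffun 'I_N -> 'I_N} => sf N f * sf N f) =
        (\sum_i s i) * wsum y (sf N).
      rewrite mulr_sumr; apply: eq_bigr => f _.
      have [fi|nfi] := pselect (injective f); first by rewrite {1}/sf sum_full//; ring.
      by rewrite wt_ninj// !mul0r mulr0.
    by rewrite wsum_full// (_ : _ - _ = 0) ?mul0r//; rewrite /Z; ring.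
  have cv1 : cv 1%N = 0.
    have := sumcv; rewrite (bigD1 (Ordinal N0))//= => /eqP.
    rewrite paddr_eq0.
    - by case/andP; rewrite mulf_eq0 gt_eqF ?gap_gt0//= => /eqP.
    - by rewrite mulr_ge0 ?cv_ge0// ltW// gap_gt0.
    - apply: sumr_ge0 => k _; have [kN|kN] := ltnP k.+1 N.
        by rewrite mulr_ge0 ?cv_ge0// ltW// gap_gt0.
      have -> : k.+1 = N by apply/eqP; rewrite eqn_leq kN ltn_ord.
      by rewrite cvN mulr0.
  move: cv1; rewrite /cv => /eqP; rewrite mulf_eq0 invr_eq0 expf_eq0 /= [Z 1 == 0]gt_eqF ?wsum1_gt0// orbF.
  rewrite subr_eq0.
  have -> : Z 1 = \sum_(f : {ffun 'I_1 -> 'I_N}) wt f y by apply: eq_bigr => f _; rewrite mulr1.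
  move=> /eqP cheb.
  pose fi : {ffun 'I_1 -> 'I_N} := [ffun=> i]; pose fj : {ffun 'I_1 -> 'I_N} := [ffun=> j].
  have sq (f g : {ffun 'I_1 -> 'I_N}) : 0 <= (sf 1 f - sf 1 g) * (sf 1 f - sf 1 g).
    by rewrite -expr2 sqr_ge0.
  have := chebyshev_eq (f := fi) (g := fj) (fun f => wt_ge0 f y) sq cheb.
  move=> /(_ (wt_gt0 y0 (@fun1_inj _)) (wt_gt0 y0 (@fun1_inj _)))/eqP.
  by rewrite mulf_eq0 orbb subr_eq0 /sf !big_ord1 !ffunE => /eqP.
have s0 : s (Ordinal N0) = 0.
  have : dN = nrm2 y * s (Ordinal N0).
    by rewrite mulr_suml; apply: eq_bigr => i _; rewrite mulrA (s_const i (Ordinal N0)).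
  by rewrite dN0 => /esym/eqP; rewrite mulf_eq0 gt_eqF ?nrm2_gt0//= => /eqP.
apply/rowP => i; rewrite mxE.
have := s_const i (Ordinal N0); rewrite s0 /s => /eqP.
by rewrite !mulf_eq0 invr_eq0 [y 0 i == 0]gt_eqF// orbF pnatr_eq0 /= => /eqP.
Qed.

Definition mmu_inv : 'rV[R]_N -> 'rV[R]_N := local_inv mmu_nrm pos_orthant.

Lemma mmu_invK y : pos_orthant y -> mmu_inv (mmu_nrm y) = y.
Proof. by apply: local_invK; exact: mmu_nrm_inj. Qed.

Lemma mmu_image_open : open (mmu_nrm @` pos_orthant).
Proof.
apply: open_image; [exact: pos_orthant_open|exact: smooth_mmu_nrm|exact: mmu_nrm_inj|].
exact: dmmu_nrm_inj.
Qed.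

Lemma smooth_mmu_inv : smooth (mmu_nrm @` pos_orthant) mmu_inv.
Proof.
apply: smooth_local_inv; [exact: pos_orthant_open|exact: smooth_mmu_nrm|exact: mmu_nrm_inj|].
exact: dmmu_nrm_inj.
Qed.

End Normalized.

End MomentCoordinates.

(** * The permutohedron *)

Section ConvexHull.
Variable R : realType.

Lemma simplex_compact K : compact [set t : 'rV[R]_K | (forall i, 0 <= t 0 i) /\ \sum_i t 0 i = 1].
Proof.
apply: bounded_closed_compact.
  exists 1; split; [exact: num_real|move=> M M1 t [t0 t1]].
  rewrite /Num.Def.normr/= mx_normrE; apply: bigmax_le; first exact: ltW (lt_trans ltr01 M1).
  move=> [i j] _ /=; rewrite ord1 ger0_norm//; apply: ltW; apply: le_lt_trans M1.
  by rewrite -t1 (bigD1 j)//= lerDl sumr_ge0.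
have -> : [set t : 'rV[R]_K | (forall i, 0 <= t 0 i) /\ \sum_i t 0 i = 1] =
    (\bigcap_(i in [set: 'I_K]) (fun t : 'rV[R]_K => t 0 i) @^-1` [set x | 0 <= x]) `&`
    ((fun t : 'rV[R]_K => \sum_i t 0 i) @^-1` [set x | x = 1]).
  by apply/seteqP; split=> t /= [t0 t1]; split=> // i; [move=> _; exact: t0|exact: t0].
apply: closedI.
  apply: closed_bigI => i _; apply: preimage_closed; last exact: closed_ge.
  by move=> x _; exact: coord_continuous.
apply: preimage_closed; last exact: closed_eq.
move=> x _.
suff C : isCk 0 setT (fun t : 'rV[R]_K => \sum_i t 0 i : R) by exact: C.
apply: isCk_sum; [exact: openT|move=> i _].
by apply: isCk_coord; [exact: openT|exact: isCk_id].
Qed.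

(* The point of the hull closest to [v] is [v] itself. *)
Lemma convex_hull_of_support (S : finType) N (p : S -> 'rV[R]_N) (v : 'rV[R]_N) :
  (forall r : 'I_N -> R, exists s, \sum_i r i * v 0 i <= \sum_i r i * p s 0 i) ->
  exists t : S -> R, [/\ forall s, 0 <= t s, \sum_s t s = 1 & v = \sum_s t s *: p s].
Proof.
move=> supp; pose K := #|S|.
pose X (t : 'rV[R]_K) : 'rV[R]_N := \sum_i t 0 i *: p (enum_val i).
pose D (t : 'rV[R]_K) : R := \sum_j (v 0 j - X t 0 j) * (v 0 j - X t 0 j).
have XE t j : X t 0 j = \sum_i t 0 i * p (enum_val i) 0 j.
  by rewrite summxE; apply: eq_bigr => i _; rewrite mxE.
have [s0 _] := supp (fun=> 0).
pose T := [set t : 'rV[R]_K | (forall i, 0 <= t 0 i) /\ \sum_i t 0 i = 1].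
have vertex s : T (delta_mx 0 (enum_rank s)).
  split=> [i|]; first by rewrite mxE ler0n.
  rewrite (bigD1 (enum_rank s))//= mxE !eqxx big1 ?addr0// => i ni.
  by rewrite mxE (negbTE ni).
have cD : {within T, continuous D}.
  apply: continuous_subspaceT; suff C : isCk 0 setT D by move=> x; exact: C.
  have CX j : isCk 0 setT (fun t => v 0 j - X t 0 j : R).
    apply: isCkD; [exact: openT|exact: isCk_cst|apply: isCkN; first exact: openT].
    have H : isCk 0 setT (fun t : 'rV[R]_K => \sum_i t 0 i * p (enum_val i) 0 j : R).
      apply: isCk_sum; [exact: openT|move=> i _]; apply: isCkM; [exact: openT| |exact: isCk_cst].
      by apply: isCk_coord; [exact: openT|exact: isCk_id].
    by apply: (eq_isCk openT _ H) => t _; rewrite XE.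
  by apply: isCk_sum; [exact: openT|move=> j _; apply: isCkM; [exact: openT|exact: CX|exact: CX]].
have Tne : T !=set0 by exists (delta_mx 0 (enum_rank s0)); exact: vertex.
have [t tT tmin] := @EVT_min_rV _ _ D T Tne (@simplex_compact K) cD.
rewrite inE in tT; case: (tT) => t0 t1.
pose r j := v 0 j - X t 0 j.
(* First-order optimality of the closest point X t: moving from it towards a vertex p s cannot
   decrease the distance to v. *)
have opt s : \sum_j r j * (p s 0 j - X t 0 j) <= 0.
  set b := \sum_j _; pose c := \sum_j (p s 0 j - X t 0 j) ^+ 2.
  have c0 : 0 <= c by apply: sumr_ge0 => j _; exact: sqr_ge0.
  have ineq e : 0 <= e <= 1 -> 0 <= e ^+ 2 * c - 2 * e * b.
    move=> /andP[e0 e1]; pose te := (1 - e) *: t + e *: delta_mx 0 (enum_rank s).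
    have [d0 d1] := vertex s.
    have Tte : te \in T.
      rewrite inE; split=> [i|].
        by rewrite mxE [X in X + _]mxE [X in _ + X]mxE addr_ge0 ?mulr_ge0 ?subr_ge0.
      under eq_bigr do rewrite mxE [X in X + _]mxE [X in _ + X]mxE.
      by rewrite big_split /= -!mulr_sumr t1 d1 !mulr1 subrK.
    have Xte j : X te 0 j = X t 0 j + e * (p s 0 j - X t 0 j).
      rewrite !XE; under eq_bigr do rewrite mxE [X in X + _]mxE [X in _ + X]mxE mulrDl -!mulrA.
      rewrite big_split /= -!mulr_sumr [X in _ + e * X](_ : _ = p s 0 j); last first.
        rewrite (bigD1 (enum_rank s))//= mxE !eqxx mul1r enum_rankK big1 ?addr0// => i ni.
        by rewrite mxE (negbTE ni) mul0r.
      ring.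
    have := tmin te Tte; rewrite -subr_ge0; congr (_ <= _).
    rewrite /D -sumrB /c /b !mulr_sumr -sumrB; apply: eq_bigr => j _.
    by rewrite Xte /r; ring.
  rewrite leNgt; apply/negP => b0.
  have cb : 0 < c + b by rewrite ltr_wpDl.
  (* A step length in (0, 1] with e c <= b, which makes e^2 c - 2 e b negative. *)
  pose e := b / (c + b).
  have e01 : 0 < e <= 1 by rewrite divr_gt0//= ler_pdivrMr// mul1r lerDr.
  have := ineq e; rewrite (ltW (andP e01).1) (andP e01).2 => /(_ isT).
  apply/negP; rewrite -ltNge.
  have -> : e ^+ 2 * c - 2 * e * b = e * (e * c - 2 * b) by ring.
  rewrite pmulr_rlt0 ?(andP e01).1// subr_lt0.
  have : e * c <= b by rewrite /e mulrAC ler_pdivrMr// ler_pM2l// lerDl ltW.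
  lra.
(* The hypothesis for the functional r = v - X t yields a vertex p s at least as far in direction r
   as v; with optimality, |r|^2 <= 0. *)
have r0 j : r j = 0.
  have [s sP] := supp r.
  have rr : \sum_j r j ^+ 2 <= 0.
    apply: le_trans (opt s).
    have -> : \sum_j r j ^+ 2 = \sum_j r j * v 0 j - \sum_j r j * X t 0 j.
      by rewrite -sumrB; apply: eq_bigr => i _; rewrite expr2 {2}/r mulrBr.
    have -> : \sum_j r j * (p s 0 j - X t 0 j) = \sum_j r j * p s 0 j - \sum_j r j * X t 0 j.
      by rewrite -sumrB; apply: eq_bigr => i _; rewrite mulrBr.
    by rewrite lerD2r.
  have : \sum_j r j ^+ 2 == 0 by rewrite eq_le rr sumr_ge0// => i _; exact: sqr_ge0.
  rewrite psumr_eq0; last by move=> i _; exact: sqr_ge0.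
  by move=> /allP/(_ j (mem_index_enum _))/=; rewrite sqrf_eq0 => /eqP.
exists (fun s => t 0 (enum_rank s)); split=> //.
  by rewrite -t1 [RHS](reindex enum_rank)//=; exact: onW_bij (@enum_rank_bij S).
apply/rowP => j; have /eqP := r0 j; rewrite subr_eq0 => /eqP ->.
rewrite XE summxE (reindex enum_rank)/=; last exact: onW_bij (@enum_rank_bij S).
by apply: eq_bigr => s _; rewrite mxE enum_rankK.
Qed.

End ConvexHull.

Section DoublyStochastic.
Variable R : realType.

(* Dual potentials for the assignment problem with cost [r i * u j]. *)
Lemma assignment_potential N (r u : nat -> R) :
  (forall i j, (i <= j < N)%N -> r j <= r i) -> (forall i j, (i <= j < N)%N -> u j <= u i) ->
  let b k := \sum_(l < k) r l.+1 * (u l.+1 - u l) in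
  forall i j, (i < N)%N -> (j < N)%N -> r i * (u j - u i) <= b j - b i.
Proof.
move=> rd ud b i j iN jN.
have bS k : b k.+1 = b k + r k.+1 * (u k.+1 - u k) by rewrite /b big_ord_recr.
have [ij|/ltnW ji] := leqP i j.
  suff H d : (i + d < N)%N -> r i * (u (i + d)%N - u i) <= b (i + d)%N - b i.
    by have := H (j - i)%N; rewrite subnKC//; exact.
  elim: d => [|d IH] dN; first by rewrite addn0 !subrr mulr0.
  rewrite addnS in dN *; rewrite bS; have {}IH := IH (ltnW dN).
  have h1 : u (i + d).+1 - u (i + d)%N <= 0 by rewrite subr_le0 ud// leqnSn dN.
  have h2 : r (i + d).+1 <= r i by rewrite rd// dN andbT (leq_trans (leq_addr _ _) (leqnSn _)).
  have := ler_wnM2r h1 h2; lra.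
suff H d : (d <= i)%N -> r i * (u (i - d)%N - u i) <= b (i - d)%N - b i.
  by have := H (i - j)%N; rewrite subKn//; apply; exact: leq_subr.
elim: d => [|d IH] di; first by rewrite subn0 !subrr mulr0.
have {}IH := IH (ltnW di).
have E : (i - d)%N = (i - d.+1).+1 by rewrite subnSK.
rewrite E bS in IH.
have jN' : ((i - d.+1).+1 < N)%N by rewrite -E (leq_ltn_trans (leq_subr _ _)).
have h1 : 0 <= u (i - d.+1)%N - u (i - d.+1).+1 by rewrite subr_ge0 ud// leqnSn jN'.
have h2 : r i <= r (i - d.+1).+1 by rewrite rd// -E leq_subr.
have := ler_wpM2r h1 h2; lra.
Qed.

Lemma sorting_perm N (r : 'I_N -> R) : exists s : 'S_N,
  forall i j : 'I_N, (i <= j)%N -> r (s j) <= r (s i).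
Proof.
pose t := [tuple r i | i < N].
have /tuple_permP[s sE] : perm_eq (sort (fun x y => y <= x) t) t by rewrite perm_sort.
exists s => i j ij.
have srt : sorted (fun x y : R => y <= x) (sort (fun x y => y <= x) t).
  by apply: sort_sorted => x y; exact: le_total.
have nE (k : 'I_N) : nth 0 (sort (fun x y => y <= x) t) k = r (s k).
  by rewrite sE (nth_map k) ?size_enum_ord// nth_ord_enum tnth_mktuple.
rewrite -!nE; apply: (@sorted_leq_nth _ (fun x y : R => y <= x)) => //.
- by move=> x y z yx zy; exact: le_trans zy yx.
- by rewrite inE size_sort size_tuple.
- by rewrite inE size_sort size_tuple.
Qed.

(** Weak linear programming duality in place of a decomposition of [M] into permutation matrices.
    For each functional, the vertex ordered like it dominates: averaging the inequality for the
    potentials against [M] cancels them, as all row and column sums are 1. *)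
Lemma doubly_stochastic_permutohedron N (M : 'I_N -> 'I_N -> R) (nu : 'rV[R]_N) :
  (forall i j, 0 <= M i j) -> (forall i, \sum_j M i j = 1) -> (forall j, \sum_i M i j = 1) ->
  (forall i j : 'I_N, (i <= j)%N -> nu 0 j <= nu 0 i) ->
  permutohedron nu (\row_i \sum_j M i j * nu 0 j).
Proof.
move=> M0 Mr Mc nud.
have [|t [t0 t1 tE]] := @convex_hull_of_support R 'S_N N (fun s => col_perm s nu)
    (\row_i \sum_j M i j * nu 0 j); last by exists t.
move=> r; have [s sr] := sorting_perm r; exists s^-1%g.
pose ext (f : 'I_N -> R) k := if (insub k : option 'I_N) is Some k' then f k' else 0.
have extE f (i : 'I_N) : ext f i = f i by rewrite /ext valK.
have mono f : (forall i j : 'I_N, (i <= j)%N -> f j <= f i) ->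
    forall i j, (i <= j < N)%N -> ext f j <= ext f i.
  move=> fd i j /andP[ij jN]; have iN := leq_ltn_trans ij jN.
  have -> : ext f i = f (Ordinal iN) by exact: (extE f (Ordinal iN)).
  have -> : ext f j = f (Ordinal jN) by exact: (extE f (Ordinal jN)).
  exact: fd.
have := assignment_potential (mono _ sr) (mono _ nud); set b := fun k => _ => /= pot.
have {}pot (i j : 'I_N) : r (s i) * nu 0 j <= r (s i) * nu 0 i - b i + b j.
  have := pot i j (ltn_ord i) (ltn_ord j); rewrite !(extE (fun i => r (s i))) !(extE (nu 0)).
  rewrite -/b mulrBr; lra.
have -> : \sum_i r i * col_perm s^-1%g nu 0 i = \sum_i r (s i) * nu 0 i.
  rewrite (reindex_inj (@perm_inj _ s))/=.
  by apply: eq_bigr => i _; rewrite mxE permK.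
have -> : \sum_i r i * (\row_i \sum_j M i j * nu 0 j) 0 i =
    \sum_i \sum_j M (s i) j * (r (s i) * nu 0 j).
  rewrite (reindex_inj (@perm_inj _ s))/=.
  by apply: eq_bigr => i _; rewrite mxE mulr_sumr; apply: eq_bigr => j _; rewrite mulrCA.
apply: (@le_trans _ _ (\sum_i \sum_j M (s i) j * (r (s i) * nu 0 i - b i + b j))).
  by apply: ler_sum => i _; apply: ler_sum => j _; exact: ler_wpM2l.
under eq_bigr do under eq_bigr do rewrite mulrDr.
under eq_bigr do rewrite big_split /= -mulr_suml Mr mul1r.
rewrite big_split /= exchange_big /= sumrB.
have -> : \sum_(j < N) \sum_(i < N) M (s i) j * b j = \sum_(j < N) b j.
  apply: eq_bigr => j _; rewrite -mulr_suml -[RHS]mul1r; congr (_ * _).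
  by rewrite -(Mc j) [RHS](reindex_inj (@perm_inj _ s)).
by rewrite subrK.
Qed.

End DoublyStochastic.

(** * Flags and the twist *)

Section Triangular.
Variable K : fieldType.

Lemma upperP n (b : 'M[K]_n) : reflect (forall i j : 'I_n, (j < i)%N -> b i j = 0) (is_trig_mx b^T).
Proof.
apply: (iffP is_trig_mxP) => H i j ij; last by rewrite mxE H.
by have := H j i ij; rewrite mxE.
Qed.

Lemma upper_mul n (b c : 'M[K]_n) : is_trig_mx b^T -> is_trig_mx c^T -> is_trig_mx (b *m c)^T.
Proof.
move=> /upperP b0 /upperP c0; apply/upperP => i j ji; rewrite mxE big1// => l _.
have [li|il] := ltnP l i; first by rewrite b0 ?mul0r.
by rewrite c0 ?mulr0// (leq_trans ji).
Qed.

Lemma upper_diag_neq0 n (b : 'M[K]_n) (i : 'I_n) : b \in unitmx -> is_trig_mx b^T -> b i i != 0.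
Proof.
move=> bu bt; move: bu; rewrite unitmxE unitfE -det_tr (det_trig bt) => /prodf_neq0/(_ i isT).
by rewrite mxE.
Qed.

Lemma upper_inv n (b : 'M[K]_n) : b \in unitmx -> is_trig_mx b^T -> is_trig_mx (invmx b)^T.
Proof.
move=> bu bt; have b0 := upperP _ bt; set c := invmx b.
have bc : b *m c = 1%:M by rewrite mulmxV.
apply/upperP => i j; move: {2}(n - i)%N (leqnn (n - i)) => m.
elim: m i => [|m IH] i im ji; first by have := ltn_ord i; lia.
have /matrixP/(_ i j) := bc; rewrite !mxE (bigD1 i)//= big1 ?addr0.
  rewrite -val_eqE /= gtn_eqF// => /eqP; rewrite mulf_eq0 (negbTE (upper_diag_neq0 _ bu bt)).
  by move=> /eqP.
move=> l li; have [lti|ltl] := ltnP l i; first by rewrite b0 ?mul0r.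
have il : (i < l)%N by rewrite ltn_neqAle ltl eq_sym li.
by rewrite IH ?mulr0//; [have := ltn_ord l; lia|exact: ltn_trans il].
Qed.

Lemma ent_mul n (g b : 'M[K]_n) i j :
  ent (g *m b) i j = \sum_(l < n) ent g i l * ent b l j.
Proof.
have [/andP[hi hj]|] := boolP ((i < n) && (j < n))%N.
  rewrite (entE _ hi hj) mxE; apply: eq_bigr => l _.
  by rewrite -(ent_ord g) -(ent_ord b).
rewrite negb_and -!leqNgt => h; rewrite ent_out//; symmetry; apply: big1 => l _.
by case/orP: h => h; [rewrite ent_out ?h// mul0r|rewrite (@ent_out _ _ b) ?h ?orbT// mulr0].
Qed.

Lemma mnr_upper n (g b : 'M[K]_n) s : is_trig_mx b^T -> (size s <= n)%N ->
  mnr (ent (g *m b)) s = mnr (ent g) s * \prod_(j < size s) ent b j j.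
Proof.
move=> /upperP b0 sn.
have bt : is_trig_mx (\matrix_(i < size s, j < size s) ent b i j)^T.
  apply/upperP => i j ji; rewrite mxE.
  rewrite -[i : nat]/(val (widen_ord sn i)) -[j : nat]/(val (widen_ord sn j)) ent_ord.
  exact: b0.
have -> : \prod_(j < size s) ent b j j = \det (\matrix_(i < size s, j < size s) ent b i j).
  by rewrite -det_tr (det_trig bt); apply: eq_bigr => j _; rewrite !mxE.
rewrite -det_mulmx; congr (\det _); apply/matrixP => i j; rewrite !mxE ent_mul.
under [RHS]eq_bigr do rewrite !mxE.
rewrite (big_ord_widen _ (fun l => ent g (nth 0%N s i) l * ent b l j) sn).
rewrite [RHS]big_mkcond; apply: eq_bigr => l _; case: ltnP => // sl.
rewrite -[j : nat]/(val (widen_ord sn j)) (ent_ord b) b0 ?mulr0//=.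
exact: leq_trans sl.
Qed.

(** LU factorization by bordering: the leading n x n block is invertible, so it can be used to clear
    the last row. *)
Lemma lower_to_upper n (A : nat -> nat -> K) :
  (forall k, (k <= n)%N -> \det (\matrix_(i < k, j < k) A i j) != 0) ->
  exists2 l : 'M[K]_n, l \in unitmx /\ is_trig_mx l &
    is_trig_mx (l *m (\matrix_(i < n, j < n) A i j))^T.
Proof.
elim: n => [|n IH] minors.
  exists 1%:M; last by apply/is_trig_mxP => -[].
  by split; [exact: unitmx1|exact: scalar_mx_is_trig].
have [|l [lu lt] ut] := IH; first by move=> k kn; apply: minors; exact: leqW.
set B := \matrix_(i < n, j < n) A i j.
have Bu : B \in unitmx by rewrite unitmxE unitfE minors.
pose c : 'rV[K]_n := \row_j A n j.
suff H : exists2 l : 'M[K]_(n + 1), l \in unitmx /\ is_trig_mx l &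
    is_trig_mx (l *m (\matrix_(i < n + 1, j < n + 1) A i j))^T.
  by move: H; rewrite addn1.
have -> : \matrix_(i < n + 1, j < n + 1) A i j =
    block_mx B (\col_i A i n) c (A n n)%:M.
  apply/matrixP => i j; rewrite mxE.
  case: (split_ordP i) => i' ->; case: (split_ordP j) => j' ->;
    rewrite ?block_mxEul ?block_mxEur ?block_mxEdl ?block_mxEdr ?mxE /= ?ord1 ?addn0 //=.
exists (block_mx l 0 (- (c *m invmx B)) 1%:M).
  split; last by rewrite is_trig_block_mx// eqxx lt scalar_mx_is_trig.
  by rewrite unitmxE det_lblock det1 mulr1 -unitmxE.
rewrite mulmx_block !mul0mx !addr0 mulNmx mulmxKV// mul1mx addNr tr_block_mx trmx0.
by rewrite is_trig_block_mx// eqxx ut mx11_is_trig.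
Qed.

End Triangular.

Section QR.
Variable C : numClosedFieldType.

(** [schmidt] orthonormalizes rows, hence the transposes. *)
Lemma QR n (G : 'M[C]_n) : G \in unitmx ->
  exists u b, [/\ u \is unitarymx, b \in unitmx, is_trig_mx b^T & G = u *m b].
Proof.
move=> Gu; pose S := schmidt G^T.
have Su : S \is unitarymx by exact: schmidt_unitarymx.
pose B := G^T *m invmx S.
have GB : G^T = B *m S by rewrite mulmxKV// unitarymx_unit.
exists S^T, B^T; split.
- by rewrite trmx_unitary.
- by rewrite unitmx_tr unitmx_mul unitmx_tr Gu unitmx_inv unitarymx_unit.
- rewrite trmxK; apply/is_trig_mxP => i j ij.
  (* Row i of G^T lies in the span of the rows of S up to index i, and each of these is annihilated
     by the column j > i of the inverse of S. *)
  have : (row i G^T <= kermx (col j (invmx S)))%MS.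
    apply: submx_trans (row_schmidt_sub _ _) _; apply/sumsmx_subP => k ki; rewrite genmxE.
    apply/sub_kermxP/matrixP => a b; rewrite !mxE.
    have /matrixP/(_ k j) := mulmxV (unitarymx_unit Su); rewrite !mxE => E.
    rewrite (eq_bigr (fun l => S k l * invmx S l j)); last by move=> l _; rewrite !mxE.
    by rewrite E -val_eqE /= ltn_eqF// (leq_ltn_trans ki).
  move=> /sub_kermxP/matrixP/(_ 0 0); rewrite !mxE => H; rewrite -[RHS]H.
  by apply: eq_bigr => l _; rewrite !mxE.
- by rewrite -trmx_mul -GB trmxK.
Qed.

End QR.

Section Flags.
Variable R : realType.
Local Notation C := R[i].
Local Notation "z ^*" := (Num.conj z).

Lemma borel_mul n (b c : 'M[C]_n) : borel b -> borel c -> borel (b *m c).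
Proof. by move=> [bu bt] [cu ct]; split; [rewrite unitmx_mul bu|exact: upper_mul]. Qed.

Lemma borel_inv n (b : 'M[C]_n) : borel b -> borel (invmx b).
Proof. by move=> [bu bt]; split; [rewrite unitmx_inv|exact: upper_inv]. Qed.

Lemma borel1 n : borel (1%:M : 'M[C]_n).
Proof. by split; [exact: unitmx1|rewrite trmx1; exact: scalar_mx_is_trig]. Qed.

Lemma flag_of_refl n (g : 'M[C]_n) : flag_of g g.
Proof. by exists 1%:M; [exact: borel1|rewrite mulmx1]. Qed.

Lemma flag_of_mul n (g b : 'M[C]_n) : borel b -> flag_of (g *m b) = flag_of g.
Proof.
move=> bb; apply/seteqP; split=> _ [c bc <-].
  by exists (b *m c); [exact: borel_mul|rewrite mulmxA].
exists (invmx b *m c); first by apply: borel_mul => //; exact: borel_inv.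
by rewrite mulmxA mulmxK//; case: bb.
Qed.

Lemma flag_of_mem n (g g' : 'M[C]_n) : flag_of g g' -> flag_of g' = flag_of g.
Proof. by move=> [b bb <-]; exact: flag_of_mul. Qed.

Lemma flag_of_eq n (g g' : 'M[C]_n) : flag_of g = flag_of g' -> exists2 b, borel b & g' = g *m b.
Proof.
move=> E; have : flag_of g g' by rewrite E; exact: flag_of_refl.
by move=> [b bb <-]; exists b.
Qed.

Lemma borel_diag n (d : 'rV[C]_n) : (forall i, d 0 i != 0) -> borel (diag_mx d).
Proof.
move=> d0; split; last by rewrite tr_diag_mx; exact: diag_mx_is_trig.
by rewrite unitmxE det_diag unitfE; apply/prodf_neq0.
Qed.

Lemma i_diagE n (lam : 'rV[R]_n) : i_diag lam = diag_mx (\row_j (Complex 0 1 * (lam 0 j)%:C%C)).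
Proof. by apply/matrixP => i j; rewrite !mxE mulrnAr. Qed.

Lemma i_neq0 : (Complex 0 1 : C) != 0.
Proof. by rewrite eq_complex /= negb_and oner_eq0 orbT. Qed.

Lemma commute_i_diag n (lam : 'rV[R]_n) (c : 'M[C]_n) : strictly_decreasing lam ->
  c *m i_diag lam = i_diag lam *m c -> is_diag_mx c.
Proof.
move=> ld; rewrite i_diagE => /matrixP cD; apply/is_diag_mxP => i j ij.
have := cD i j; rewrite mul_mx_diag mul_diag_mx !mxE => /eqP.
rewrite mulrC -subr_eq0 -mulrBl mulf_eq0 => /orP[|/eqP//].
rewrite -mulrBr mulf_eq0 (negbTE i_neq0) /= subr_eq0 => /eqP[] E.
have := ssrnat.ltngtP i j.
case => h.
- by have := ld _ _ h; rewrite E ltxx.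
- by have := ld _ _ h; rewrite E ltxx.
- by move: ij; rewrite (ord_inj h) eqxx.
Qed.

Lemma diag_mx_comm_i_diag n (lam : 'rV[R]_n) (c : 'M[C]_n) : is_diag_mx c ->
  c *m i_diag lam = i_diag lam *m c.
Proof.
move=> /is_diag_mxP cd; rewrite i_diagE mul_mx_diag mul_diag_mx; apply/matrixP => i j; rewrite !mxE.
have [->|ij] := eqVneq i j; first by rewrite mulrC.
by rewrite cd ?mul0r ?mulr0.
Qed.

Lemma same_orbit_point n (lam : 'rV[R]_n) (g c : 'M[C]_n) : g \in unitmx -> c \in unitmx ->
  c *m i_diag lam = i_diag lam *m c ->
  (g *m c) *m i_diag lam *m invmx (g *m c) = g *m i_diag lam *m invmx g.
Proof.
move=> gu cu cD; have gcu : g *m c \in unitmx by rewrite unitmx_mul gu.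
apply: (can_inj (mulmxK gcu)); rewrite (mulmxKV gcu) -!mulmxA cD.
by rewrite (mulmxA (invmx g)) (mulVmx gu) mul1mx.
Qed.

(** A unitary triangular b has an upper triangular inverse that is also its conjugate transpose. *)
Lemma unitary_borel_diag n (g b : 'M[C]_n) : g \is unitarymx -> g *m b \is unitarymx ->
  borel b -> is_diag_mx b.
Proof.
move=> gu gbu bb; have [bu bt] := bb.
have bU : b \is unitarymx.
  have -> : b = invmx g *m (g *m b) by rewrite mulKmx// unitarymx_unit.
  apply: mul_unitarymx => //.
  by rewrite (invmx_unitary gu) trmxC_unitary.
have [_ it] := borel_inv bb.
rewrite is_diag_mxEtrig bt andbT; apply/is_trig_mxP => i j ij.
move/is_trig_mxP : it; rewrite (invmx_unitary bU) => /(_ i j ij).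
rewrite !mxE => /eqP; rewrite conjC_eq0 => /eqP //.
Qed.

(** Two unitary matrices giving the same L differ by a matrix commuting with [i_diag lam]; it is
    diagonal since the entries of lam are distinct, hence lies in the Borel subgroup. *)
Lemma flag_of_orbitE n (lam : 'rV[R]_n) g : strictly_decreasing lam -> g \is unitarymx ->
  flag_of_orbit lam (g *m i_diag lam *m invmx g) = flag_of g.
Proof.
move=> ld gu; rewrite /flag_of_orbit; case: xgetP => [V _ /= [g' [g'u E ->]]|/(_ (flag_of g))].
  have gU := unitarymx_unit gu; have g'U := unitarymx_unit g'u.
  pose c := invmx g *m g'.
  have cU : c \in unitmx by rewrite unitmx_mul unitmx_inv gU.
  have cD : c *m i_diag lam = i_diag lam *m c.
    rewrite /c; apply: (can_inj (mulKmx gU)); rewrite -!mulmxA mulKVmx//.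
    apply: (can_inj (mulmxK (_ : invmx g' \in unitmx))); first by rewrite unitmx_inv.
    by rewrite -E -!mulmxA mulmxV// mulmx1.
  have -> : g' = g *m c by rewrite mulKVmx.
  rewrite flag_of_mul//; split=> //.
  by have := commute_i_diag ld cD; rewrite is_diag_mxEtrig => /andP[].
by case; exists g; split.
Qed.

(** The representative picked inside [plucker] is g times an upper triangular b, and [c] collects
    the products of leading diagonal entries of b. *)
Lemma plucker_scale n (g : 'M[C]_n) : exists c : nat -> C,
  (forall k, (k <= n)%N -> c k != 0) /\
  forall I, plucker (flag_of g) I = c #|I| * mnr (ent g) (sseq I).
Proof.
rewrite /plucker; case: xgetP => [h _ [b [bu bt] <-]|/(_ g)]; last by case; exact: flag_of_refl.
exists (fun k => \prod_(j < k) ent b j j); split=> [k kn|I].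
  apply/prodf_neq0 => j _; rewrite -[j : nat]/(val (widen_ord kn j)) ent_ord.
  exact: upper_diag_neq0.
by rewrite DeltaE mnr_upper ?size_sseq ?card_set_ord// mulrC.
Qed.

Lemma lexi_nth_le (s t : seq nat) : size s = size t ->
  (forall i, nth 0%N s i <= nth 0%N t i)%N -> ((s : seqlexi nat) <= (t : seqlexi nat))%O.
Proof.
elim: s t => [|x s IH] [|y t] //= [st] le; rewrite lexi_cons.
have xy := le 0%N; rewrite -leEnat in xy; rewrite xy /=; apply/implyP => _.
by apply: IH => // i; exact: (le i.+1).
Qed.

Lemma nth_sorted_le n s i : sorted ltn s -> all (fun i => i < n)%N s -> (i < size s)%N ->
  (nth 0%N s i + (size s - i) <= n)%N.
Proof.
move=> ss /allP sn; move: {2}(size s - i)%N (erefl (size s - i)%N) => m;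
elim: m i => [|m IH] i im isz; first by lia.
have [last_i|next] := eqVneq i.+1 (size s).
  have h := sn _ (mem_nth 0%N isz).
    by rewrite (_ : (size s - i)%N = 1%N) ?addn1//; lia.
have isz' : (i.+1 < size s)%N by rewrite ltn_neqAle next.
have := IH i.+1; rewrite isz'; have : (size s - i.+1 = m)%N by lia.
move=> E /(_ E isT).
have : (nth 0%N s i < nth 0%N s i.+1)%N by apply: (sorted_ltn_nth ltn_trans) => //; rewrite inE.
lia.
Qed.

(** The i-th element of a k-subset is at most n - k + i (counting from 0), and entrywise domination
    implies lexicographic order. *)
Lemma lex_lt_last n (I J : {set 'I_n}) : sseq J = iota (n - #|I|) #|I| ->
  I != J -> lex_lt I J.
Proof.
move=> JE IJ; rewrite /lex_lt lt_neqAle -/(sseq I) -/(sseq J); apply/andP; split.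
  apply: contra IJ => /eqP E; apply/eqP/setP => i.
  by rewrite -!mem_sseq E.
apply: lexi_nth_le; first by rewrite JE size_iota size_sseq.
move=> i; have [iI|iI] := ltnP i #|I|; last by rewrite nth_default ?size_sseq.
rewrite JE nth_iota//.
have := @nth_sorted_le n _ i (sseq_sorted I) (sseq_lt I); rewrite size_sseq => /(_ iI).
have := card_set_ord I; lia.
Qed.

End Flags.

(** * The open Schubert cell and the canonical representative there *)

Section BigCell.
Variable R : realType.
Local Notation C := R[i].
Local Notation "z ^*" := (Num.conj z).

Lemma card_ord_lt n k : (k <= n)%N -> #|[set j : 'I_n | (j < k)%N]%SET| = k.
Proof.
move=> kn; have -> : [set j : 'I_n | (j < k)%N]%SET = widen_ord kn @: [set: 'I_k]%SET.
  apply/setP => j; rewrite inE; apply/idP/imsetP => [jk|[i _ ->]]; last by rewrite /= ltn_ord.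
  by exists (Ordinal jk) => //; apply: val_inj.
rewrite card_imset ?cardsT ?card_ord// => i j /(congr1 val) /= ij; exact: val_inj.
Qed.

Lemma card_perm_prefix n (w : 'S_n) k : (k <= n)%N -> #|perm_prefix w k| = k.
Proof. by move=> kn; rewrite /perm_prefix card_imset ?card_ord_lt//; exact: perm_inj. Qed.

(** The longest permutation, whose cell is the open one; its prefixes are the sets of last k
    rows. *)
Definition w0 n : 'S_n := perm (@rev_ord_inj n).

Lemma sseq_w0 n k : (k <= n)%N -> sseq (perm_prefix (w0 n) k) = iota (n - k) k.
Proof.
move=> kn; apply: (@sorted_last_interval n); first by rewrite subnK.
- exact: sseq_sorted.
- by rewrite size_sseq card_perm_prefix.
- apply/allP => _ /mapP[i + ->]; rewrite mem_enum => /imsetP[j].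
  by rewrite inE permE => jk -> /=; have := ltn_ord j; lia.
Qed.

(** The sign in column b is the one produced by expanding along the first row, so the signs of
    [w0_mx] are the right ones. *)
Lemma antidiag_det k :
  \det (\matrix_(a < k, b < k) if (a + b).+1 == k then (-1) ^+ b else 0 : C) = 1.
Proof.
elim: k => [|k IH]; first by rewrite det_mx00.
rewrite (expand_det_row _ ord0) (bigD1 ord_max)//= big1 ?addr0; last first.
  by move=> b bk; rewrite mxE add0n eqSS ifN ?mul0r//.
rewrite mxE add0n eqxx /cofactor add0n mulrA -expr2 sqrr_sign mul1r -[RHS]IH.
congr (\det _); apply/matrixP => a b; rewrite !mxE.
have -> : lift (ord0 : 'I_k.+1) a = a.+1 :> nat by rewrite lift0.
have -> : lift (ord_max : 'I_k.+1) b = b :> nat by rewrite lift_max.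
by rewrite addSn eqSS.
Qed.

Definition w0_mx n : 'M[C]_n := \matrix_(i, j) if i == rev_ord j then (-1) ^+ j else 0.

Lemma mnr_w0_mx n k : (k <= n)%N -> mnr (ent (w0_mx n)) (iota (n - k) k) = 1.
Proof.
move=> kn; rewrite (@mnrE _ k) ?size_iota// -[RHS](antidiag_det k).
congr (\det _); apply/matrixP => a b; rewrite !mxE nth_iota//.
have ha : (n - k + a < n)%N by have := ltn_ord a; lia.
have hb : (b < n)%N by have := ltn_ord b; lia.
rewrite (entE _ ha hb) mxE -val_eqE /=; congr (if _ then _ else _).
have := ltn_ord a; have := ltn_ord b; lia.
Qed.

Lemma w0_mx_signed n : signed_perm (w0 n) (w0_mx n).
Proof.
split=> [i j|I].
  rewrite permE mxE; case: eqP => // _; case: (odd j) (signr_odd C j) => <- /=.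
    by right; rewrite expr1.
  by left; rewrite expr0.
rewrite DeltaE; set k := #|I|; have kn : (k <= n)%N := card_set_ord I.
have [full|] := boolP (all (fun i => n - k <= i < n)%N (sseq I)).
  rewrite (@sorted_last_interval n (n - k) k (sseq I)) ?mnr_w0_mx ?ler01//.
  - by rewrite subnK.
  - exact: sseq_sorted.
  - exact: size_sseq.
(* Row x < n - k of [w0_mx] has its nonzero entry in column n - 1 - x, beyond the first k columns,
   so the minor has a zero row. *)
move=> /allPn[x xI nx]; have xn := allP (sseq_lt I) _ xI; rewrite xn andbT -ltnNge in nx.
have hx : (index x (sseq I) < size (sseq I))%N by rewrite index_mem.
rewrite /mnr (expand_det_row _ (Ordinal hx)) big1// => j _.
rewrite mxE /= nth_index//.
have hj : (j < n)%N by have := ltn_ord j; rewrite [in X in (_ < X)%N -> _]size_sseq => /leq_trans; apply.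
rewrite (entE _ xn hj) mxE -val_eqE /= ifN ?mul0r//.
have : (j < k)%N by have := ltn_ord j; rewrite [in X in (_ < X)%N -> _]size_sseq.
lia.
Qed.

(** Reversing the rows turns the minors in the last k rows into leading principal minors, so LU
    factorization applies; conjugation by the reversal makes the lower triangular factor upper
    triangular. *)
Lemma big_cell n (g : 'M[C]_n) : g \in unitmx ->
  (forall k, (k <= n)%N -> mnr (ent g) (iota (n - k) k) != 0) ->
  schubert_cell (w0 n) (flag_of g).
Proof.
move=> gu gm; pose A i j := ent g (n.-1 - i) j.
have minors k : (k <= n)%N -> \det (\matrix_(i < k, j < k) A i j) != 0.
  move=> kn; pose s := [seq (n.-1 - i)%N | i <- iota 0 k].
  have -> : \det (\matrix_(i < k, j < k) A i j) = mnr (ent g) s.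
    rewrite (@mnrE _ k) ?size_map ?size_iota//; congr (\det _); apply/matrixP => i j.
    by rewrite !mxE (nth_map 0%N) ?size_iota// nth_iota.
  have [b bP] := mnr_sort C s; rewrite (bP _ [::]) mulf_neq0 ?signr_eq0//.
  rewrite (_ : sort leq s = iota (n - k) k) ?gm//.
  have us : uniq s.
    rewrite map_inj_in_uniq ?iota_uniq// => x y; rewrite !mem_iota; lia.
  apply: (@sorted_last_interval n); first by rewrite subnK.
  - by rewrite ltn_sorted_uniq_leq sort_uniq us (sort_sorted leq_total).
  - by rewrite size_sort size_map size_iota.
  - by rewrite all_sort all_map; apply/allP => i; rewrite mem_iota /=; lia.
have [l [lu lt] ut] := lower_to_upper minors.
set Ag := \matrix_(i, j) _ in ut.
pose P : 'M[C]_n := \matrix_(i, j) (i == rev_ord j)%:R.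
have PL (B : 'M[C]_n) i j : (P *m B) i j = B (rev_ord i) j.
  rewrite mxE (bigD1 (rev_ord i))//= mxE rev_ordK eqxx mul1r big1 ?addr0// => a ai.
  rewrite mxE (_ : (i == rev_ord a) = false) ?mul0r//.
  by apply: contraNF ai => /eqP ->; rewrite rev_ordK.
have PR (B : 'M[C]_n) i j : (B *m P) i j = B i (rev_ord j).
  rewrite mxE (bigD1 (rev_ord j))//= mxE eqxx mulr1 big1 ?addr0// => a ai.
  by rewrite mxE (negbTE ai) mulr0.
have PP : P *m P = 1%:M by apply/matrixP => i j; rewrite PL !mxE (inj_eq rev_ord_inj).
have AgE : Ag = P *m g.
  apply/matrixP => i j; rewrite PL mxE /A -(ent_ord g) /=; congr (ent g _ _).
  by have := ltn_ord i; lia.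
have Pu : P \in unitmx by case/mulmx1_unit: PP.
pose b := P *m invmx l *m P.
pose d : 'rV[C]_n := \row_j (-1) ^+ j.
have d0 i : d 0 i != 0 by rewrite mxE signr_eq0.
have bd : borel (diag_mx d) by exact: borel_diag.
have M0E : w0_mx n = P *m diag_mx d.
  apply/matrixP => i j; rewrite mul_mx_diag !mxE.
  by case: eqP => _; rewrite ?mul1r ?mul0r.
have dd : diag_mx d *m diag_mx d = 1%:M.
  rewrite mulmx_diag -diag_const_mx; congr diag_mx; apply/rowP => j; rewrite !mxE.
  by rewrite -expr2 sqrr_sign.
exists (w0_mx n), b; split; first exact: w0_mx_signed.
  split; first by rewrite !unitmx_mul Pu unitmx_inv lu.
  apply/upperP => i j ji; rewrite PR PL.
  have /is_trig_mxP it : is_trig_mx (invmx l).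
    have := @upper_inv _ _ l^T; rewrite unitmx_tr trmxK => /(_ lu lt).
    by rewrite -trmx_inv trmxK.
  by apply: it => /=; have := ltn_ord i; lia.
have gE : g = b *m w0_mx n *m (diag_mx d *m (l *m Ag)).
  rewrite M0E AgE /b !mulmxA -(mulmxA _ P P) PP mulmx1.
  rewrite -(mulmxA _ (diag_mx d) (diag_mx d)) dd mulmx1 mulmxKV// -!mulmxA (mulmxA P P) PP mul1mx.
  by [].
have bu : borel (l *m Ag) by split; [rewrite AgE !unitmx_mul lu Pu; exact: gu|exact: ut].
by rewrite {1}gE (flag_of_mul _ (borel_mul bd bu)).
Qed.

(** Multiply g by the diagonal unitary matrix with entries u_(j+1) / u_j: the products of its
    leading entries telescope to u_k. *)
Lemma phase_adjust n (g : 'M[C]_n) (u : nat -> C) : g \is unitarymx ->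
  (forall k, `|u k| = 1) -> u 0%N = 1 -> exists g', [/\ g' \is unitarymx,
    flag_of g' = flag_of g,
    forall lam : 'rV[R]_n, g' *m i_diag lam *m invmx g' = g *m i_diag lam *m invmx g &
    forall s, (size s <= n)%N -> mnr (ent g') s = u (size s) * mnr (ent g) s].
Proof.
move=> gu u1 u0; have un k : u k != 0 by rewrite -normr_gt0 u1.
pose d : 'rV[C]_n := \row_j (u j.+1 / u j).
have d0 i : d 0 i != 0 by rewrite mxE mulf_neq0 ?invr_eq0.
have bd : borel (diag_mx d) by exact: borel_diag.
have du : diag_mx d \is unitarymx.
  apply/unitarymxP; rewrite tr_diag_mx map_diag_mx /= mulmx_diag -diag_const_mx.
  congr diag_mx; apply/rowP => j; rewrite !mxE -normCK.
  by rewrite normrM normrV ?unitfE// !u1 invr1 mulr1 expr1n.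
exists (g *m diag_mx d); split.
- exact: (mul_unitarymx gu du).
- exact: flag_of_mul.
- move=> lam; apply: same_orbit_point; [exact: (unitarymx_unit gu)|exact: (unitarymx_unit du)|].
  by apply: diag_mx_comm_i_diag; exact: diag_mx_is_diag.
- move=> s sn; rewrite mnr_upper//; last by case: bd.
  rewrite mulrC; congr (_ * _).
  rewrite (eq_bigr (fun j : 'I_(size s) => u j.+1 / u j)).
    elim: (size s) => [|k IH]; first by rewrite big_ord0 u0.
    by rewrite big_ord_recr /= IH mulrCA divff// mulr1.
  move=> j _; have jn : (j < n)%N by exact: leq_trans sn.
  by rewrite (entE _ jn jn) !mxE eqxx mulr1n.
Qed.

Lemma phase_norm (z : C) : z != 0 -> `|z^* / `|z| | = 1.
Proof. by move=> z0; rewrite normrM normrV ?unitfE ?normr_eq0// norm_conjC normr_id divff// normr_eq0. Qed.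

Lemma phase_mul (z : C) : z != 0 -> 0 < z^* / `|z| * z.
Proof.
move=> z0; rewrite mulrAC [_^* * _]mulrC -normCK expr2 mulfK ?normr_eq0//.
by rewrite normr_gt0.
Qed.

(** The canonical normalization for [w0]; the vanishing condition is void there, since the last k
    rows form the lexicographically greatest k-subset. *)
Definition last_pos n (g : 'M[C]_n) := forall k, (k <= n)%N -> 0 < mnr (ent g) (iota (n - k) k).

(** [twist] may have picked any w. If the prefix of w were not the set of last k rows, the
    lexicographic condition would annihilate the minor in those rows, which is nonzero for the flag
    of g. *)
Lemma canonical_repr_last n (V : set 'M[C]_n) (g h : 'M[C]_n) w : V = flag_of g ->
  (forall k, (k <= n)%N -> mnr (ent g) (iota (n - k) k) != 0) ->
  canonical_repr w V h -> last_pos h.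
Proof.
move=> -> gm [hu [b [bu bt] hE] can] k kn.
have [->|k0] := posnP k; first by rewrite subn0 mnr_nil ltr01.
have [|D0 Dlex] := can k; first by rewrite k0.
have cP := card_perm_prefix w kn.
have JE := sseq_w0 kn.
have cJ := card_perm_prefix (w0 n) kn.
have [E|ne] := eqVneq (perm_prefix w k) (perm_prefix (w0 n) k).
  by rewrite -JE -DeltaE -E.
have lt : lex_lt (perm_prefix w k) (perm_prefix (w0 n) k).
  by apply: lex_lt_last => //; rewrite cP.
have := Dlex _ cJ lt; rewrite DeltaE JE -hE mnr_upper ?size_iota// => /eqP.
rewrite mulf_eq0 (negbTE (gm k kn)) /= => /prodf_eq0[j _].
rewrite -[j : nat]/(val (widen_ord kn j)) ent_ord.
by rewrite (negbTE (upper_diag_neq0 _ bu bt)).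
Qed.

Lemma big_cell_canonical n (g : 'M[C]_n) : g \is unitarymx ->
  (forall k, (k <= n)%N -> mnr (ent g) (iota (n - k) k) != 0) ->
  exists h, canonical_repr (w0 n) (flag_of g) h.
Proof.
move=> gu gm; pose m k := if (k <= n)%N then mnr (ent g) (iota (n - k) k) else 1.
have m0 k : m k != 0 by rewrite /m; case: ifP => [/gm|_]//; rewrite oner_neq0.
have [||h [hu hV _ hm]] := @phase_adjust n g (fun k => (m k)^* / `|m k|) gu.
- by move=> k; exact: phase_norm.
- by rewrite /m leq0n subn0 mnr_nil rmorph1 normr1 divr1.
exists h; split=> // [|k /andP[k0 kn]]; first by rewrite -hV; exact: flag_of_refl.
split; first rewrite DeltaE sseq_w0// hm ?size_iota//.
  by have := phase_mul (m0 k); rewrite {3}/m kn.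
move=> I Ik lt; exfalso; have [E|ne] := eqVneq I (perm_prefix (w0 n) k).
  by move: lt; rewrite E /lex_lt ltxx.
have := @lex_lt_last n I (perm_prefix (w0 n) k); rewrite Ik sseq_w0// => /(_ erefl ne).
by move: lt; rewrite /lex_lt => h1 h2; have := lt_trans h1 h2; rewrite ltxx.
Qed.

Lemma twist_big_cell n (g : 'M[C]_n) : g \is unitarymx ->
  (forall k, (k <= n)%N -> mnr (ent g) (iota (n - k) k) != 0) ->
  exists h, [/\ h \is unitarymx, flag_of h = flag_of g, last_pos h &
    twist (flag_of g) = flag_of (iota_inv h)].
Proof.
move=> gu gm; have [h0 h0P] := big_cell_canonical gu gm.
have cell := big_cell (unitarymx_unit gu) gm.
rewrite /twist; case: xgetP => [W _ [w [h [cw hP WE]]]|/(_ (flag_of (iota_inv h0)))[]]; last first.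
  by exists (w0 n), h0.
exists h; split; [by case: hP| |exact: canonical_repr_last hP|by []].
by case: hP => _ /flag_of_mem.
Qed.

Lemma unitary_flag_orbit n (lam : 'rV[R]_n) (g h : 'M[C]_n) : g \is unitarymx -> h \is unitarymx ->
  flag_of h = flag_of g -> h *m i_diag lam *m invmx h = g *m i_diag lam *m invmx g.
Proof.
move=> gu hu E; have [b bb hE] := flag_of_eq (esym E); rewrite hE.
apply: same_orbit_point; [exact: (unitarymx_unit gu)|by case: bb|].
by apply: diag_mx_comm_i_diag; rewrite hE in hu; exact: (unitary_borel_diag gu hu bb).
Qed.

Lemma plucker_neq0 n (h : 'M[C]_n) : (forall I, plucker (flag_of h) I != 0) ->
  forall s, sorted ltn s -> all (fun i => i < n)%N s -> mnr (ent h) s != 0.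
Proof.
move=> pl s ss sn; have [I <-] := sseq_onto ss sn; have [c [_ cP]] := plucker_scale h.
by have := pl I; rewrite cP mulf_eq0 negb_or => /andP[].
Qed.

Lemma orbit_nz_repr n (lam : 'rV[R]_n) L : (0 < n)%N -> strictly_decreasing lam ->
  orbit_nz lam L -> exists g, [/\ g \is unitarymx, L = g *m i_diag lam *m invmx g, last_pos g,
    twist (flag_of_orbit lam L) = flag_of (iota_inv g) &
    forall s, sorted ltn s -> all (fun i => i < n)%N s -> mnr (ent (iota_inv g)) s != 0].
Proof.
move=> n0 ld [[g0 g0u LE]]; rewrite {1}LE flag_of_orbitE// => pl.
suff [h [hu hV hl tw]] : exists h, [/\ h \is unitarymx, flag_of h = flag_of g0, last_pos h &
    twist (flag_of g0) = flag_of (iota_inv h)].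
  exists h; split; [exact: hu| |exact: hl| |].
  - by rewrite LE; symmetry; exact: (unitary_flag_orbit lam g0u hu hV).
  - by rewrite LE (flag_of_orbitE ld g0u).
  - by apply: plucker_neq0; rewrite -tw.
(* For n = 1 the default value of [twist] has nonzero coordinates as well, so it cannot be excluded
   as below; but here g0 lies in the open cell trivially. *)
have [n1|n1] := leqP n 1.
  apply: twist_big_cell => // k kn; have n_1 : n = 1%N by apply/eqP; rewrite eqn_leq n1.
  have [->|k0] := posnP k; first by rewrite mnr_nil oner_neq0.
  have -> : k = n by lia.
  rewrite subnn (@mnrE _ n) ?size_iota//.
  rewrite (_ : \matrix_(i, j) _ = g0); first by rewrite -unitfE -unitmxE unitarymx_unit.
  by apply/matrixP => i j; rewrite mxE nth_iota// add0n ent_ord.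
move: pl; rewrite {1}/twist; case: xgetP => [W _ [w [h [cw hP WE]]] pl|_ pl]; last first.
  (* On the default value [set0], [plucker] is computed from the identity matrix, whose minor in row
     1 and column 0 vanishes. *)
  exfalso; have n1' : (1 < n)%N by [].
  have := pl [set Ordinal n1']%SET; rewrite /plucker; case: xgetP => [?//|_].
  rewrite DeltaE /sseq enum_set1 /= (@mnrE _ 1)// det_mx11 mxE /=.
  by rewrite (entE _ n1' n0) mxE /= eqxx.
have [hu Vh can] := hP; have hV := flag_of_mem Vh.
have nz := plucker_neq0 (fun I => etrans (congr1 (fun V => plucker V I != 0) (esym WE)) (pl I)).
(* A zero minor of h in its last k rows would force a zero minor of [iota_inv h] in its last n - k
   rows. *)
have hm k : (k <= n)%N -> mnr (ent h) (iota (n - k) k) != 0.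
  move=> kn; have akn : (k + (n - k) = n)%N by rewrite subnKC.
  apply/eqP => h0; have := twist_last_eq0 hu akn h0; apply/eqP; apply: nz.
    exact: iota_ltn_sorted.
  by apply/allP => x; rewrite mem_iota; lia.
have hg k : (k <= n)%N -> mnr (ent g0) (iota (n - k) k) != 0.
  move=> kn; have [b [_ bt] hE] := flag_of_eq (esym hV).
  have := hm k kn; rewrite hE mnr_upper ?size_iota//.
  by rewrite mulf_eq0 negb_or => /andP[].
exact: (twist_big_cell g0u hg).
Qed.

Lemma orbit_pos_repr n (lam : 'rV[R]_n) L : (0 < n)%N -> strictly_decreasing lam ->
  orbit_pos lam L -> exists g, [/\ g \is unitarymx, L = g *m i_diag lam *m invmx g, last_pos g,
    twist (flag_of_orbit lam L) = flag_of (iota_inv g) &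
    forall s, sorted ltn s -> all (fun i => i < n)%N s -> 0 < mnr (ent (iota_inv g)) s].
Proof.
move=> n0 ld [[g0 g0u LE] [_]]; rewrite {1}LE flag_of_orbitE// => fp.
have [c [c0 cP]] := plucker_scale g0.
have uex k : exists u : C, [/\ `|u| = 1, (k = 0%N -> u = 1) &
    forall s, sorted ltn s -> all (fun i => i < n)%N s -> size s = k -> 0 < u * mnr (ent g0) s].
  have [->|k0] := posnP k.
    exists 1; split=> //; first exact: normr1.
    by move=> s _ _ /size0nil ->; rewrite mnr_nil mulr1 ltr01.
  have [kn|kn] := leqP k n; last first.
    exists 1; split=> //; [exact: normr1|move=> s ss sn sk; exfalso].
    have [I IE] := sseq_onto ss sn; have := card_set_ord I.
    by rewrite -size_sseq IE sk leqNgt kn.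
  have [|e e0 eP] := fp k; first by rewrite k0.
  pose z := e * c k; have z0 : z != 0 by rewrite mulf_neq0 ?c0.
  (* Only the phase of the rescaling factor is absorbed into the representative; a modulus would
     destroy unitarity. *)
  exists (z / `|z|); split.
  - by rewrite normrM normrV ?unitfE ?normr_eq0// normr_id divff// normr_eq0.
  - by move=> E; rewrite E in k0.
  - move=> s ss sn sk; have [I IE] := sseq_onto ss sn.
    have Ik : #|I| = k by rewrite -size_sseq IE.
    have := eP I Ik; rewrite cP Ik IE mulrA -/z => pos.
    by rewrite mulrAC divr_gt0// normr_gt0.
pose u k := sval (cid (uex k)); have uP k : _ := svalP (cid (uex k)).
have [||g1 [g1u g1V _ g1m]] := @phase_adjust n g0 u g0u.
- by move=> k; case: (uP k).
- by case: (uP 0%N) => _ /(_ erefl).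
have size_le s : sorted ltn s -> all (fun i => i < n)%N s -> (size s <= n)%N.
  by move=> ss sn; have [I <-] := sseq_onto ss sn; rewrite size_sseq card_set_ord.
have g1pos s : sorted ltn s -> all (fun i => i < n)%N s -> 0 < mnr (ent g1) s.
  move=> ss sn; rewrite g1m; last exact: size_le.
  by case: (uP (size s)) => _ _; exact.
have iota_in k : (k <= n)%N -> all (fun i => i < n)%N (iota (n - k) k).
  by move=> kn; apply/allP => x; rewrite mem_iota; lia.
have [|h [hu hV hl tw]] := twist_big_cell g1u.
  by move=> k kn; rewrite gt_eqF// g1pos ?iota_ltn_sorted ?iota_in.
have hg0 : flag_of h = flag_of g0 by rewrite hV.
exists h; split; [exact: hu| |exact: hl| |].
- by rewrite LE; symmetry; exact: (unitary_flag_orbit lam g0u hu hg0).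
- by rewrite LE (flag_of_orbitE ld g0u) -g1V.
apply: (twist_minors_gt0 hu) => s ss sn.
have [b [_ bt] hE] := flag_of_eq (esym hV).
have sz := size_le s ss sn.
(* h and g1 differ by a triangular matrix; as both have positive minors in the last rows, the factor
   between their minors of each size is positive. *)
have := hl _ sz; rewrite hE !mnr_upper ?size_iota// pmulr_rgt0; last first.
  by rewrite g1pos ?iota_ltn_sorted ?iota_in.
by move=> b0; rewrite mulr_gt0// g1pos.
Qed.

End BigCell.

(** * The Moser map *)

Section RankOne.
Variable K : comNzRingType.

Lemma det_cast_ord m m' (e : m' = m) (B : 'M[K]_m) :
  \det (\matrix_(i < m', j < m') B (cast_ord e i) (cast_ord e j)) = \det B.
Proof.
by case: m / e B => B; congr (\det _); apply/matrixP => i j; rewrite mxE !cast_ord_id.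
Qed.

Lemma Cauchy_Binet a n (X : 'M[K]_(a, n)) (A : 'M[K]_(n, a)) :
  \det (X *m A) *+ a`! =
  \sum_(f : {ffun 'I_a -> 'I_n}) \det (colsub f X) * \det (rowsub f A).
Proof.
pose A' : 'M[K]_(n, a + 0) := \matrix_(i, j) A i (cast_ord (addn0 a) j).
have E (B : 'M[K]_a) (B' : 'M[K]_(a, a + 0)) (Y : 'M[K]_(0, a + 0)) :
    (forall i j, B' i j = B i (cast_ord (addn0 a) j)) -> \det (col_mx B' Y) = \det B.
  move=> BB; rewrite -(det_cast_ord (addn0 a)); congr (\det _).
  apply/matrixP => i j; rewrite [RHS]mxE; case: (split_ordP i) => [i' ->|[]//].
  by rewrite col_mxEu BB; congr (B _ _); apply: val_inj.
have := partial_Cauchy_Binet X A' (0 : 'M[K]_(0, a + 0)).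
rewrite (E (X *m A)); last first.
  by move=> i j; rewrite !mxE; apply: eq_bigr => l _; rewrite mxE.
move=> ->; apply: eq_bigr => f _; rewrite (E (rowsub f A))//.
by move=> i j; rewrite !mxE.
Qed.

(** Two block factorizations of the same bordered matrix, eliminating either off-diagonal block. *)
Lemma det_one_sub_rank1 m (u : 'cV[K]_m) (v : 'rV[K]_m) :
  \det (1%:M - u *m v) = 1 - (v *m u) 0 0.
Proof.
have E1 : block_mx 1%:M u v 1%:M =
    block_mx 1%:M 0 v 1%:M *m block_mx 1%:M u 0 (1%:M - v *m u) :> 'M[K]_(m + 1).
  by rewrite mulmx_block !mul1mx !mul0mx !mulmx1 ?mulmx0 !addr0 addrC subrK.
have E2 : block_mx 1%:M u v 1%:M =
    block_mx 1%:M u 0 1%:M *m block_mx (1%:M - u *m v) 0 v 1%:M :> 'M[K]_(m + 1).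
  by rewrite mulmx_block !mul1mx !mul0mx !mulmx1 !add0r subrK.
have := congr1 determinant E1.
rewrite E2 !det_mulmx det_lblock !det_ublock det_lblock !det1 !mul1r mulr1 => ->.
by rewrite det_mx11 !mxE.
Qed.

End RankOne.

Section ProjectionDiagonal.
Variable C : numClosedFieldType.
Local Notation "z ^*" := (Num.conj z).

Lemma cnt_inj (R : pzSemiRingType) k n (f : 'I_k -> 'I_n) i : injective f ->
  \sum_a (f a == i)%:R + ([forall a, f a != i])%:R = 1 :> R.
Proof.
move=> fi; have [/forallP h|] := boolP [forall a, f a != i].
  by rewrite big1 ?add0r// => a _; rewrite (negbTE (h a)).
rewrite negb_forall => /existsP[a]; rewrite negbK => /eqP fa; rewrite addr0.
rewrite (bigD1 a)//= fa eqxx big1 ?addr0// => b ba.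
by rewrite -fa (inj_eq fi) (negbTE ba).
Qed.

(* The diagonal of the orthogonal projection to the span of the first [m] columns, in terms
   of minors: deleting the row [i] from the Gram matrix subtracts a rank one matrix. *)
Lemma projection_diag n (g : 'M[C]_n) m (i : 'I_n) : g \is unitarymx -> (m <= n)%N ->
  (\sum_(j < m) `|ent g i j| ^+ 2) *+ m`! =
  \sum_(f : {ffun 'I_m -> 'I_n}) (\sum_a (f a == i)%:R) * `|mnr (ent g) (fseq f)| ^+ 2.
Proof.
move=> gu mn.
pose X : 'M[C]_(m, n) := \matrix_(a, l) if l == i then 0 else (g l (widen_ord mn a))^*.
pose A : 'M[C]_(n, m) := \matrix_(l, a) g l (widen_ord mn a).
pose v : 'rV[C]_m := \row_a g i (widen_ord mn a).
pose u : 'cV[C]_m := \col_a (g i (widen_ord mn a))^*.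
have XA : X *m A = 1%:M - u *m v.
  apply/matrixP => a b; rewrite !mxE big_ord1 !mxE.
  have := unitary_cols (widen_ord mn a) (widen_ord mn b) gu.
  rewrite [widen_ord mn a == _]/(a == b) => <-.
  rewrite (bigD1 i)//= [in RHS](bigD1 i)//= !mxE eqxx mul0r add0r addrC addKr.
  by apply: eq_bigr => l li; rewrite !mxE (negbTE li).
have := Cauchy_Binet X A; rewrite XA det_one_sub_rank1 mulrnBl.
have -> : (v *m u) 0 0 = \sum_(j < m) `|ent g i j| ^+ 2.
  rewrite mxE; apply: eq_bigr => j _; rewrite !mxE -normCK; congr (`|_| ^+ 2).
  by rewrite -(ent_ord g).
have mE (f : {ffun 'I_m -> 'I_n}) : \det (rowsub f A) = mnr (ent g) (fseq f).
  rewrite (@mnrE _ m) ?size_fseq//; congr (\det _); apply/matrixP => a b; rewrite !mxE nth_fseq.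
  by rewrite -(ent_ord g).
have XE (f : {ffun 'I_m -> 'I_n}) : \det (colsub f X) * \det (rowsub f A) =
    ([forall a, f a != i])%:R * `|mnr (ent g) (fseq f)| ^+ 2.
  rewrite mE; have [/forallP h|] := boolP [forall a, f a != i].
    rewrite mul1r normCK mulrC; congr (_ * _); rewrite -mE -det_map_mx -det_tr.
    by congr (\det _); apply/matrixP => a b; rewrite !mxE (negbTE (h _)).
  rewrite negb_forall => /existsP[a]; rewrite negbK => /eqP fa.
  rewrite mul0r -det_tr (expand_det_row _ a) big1 ?mul0r// => b _.
  by rewrite !mxE fa eqxx mul0r.
rewrite (eq_bigr _ (fun f _ => XE f)) -(unitary_minors_norm gu mn) => H.
rewrite -[LHS](subKr (\sum_(f : {ffun 'I_m -> 'I_n}) `|mnr (ent g) (fseq f)| ^+ 2)) H -sumrB.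
apply: eq_bigr => f _; have [fi|nfi] := pselect (injective f).
  have -> : \sum_a (f a == i)%:R = 1 - ([forall a, f a != i])%:R :> C.
    by apply/esym/eqP; rewrite subr_eq; apply/eqP/esym; exact: cnt_inj.
  by rewrite mulrBl mul1r.
rewrite (_ : mnr _ _ = 0) ?normr0 ?expr0n ?mulr0 ?subr0//.
apply: mnr_dup; apply/negP => u_f; apply: nfi; apply/injectiveP.
by apply: (@map_uniq _ _ val); rewrite -map_comp.
Qed.

End ProjectionDiagonal.

Section MoserMap.
Variable R : realType.
Local Notation C := R[i].
Local Notation "z ^*" := (Num.conj z).

Lemma vand_unit N (nu y : 'rV[R]_N) : strictly_decreasing nu -> pos_orthant y ->
  (\matrix_(i < N, j < N) (((nu 0 i) ^+ j)%:C%C * (y 0 i)%:C%C) : 'M[C]_N) \in unitmx.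
Proof.
move=> nd y0; rewrite unitmxE unitfE.
have -> : \matrix_(i < N, j < N) (((nu 0 i) ^+ j)%:C%C * (y 0 i)%:C%C) =
    map_mx (real_complex R) (\matrix_(i < N, j < N) (y 0 i * 1 * nu 0 i ^+ j)) :> 'M[C]_N.
  by apply/matrixP => i j; rewrite !mxE mulr1 mulrC rmorphM.
rewrite det_map_mx fmorph_eq0.
have -> : \det (\matrix_(i < N, j < N) (y 0 i * 1 * nu 0 i ^+ j)) =
    \prod_i y 0 i * \prod_(i < N) 1 * \det (\matrix_(i < N, j < N) nu 0 i ^+ j).
  rewrite -[RHS](det_scale (fun i => y 0 i) (fun=> 1)); congr (\det _).
  by apply/matrixP => i j; rewrite !mxE.
rewrite !mulf_neq0//.
- by apply/prodf_neq0 => i _; rewrite gt_eqF.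
- by rewrite big1 ?oner_neq0.
- have := @vdm_neq0 R N nu nd N [ffun i => i]; rewrite /vdm.
  rewrite (_ : \matrix_(a, b) _ = \matrix_(i, j) nu 0 i ^+ j); last first.
    by apply/matrixP => a b; rewrite !mxE ffunE.
  by apply => i j; rewrite !ffunE.
Qed.

Lemma mnr_vand N (nu y : 'rV[R]_N) k (f : {ffun 'I_k -> 'I_N}) : (k <= N)%N ->
  mnr (ent (\matrix_(i < N, j < N) (((nu 0 i) ^+ j)%:C%C * (y 0 i)%:C%C) : 'M[C]_N)) (fseq f) =
  (vdm nu f * \prod_a y 0 (f a))%:C%C.
Proof.
move=> kN; rewrite (@mnrE _ k) ?size_fseq//.
have := det_scale (fun a => y 0 (f a)) (fun=> 1) (\matrix_(a < k, b < k) nu 0 (f a) ^+ b).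
rewrite [\prod_(i < k) 1]big1// mulr1 mulrC => <-; rewrite -det_map_mx; congr (\det _).
apply/matrixP => a b; rewrite !mxE nth_fseq -[b : nat]/(val (widen_ord kN b)) (ent_ord _ (f a)).
by rewrite !mxE mulr1 mulrC rmorphM.
Qed.

Lemma moser_unitary N (nu y : 'rV[R]_N) : strictly_decreasing nu -> pos_orthant y ->
  exists g, [/\ g \is unitarymx, moser nu (map_mx (real_complex R) y) = g *m i_diag nu *m invmx g &
   exists2 b, borel b & g = \matrix_(i < N, j < N) (((nu 0 i) ^+ j)%:C%C * (y 0 i)%:C%C) *m b].
Proof.
move=> nd y0; set G := \matrix_(i, j) _.
have Gu : G \in unitmx by exact: vand_unit.
have VG : vand nu (map_mx (real_complex R) y) = flag_of G.
  by congr flag_of; apply/matrixP => i j; rewrite !mxE.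
rewrite /moser /orbit_of_flag VG; case: xgetP => [L _ [g [gu LE gG]]|].
  by exists g; split=> //; exact: flag_of_eq.
have [u [b [uu bu bt GE]]] := QR Gu.
move=> /(_ (u *m i_diag nu *m invmx u))[]; exists u; split=> //.
by rewrite GE flag_of_mul.
Qed.

Definition csq (z : C) : R := complex.Re z ^+ 2 + complex.Im z ^+ 2.

Lemma csqE z : (csq z)%:C%C = `|z| ^+ 2.
Proof. exact: add_Re2_Im2. Qed.

Lemma csq_ge0 z : 0 <= csq z.
Proof. by rewrite addr_ge0// sqr_ge0. Qed.

Lemma moment_unitary N (nu : 'rV[R]_N) (g : 'M[C]_N) i : g \is unitarymx ->
  moment (g *m i_diag nu *m invmx g) 0 i = \sum_j csq (g i j) * nu 0 j.
Proof.
move=> gu; rewrite mxE (invmx_unitary gu) i_diagE mul_mx_diag mxE.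
set S := (X in X / _).
have -> : S = (\sum_j csq (g i j) * nu 0 j)%:C%C * Complex 0 1.
  rewrite rmorph_sum mulr_suml; apply: eq_bigr => j _; rewrite !mxE rmorphM /= csqE normCK.
  by ring.
by rewrite mulfK// i_neq0.
Qed.

Lemma nu_telescope N (nu : 'rV[R]_N) (j : 'I_N) : nu 0 j = \sum_(k < N | (j <= k)%N) gap nu k.
Proof.
rewrite -nunE -(big_mkord (fun k => j <= k)%N (gap nu)) (@big_cat_nat _ _ _ j)//=; last exact: ltnW.
rewrite big_nat_cond big1 ?add0r; last by move=> k /andP[/andP[_ kj]]; rewrite leqNgt kj.
rewrite big_nat_cond (eq_bigl (fun k => (j <= k < N)%N && true)); last first.
  by move=> k; case: (j <= k)%N; rewrite ?andbT ?andbF.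
rewrite -big_nat_cond /gap.
rewrite (eq_bigr (fun k => - nun nu k.+1 - (- nun nu k))); last first.
  by move=> k _; rewrite opprK addrC.
rewrite telescope_sumr; last exact: ltnW.
have -> : nun nu N = 0 by rewrite /nun insubN// ltnn.
by rewrite oppr0 sub0r opprK.
Qed.

(** The minors of g and of the Vandermonde matrix with rows scaled by y differ by a factor depending
    only on k, which cancels in the quotient along with k!. *)
Lemma projection_weights N (nu y : 'rV[R]_N) (g b : 'M[C]_N) k i : strictly_decreasing nu ->
  pos_orthant y -> g \is unitarymx -> borel b ->
  g = \matrix_(i < N, j < N) (((nu 0 i) ^+ j)%:C%C * (y 0 i)%:C%C) *m b -> (k <= N)%N ->
  \sum_(j < N | (j < k)%N) csq (g i j) =
  wsum nu y (@cnt R N k i) / wsum nu y (fun _ : {ffun 'I_k -> 'I_N} => 1).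
Proof.
move=> nd y0 gu [bu bt] gE kN.
pose c : C := \prod_(j < k) ent b j j.
have mE (f : {ffun 'I_k -> 'I_N}) : `|mnr (ent g) (fseq f)| ^+ 2 = (wt nu f y * csq c)%:C%C.
  rewrite gE mnr_upper ?size_fseq// mnr_vand// normrM exprMn [RHS]rmorphM /= csqE; congr (_ * _).
  by rewrite -csqE /csq /= expr0n addr0.
have H1 := unitary_minors_norm gu kN.
rewrite (eq_bigr _ (fun f _ => mE f)) -rmorph_sum -mulr_suml in H1.
have H2 := projection_diag i gu kN.
have {}H2 : ((\sum_(j < N | (j < k)%N) csq (g i j)) *+ k`!)%:C%C =
    (wsum nu y (@cnt R N k i) * csq c)%:C%C.
  rewrite [LHS]rmorphMn /= (_ : (\sum_(_ < N | _) _)%:C%C = \sum_(j < k) `|ent g i j| ^+ 2); last first.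
    rewrite rmorph_sum (big_ord_widen_cond N xpredT (fun j => `|ent g i j| ^+ 2) kN) /=.
    by apply: eq_bigr => j _; rewrite csqE -(ent_ord g).
  rewrite H2 rmorphM rmorph_sum mulr_suml; apply: eq_bigr => f _.
  rewrite mE !rmorphM /= /cnt rmorph_sum -[RHS]mulrA mulrCA; congr (_ * _).
  by congr (_ * _); rewrite rmorph_sum; apply: eq_bigr => a _; rewrite rmorph_nat.
have {}H1 : wsum nu y (fun _ : {ffun 'I_k -> 'I_N} => 1) * csq c = (k`!)%:R.
  apply: (@complexI R); rewrite [RHS]rmorph_nat -H1; congr (_%:C%C); congr (_ * _).
  by apply: eq_bigr => f _; rewrite mulr1.
have {}H2 := complexI H2.
have f0 : (k`!)%:R != 0 :> R by rewrite pnatr_eq0 -lt0n fact_gt0.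
have Z0 : wsum nu y (fun _ : {ffun 'I_k -> 'I_N} => 1) != 0 by rewrite gt_eqF// wsum1_gt0.
apply: (mulIf f0); rewrite -mulr_natr in H2; rewrite H2 -H1.
by field.
Qed.

Lemma moment_moser N (nu y : 'rV[R]_N) : strictly_decreasing nu -> pos_orthant y ->
  moment (moser nu (map_mx (real_complex R) y)) = mmu nu y.
Proof.
move=> nd y0; have [g [gu -> [b bb gE]]] := moser_unitary nd y0.
apply/rowP => i; rewrite moment_unitary// mxE.
under eq_bigr do rewrite (nu_telescope nu) mulr_sumr.
rewrite (exchange_big_dep xpredT)//=; apply: eq_bigr => k _.
rewrite -(projection_weights i nd y0 gu bb gE (ltn_ord k)) mulr_sumr.
by apply: eq_big => [j|j _]; [rewrite ltnS|rewrite mulrC].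
Qed.

Lemma mmu_permutohedron N (nu y : 'rV[R]_N) : strictly_decreasing nu -> pos_orthant y ->
  permutohedron nu (mmu nu y).
Proof.
move=> nd y0; rewrite -moment_moser//; have [g [gu -> _]] := moser_unitary nd y0.
have -> : moment (g *m i_diag nu *m invmx g) = \row_i \sum_j csq (g i j) * nu 0 j.
  by apply/rowP => i; rewrite moment_unitary// mxE.
have col1 (h : 'M[C]_N) : h \is unitarymx -> forall j, \sum_i csq (h i j) = 1.
  move=> hu j; apply: (@complexI R); rewrite rmorph_sum rmorph1.
  have := unitary_cols j j hu; rewrite eqxx /= mulr1n => <-; apply: eq_bigr => i _.
  by rewrite csqE normCK mulrC.
apply: doubly_stochastic_permutohedron.
- by move=> i j; exact: csq_ge0.
- move=> i; have := col1 g^T; rewrite trmx_unitary => /(_ gu i) <-.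
  by apply: eq_bigr => j _; rewrite mxE.
- exact: col1.
- move=> i j; rewrite leq_eqVlt => /orP[/eqP/val_inj ->//|/nd/ltW//].
Qed.

Lemma moser_ext_moment N (nu : 'rV[R]_N) (x : 'rV[C]_N) : strictly_decreasing nu ->
  (forall i, x 0 i != 0) ->
  conform_mx 0 (moment (moser_ext nu x)) = mmu nu (\row_i complex.Re `|x 0 i|).
Proof.
move=> nd x0; rewrite /moser_ext.
set I := nonzero_coords x.
have IT i : i \in I by rewrite inE.
have cI : #|I| = N by rewrite (_ : I = [set: 'I_N]%SET) ?cardsT ?card_ord//; apply/setP => i; rewrite IT inE.
have ev (a : 'I_#|I|) : enum_val a = cast_ord cI a.
  apply: val_inj => /=.
  have : nth 0%N (sseq I) a = a.
    rewrite (@sorted_last_interval N 0 N (sseq I)) ?add0n ?size_sseq//; last first.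
    - by apply: sub_all (sseq_lt I) => z ->.
    - exact: sseq_sorted.
    - by rewrite nth_iota//; exact: ltn_ord (cast_ord cI a).
  by rewrite (nth_map (enum_val a)) -?cardE// -enum_val_nth.
(* The cast disappears once the size is a variable, so that the equality of sizes can be
   substituted. *)
have gen m (e : m = N) (nu' : 'rV[R]_m) (x' : 'rV[C]_m) :
    (forall a, nu' 0 a = nu 0 (cast_ord e a)) ->
    (forall a, x' 0 a = `|x 0 (cast_ord e a)|) ->
    conform_mx 0 (moment (moser nu' x')) = mmu nu (\row_i complex.Re `|x 0 i|).
  subst m => nuE xE; rewrite conform_mx_id.
  have -> : nu' = nu by apply/rowP => a; rewrite nuE cast_ord_id.
  have -> : x' = map_mx (real_complex R) (\row_i complex.Re `|x 0 i|).
    apply/rowP => a; rewrite xE !mxE cast_ord_id.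
    by rewrite RRe_real// normr_real.
  apply: moment_moser => // i; rewrite mxE.
  have : 0 < `|x 0 i| by rewrite normr_gt0.
  by rewrite ltcE => /andP[].
by apply: (gen _ cI) => a; rewrite mxE ev.
Qed.

End MoserMap.

(** * Smooth dependence of the minors on the orbit point *)

Section ComplexSmooth.
Variables (R : realType) (U : normedModType R) (A : set U).
Hypothesis oA : open A.
Local Notation C := R[i].
Local Notation "z ^*" := (Num.conj z).
Implicit Types f g : U -> C.

Definition isCkC k f :=
  isCk k A (fun x => complex.Re (f x) : R) /\ isCk k A (fun x => complex.Im (f x) : R).

Lemma eq_isCkC k f g : (forall x, A x -> f x = g x) -> isCkC k f -> isCkC k g.
Proof.
move=> fg [h1 h2]; split; [apply: (eq_isCk oA _ h1)|apply: (eq_isCk oA _ h2)] => x Ax.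
  by rewrite fg.
by rewrite fg.
Qed.

Lemma isCkC_cst k (c : C) : isCkC k (fun=> c).
Proof. by split; exact: isCk_cst. Qed.

Lemma isCkC_real k (f : U -> R) : isCk k A f -> isCkC k (fun x => (f x)%:C%C).
Proof. by move=> Cf; split=> //; exact: (isCk_cst k A (0 : R)). Qed.

Lemma isCkCD k f g : isCkC k f -> isCkC k g -> isCkC k (fun x => f x + g x).
Proof.
move=> [f1 f2] [g1 g2]; split; [apply: (eq_isCk oA _ (isCkD oA f1 g1))|apply: (eq_isCk oA _ (isCkD oA f2 g2))];
  by move=> x _; case: (f x) => a b; case: (g x).
Qed.

Lemma isCkCM k f g : isCkC k f -> isCkC k g -> isCkC k (fun x => f x * g x).
Proof.
move=> [f1 f2] [g1 g2]; split.
  apply: (eq_isCk oA _ (isCkD oA (isCkM oA f1 g1) (isCkN oA (isCkM oA f2 g2)))).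
  by move=> x _; case: (f x) => a b; case: (g x).
apply: (eq_isCk oA _ (isCkD oA (isCkM oA f1 g2) (isCkM oA f2 g1))).
by move=> x _; case: (f x) => a b; case: (g x).
Qed.

Lemma isCkC_conj k f : isCkC k f -> isCkC k (fun x => (f x)^*).
Proof.
move=> [f1 f2]; split; first by apply: (eq_isCk oA _ f1) => x _; case: (f x).
by apply: (eq_isCk oA _ (isCkN oA f2)) => x _; case: (f x).
Qed.

Lemma isCkC_sum k (I : Type) (r : seq I) (P : pred I) (f : I -> U -> C) :
  (forall i, P i -> isCkC k (f i)) -> isCkC k (fun x => \sum_(i <- r | P i) f i x).
Proof.
move=> Hf; elim: r => [|i r IH].
  by apply: (eq_isCkC _ (isCkC_cst k 0)) => x _; rewrite big_nil.
case: (boolP (P i)) => Pi.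
  by apply: (eq_isCkC _ (isCkCD (Hf i Pi) IH)) => x _; rewrite big_cons Pi.
by apply: (eq_isCkC _ IH) => x _; rewrite big_cons (negbTE Pi).
Qed.

Lemma isCkC_prod k (I : Type) (r : seq I) (f : I -> U -> C) :
  (forall i, isCkC k (f i)) -> isCkC k (fun x => \prod_(i <- r) f i x).
Proof.
move=> Hf; elim: r => [|i r IH].
  by apply: (eq_isCkC _ (isCkC_cst k 1)) => x _; rewrite big_nil.
by apply: (eq_isCkC _ (isCkCM (Hf i) IH)) => x _; rewrite big_cons.
Qed.

Lemma isCkC_det k n (f : U -> 'M[C]_n) :
  (forall i j, isCkC k (fun x => f x i j)) -> isCkC k (fun x => \det (f x)).
Proof.
move=> Cf; apply: isCkC_sum => s _; apply: isCkCM; first exact: isCkC_cst.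
exact: isCkC_prod.
Qed.

End ComplexSmooth.

(** * Squared moduli of the twisted minors as polynomials in L *)

Section SpectralProjection.
Variables (R : realType) (n : nat) (lam : 'rV[R]_n).
Hypothesis lam_decr : strictly_decreasing lam.
Local Notation C := R[i].
Local Notation "z ^*" := (Num.conj z).

Definition ilam (j : 'I_n) : C := Complex 0 1 * (lam 0 j)%:C%C.

(* The Lagrange interpolation polynomial of the eigenvalue [l], evaluated at [L]. *)
Definition spectral_proj (l : 'I_n) (L : 'M[C]_n) : 'M[C]_n :=
  \big[mulmx/1%:M]_(m <- index_enum 'I_n | m != l)
    ((ilam l - ilam m)^-1 *: (L - (ilam m)%:M)).

Lemma ilam_inj : injective ilam.
Proof.
move=> i j /(mulfI (i_neq0 R))/complexI E; apply/val_inj/eqP.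
by case: (ssrnat.ltngtP i j) => // h; have := lam_decr h; rewrite E ltxx.
Qed.

Lemma spectral_projE (g : 'M[C]_n) l a b : g \is unitarymx ->
  spectral_proj l (g *m i_diag lam *m invmx g) a b = g a l * (g b l)^*.
Proof.
move=> gu; have gU := unitarymx_unit gu; set L := _ *m invmx g.
(* Each factor rescales the columns of g, so the product can be computed factor by factor along any
   sequence of eigenvalue indices. *)
have H (r : seq 'I_n) :
    (\big[mulmx/1%:M]_(m <- r | m != l) ((ilam l - ilam m)^-1 *: (L - (ilam m)%:M))) *m g =
    g *m diag_mx (\row_j \prod_(m <- r | m != l) ((ilam l - ilam m)^-1 * (ilam j - ilam m))).
  elim: r => [|m r IH].
    rewrite !big_nil mul1mx (_ : \row_j _ = const_mx 1) ?diag_const_mx ?mulmx1//.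
    by apply/rowP => j; rewrite !mxE big_nil.
  rewrite big_cons; case: ifP => ml; last first.
    by rewrite IH; congr (_ *m diag_mx _); apply/rowP => j; rewrite !mxE big_cons ml.
  rewrite -mulmxA IH mulmxA.
  have -> : ((ilam l - ilam m)^-1 *: (L - (ilam m)%:M)) *m g =
      g *m diag_mx (\row_j ((ilam l - ilam m)^-1 * (ilam j - ilam m))).
    rewrite -scalemxAl mulmxBl /L (mulmxKV gU) i_diagE mul_scalar_mx !mul_mx_diag.
    by apply/matrixP => i j; rewrite !mxE -/(ilam j); ring.
  rewrite -mulmxA mulmx_diag; congr (_ *m diag_mx _); apply/rowP => j.
  by rewrite !mxE big_cons ml.
have {}H := H (index_enum 'I_n).
rewrite -/(spectral_proj l L) in H.
have -> : spectral_proj l L = g *m diag_mx (\row_j (j == l)%:R) *m invmx g.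
  apply: (can_inj (mulmxK gU)); rewrite (mulmxKV gU) H; congr (_ *m diag_mx _).
  apply/rowP => j; rewrite !mxE; have [->|jl] := eqVneq j l.
    by rewrite big1// => m ml; rewrite mulVf// subr_eq0 (inj_eq ilam_inj) eq_sym.
  by rewrite (bigD1 j)//= subrr mulr0 mul0r.
rewrite (invmx_unitary gu) mul_mx_diag mxE (bigD1 l)//= big1 ?addr0.
  by rewrite !mxE eqxx mulr1.
by move=> j jl; rewrite !mxE (negbTE jl) mulr0 mul0r.
Qed.

(* The sum of the spectral projections over [I] has the leading k x k minor
   [|\det (g_(a, i))|^2], a < k, i in I, and [iota] turns columns of [g] into rows. *)
Definition minor_sq (I : {set 'I_n}) (L : 'M[C]_n) : C :=
  \det (\matrix_(a < #|I|, b < #|I|) \sum_(l in I) ent (spectral_proj l L) a b).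

Lemma minor_sqE (g : 'M[C]_n) I : g \is unitarymx ->
  minor_sq I (g *m i_diag lam *m invmx g) = (csq (mnr (ent (iota_inv g)) (sseq I)))%:C%C.
Proof.
move=> gu; set k := #|I|; have kn : (k <= n)%N := card_set_ord I.
pose G : 'M[C]_k := \matrix_(a, c) ent g a (nth 0%N (sseq I) c).
have nI (c : 'I_k) : nth 0%N (sseq I) c = enum_val c.
  by rewrite (enum_val_nth (enum_val c)) (nth_map (enum_val c))// -cardE.
have -> : minor_sq I (g *m i_diag lam *m invmx g) = \det G * (\det G)^*.
  rewrite -det_map_mx -[in X in _ * X]det_tr -det_mulmx; congr (\det _).
  apply/matrixP => a b; rewrite !mxE.
  rewrite big_enum_val /=; apply: eq_bigr => c _; rewrite !mxE nI.
  rewrite -[a : nat]/(val (widen_ord kn a)) -[b : nat]/(val (widen_ord kn b)) !ent_ord.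
  by rewrite spectral_projE.
rewrite csqE -normCK; congr (_ ^+ 2).
have -> : mnr (ent (iota_inv g)) (sseq I) =
    \prod_(i < k) (-1) ^+ (nth 0%N (sseq I) i) * \prod_(i < k) (-1) ^+ i * (\det G)^*.
  rewrite -det_map_mx -[in RHS]det_tr.
  rewrite -(det_scale (fun i : 'I_k => (-1) ^+ (nth 0%N (sseq I) i)) (fun i : 'I_k => (-1) ^+ i)).
  rewrite (mnrE _ (size_sseq I)) -/k; congr (\det _); apply/matrixP => a b; rewrite !mxE nI.
  by rewrite -[b : nat]/(val (widen_ord kn b)) !ent_ord iota_invE.
have n1 (F : 'I_k -> nat) : `|\prod_(i < k) ((-1) ^+ F i : C)| = 1.
  by rewrite normr_prod big1// => i _; rewrite normrX normrN1 expr1n.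
by rewrite !normrM !n1 !mul1r norm_conjC.
Qed.

Lemma realifyK (L : 'M[C]_n) : complexify (realify L) = L.
Proof. by apply/matrixP => i j; rewrite !mxE; case: (L i j). Qed.

Lemma isCkC_entry k i j : isCkC setT k
  (fun P : 'M[R]_n * 'M[R]_n => complexify P i j).
Proof.
have c1 : continuous (fst : {linear ('M[R]_n * 'M[R]_n)%type -> 'M[R]_n}) by move=> x; exact: cvg_fst.
have c2 : continuous (snd : {linear ('M[R]_n * 'M[R]_n)%type -> 'M[R]_n}) by move=> x; exact: cvg_snd.
split.
  have H := isCk_coord i j openT (isCk_linear k setT c1).
  by apply: (eq_isCk openT _ H) => P _; rewrite mxE.
have H := isCk_coord i j openT (isCk_linear k setT c2).
by apply: (eq_isCk openT _ H) => P _; rewrite mxE.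
Qed.

Lemma isCkC_ent k (f : 'M[R]_n * 'M[R]_n -> 'M[C]_n) i j :
  (forall i j, isCkC setT k (fun P => f P i j)) -> isCkC setT k (fun P => ent (f P) i j).
Proof.
move=> Cf; have [/andP[hi hj]|] := boolP ((i < n) && (j < n))%N.
  by apply: (eq_isCkC openT _ (Cf (Ordinal hi) (Ordinal hj))) => P _; rewrite (entE _ hi hj).
rewrite negb_and -!leqNgt => h.
by apply: (eq_isCkC openT _ (isCkC_cst setT k 0)) => P _; rewrite ent_out.
Qed.

Lemma isCkC_spectral_proj k l i j :
  isCkC setT k (fun P : 'M[R]_n * 'M[R]_n => spectral_proj l (complexify P) i j).
Proof.
rewrite /spectral_proj; elim: (index_enum _) i j => [|m r IH] i j.
  by apply: (eq_isCkC openT _ (isCkC_cst setT k ((1%:M : 'M[C]_n) i j))) => P _; rewrite big_nil.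
have [ml|ml] := boolP (m != l); last first.
  by apply: (eq_isCkC openT _ (IH i j)) => P _; rewrite big_cons (negbTE ml).
have H : isCkC setT k (fun P : 'M[R]_n * 'M[R]_n => \sum_(a < n)
    (((ilam l - ilam m)^-1 * (complexify P i a + - (ilam m *+ (i == a)))) *
     (\big[mulmx/1%:M]_(m <- r | m != l) ((ilam l - ilam m)^-1 *: (complexify P - (ilam m)%:M))) a j)).
  apply: (isCkC_sum openT) => a _; apply: (isCkCM openT); last exact: IH.
  apply: (isCkCM openT); first exact: isCkC_cst.
  by apply: (isCkCD openT); [exact: isCkC_entry|exact: isCkC_cst].
apply: (eq_isCkC openT _ H) => P _; rewrite big_cons ml mxE; apply: eq_bigr => a _.
by congr (_ * _); rewrite !mxE.
Qed.

Lemma isCk_minor_sq k I :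
  isCk k setT (fun P : 'M[R]_n * 'M[R]_n => complex.Re (minor_sq I (complexify P)) : R).
Proof.
suff [] : isCkC setT k (fun P : 'M[R]_n * 'M[R]_n => minor_sq I (complexify P)) by [].
apply: (isCkC_det openT) => a b.
have H : isCkC setT k (fun P : 'M[R]_n * 'M[R]_n =>
    \sum_(l in I) ent (spectral_proj l (complexify P)) a b).
  by apply: (isCkC_sum openT) => l _; apply: isCkC_ent => i j; exact: isCkC_spectral_proj.
by apply: (eq_isCkC openT _ H) => P _; rewrite mxE.
Qed.

End SpectralProjection.

(** * The moment map *)

Section Scaling.
Variables (R : realType) (N : nat) (nu : 'rV[R]_N).

(* [wsum] in terms of the squared coordinates, as these depend smoothly on the orbit point. *)
Definition wsumd k (d : 'I_N -> R) (h : {ffun 'I_k -> 'I_N} -> R) : R :=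
  \sum_(f : {ffun 'I_k -> 'I_N}) vdm nu f ^+ 2 * \prod_a d (f a) * h f.

Lemma wsum_sq k (y : 'rV[R]_N) (h : {ffun 'I_k -> 'I_N} -> R) :
  wsum nu y h = wsumd (fun j => y 0 j ^+ 2) h.
Proof. by apply: eq_bigr => f _; rewrite /wt exprMn prodrXl. Qed.

Lemma wsum_scale k t (y : 'rV[R]_N) (h : {ffun 'I_k -> 'I_N} -> R) :
  wsum nu (t *: y) h = (t ^+ k) ^+ 2 * wsum nu y h.
Proof.
rewrite mulr_sumr; apply: eq_bigr => f _; rewrite mulrA; congr (_ * _).
rewrite /wt -exprMn; congr (_ ^+ 2).
under eq_bigr do rewrite mxE.
by rewrite big_split /= prodr_const card_ord mulrCA.
Qed.

Lemma mmu_scale t (y : 'rV[R]_N) : t != 0 -> mmu nu (t *: y) = mmu nu y.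
Proof.
move=> t0; apply/rowP => i; rewrite !mxE; apply: eq_bigr => k _; congr (_ * _).
by rewrite !wsum_scale invfM mulrACA divff ?mul1r// !expf_neq0.
Qed.

End Scaling.

Lemma isCk_mxrow (R : realType) (U : normedModType R) k (A : set U) p m (q_ : 'I_p -> nat)
    (f : forall j, U -> 'M[R]_(m, q_ j)) :
  open A -> (forall j, isCk k A (f j)) -> isCk k A (fun x => \mxrow_(j < p) f j x).
Proof.
move=> oA Cf; apply: isCk_mx => // i j.
apply: (eq_isCk oA _ (isCk_coord i (tagnat.sig2 j) oA (Cf (tagnat.sig1 j)))).
by move=> x _; rewrite mxE.
Qed.

(** * Values, smooth extension and continuity of the moment map *)

Section Assembly.
Variables (R : realType) (n : nat) (lam : 'rV[R]_n).
Hypotheses (n_gt0 : (0 < n)%N) (lam_decr : strictly_decreasing lam)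
  (lam_sums : forall k, (0 < k < n)%N -> injective (fun j : 'I_'C(n, k) => ksums lam k 0 j)).
Local Notation C := R[i].
Local Notation "z ^*" := (Num.conj z).

Lemma mem_ksubsets k I : (I \in ksubsets lam k) = (#|I| == k).
Proof. by rewrite mem_sort mem_enum inE. Qed.

Lemma size_ksubsets k : size (ksubsets lam k) = 'C(n, k).
Proof. by rewrite size_sort -cardE card_draws card_ord. Qed.

Definition kth k (J : nat) : {set 'I_n} := nth finset.set0 (ksubsets lam k) J.

Lemma card_kth k (J : 'I_'C(n, k)) : #|kth k J| = k.
Proof. by apply/eqP; rewrite -mem_ksubsets mem_nth ?size_ksubsets. Qed.

Lemma kth_onto k (I : {set 'I_n}) : #|I| = k -> exists J : 'I_'C(n, k), kth k J = I.
Proof.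
move=> Ik; have Iin : I \in ksubsets lam k by rewrite mem_ksubsets Ik.
have h : (index I (ksubsets lam k) < 'C(n, k))%N by rewrite -size_ksubsets index_mem.
by exists (Ordinal h); rewrite /kth nth_index.
Qed.

Lemma sum_kth k (F : {set 'I_n} -> R) :
  \sum_(I : {set 'I_n} | #|I| == k) F I = \sum_(J < 'C(n, k)) F (kth k J).
Proof.
rewrite -(size_ksubsets k) /kth -(big_mkord xpredT (fun J => F (nth finset.set0 (ksubsets lam k) J))).
rewrite -(big_nth finset.set0 xpredT F).
rewrite [RHS](perm_big (enum [set I : {set 'I_n} | #|I| == k]%SET)) ?perm_sort// big_enum /=.
by apply: eq_bigl => I; rewrite inE.
Qed.

Lemma ksums_decr k : (0 < k < n)%N -> strictly_decreasing (ksums lam k).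
Proof.
move=> kn i j ij; rewrite lt_neqAle; apply/andP; split.
  by apply/eqP => /(lam_sums kn) E; rewrite E ltnn in ij.
rewrite !mxE.
have srt : sorted (fun I J : {set 'I_n} => \sum_(i in J) lam 0 i <= \sum_(i in I) lam 0 i)
    (ksubsets lam k).
  by apply: sort_sorted => I J; exact: le_total.
apply: (sorted_leq_nth _ _ finset.set0 srt); rewrite ?inE ?size_ksubsets ?(ltnW ij)//.
by move=> I J K h1 h2; exact: le_trans h2 h1.
Qed.

Definition absmin k (h : 'M[C]_n) : 'rV[R]_'C(n, k) :=
  \row_J complex.Re `|mnr (ent h) (sseq (kth k J))|.

Definition nzminors (h : 'M[C]_n) :=
  forall s, sorted ltn s -> all (fun i => i < n)%N s -> mnr (ent h) s != 0.

Lemma Re_norm (z : C) : (complex.Re `|z|)%:C%C = `|z|.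
Proof. by rewrite RRe_real// normr_real. Qed.

Lemma Re_norm_gt0 (z : C) : z != 0 -> 0 < complex.Re `|z|.
Proof. by rewrite -normr_gt0 ltcE => /andP[]. Qed.

Lemma Re_norm_sq (z : C) : complex.Re `|z| ^+ 2 = csq z.
Proof. by apply: (@complexI R); rewrite rmorphXn /= Re_norm csqE. Qed.

Lemma absmin_pos k h : nzminors h -> pos_orthant (absmin k h).
Proof. by move=> nz J; rewrite mxE Re_norm_gt0// nz ?sseq_sorted ?sseq_lt. Qed.

Lemma moment_component_mmu k L h : (0 < k < n)%N ->
  twist (flag_of_orbit lam L) = flag_of h -> nzminors h ->
  moment_component lam k L = mmu (ksums lam k) (absmin k h).
Proof.
move=> kn tw nz; rewrite /moment_component tw.
have [c [c0 cP]] := plucker_scale h.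
have kn' : (k <= n)%N by case/andP: kn => _ /ltnW.
have xE J : kplucker lam k (flag_of h) 0 J = c k * mnr (ent h) (sseq (kth k J)).
  by rewrite mxE cP card_kth.
rewrite moser_ext_moment; last first.
- by move=> J; rewrite xE mulf_neq0 ?c0// nz ?sseq_sorted ?sseq_lt.
- exact: ksums_decr.
(* The Pluecker coordinates are c k times the minors of h; scale invariance absorbs |c k|. *)
rewrite -[RHS](@mmu_scale _ _ _ (complex.Re `|c k|)); last first.
  by rewrite gt_eqF// Re_norm_gt0// c0.
congr mmu; apply/rowP => J; rewrite [LHS]mxE [RHS]mxE [X in _ * X]mxE xE normrM.
by rewrite -{1}(Re_norm (c k)) -{1}(Re_norm (mnr _ _)) -rmorphM.
Qed.

Lemma submxrow_moment_map L (k : 'I_n.-1) :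
  submxrow (moment_map lam L) k = moment_component lam k.+1 L.
Proof. exact: mxrowK. Qed.

Lemma krange (k : 'I_n.-1) : (0 < k.+1 < n)%N.
Proof. by have := ltn_ord k; lia. Qed.

Lemma moment_map_permutohedron L : orbit_nz lam L -> forall k : 'I_n.-1,
  permutohedron (ksums lam k.+1) (submxrow (moment_map lam L) k).
Proof.
move=> nzL k; have [g [_ _ _ tw nz]] := orbit_nz_repr n_gt0 lam_decr nzL.
rewrite submxrow_moment_map (moment_component_mmu (krange k) tw nz).
by apply: mmu_permutohedron; [exact: ksums_decr (krange k)|exact: absmin_pos].
Qed.

(** Defined on all pairs of real matrices; on the orbit these are the squared moduli of the k-minors
    of iota(g). *)
Definition dmin k (P : 'M[R]_n * 'M[R]_n) (J : 'I_'C(n, k)) : R :=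
  complex.Re (minor_sq lam (kth k J) (complexify P)).
Arguments dmin k P J : clear implicits.

Lemma dmin_absmin k (g : 'M[C]_n) J : g \is unitarymx ->
  dmin k (realify (g *m i_diag lam *m invmx g)) J = absmin k (iota_inv g) 0 J ^+ 2.
Proof.
by move=> gu; rewrite /dmin realifyK minor_sqE// mxE Re_norm_sq.
Qed.

Lemma isCk_wsumd k m r (h : {ffun 'I_r -> 'I_'C(n, k)} -> R) :
  isCk m setT (fun P => wsumd (ksums lam k) (dmin k P) h).
Proof.
rewrite /wsumd; apply: (isCk_sum _ openT) => f _; apply: isCkM; [exact: openT| |exact: isCk_cst].
apply: isCkM; [exact: openT|exact: isCk_cst|].
by apply: (isCk_prod _ openT) => a _; exact: isCk_minor_sq.
Qed.

Definition den (k r : nat) P : R :=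
  wsumd (ksums lam k) (dmin k P) (fun _ : {ffun 'I_r -> 'I_'C(n, k)} => 1).

(** The product of all denominators of [moment_ext], so that the domain of the extension is given by
    a single open condition. *)
Definition dens P : R := \prod_(k < n.-1) \prod_(r < 'C(n, k.+1)) den k.+1 r.+1 P.

Definition moment_ext P : 'rV[R]_(\sum_(k < n.-1) 'C(n, k.+1)) :=
  \mxrow_(k < n.-1) \row_i \sum_(r < 'C(n, k.+1)) gap (ksums lam k.+1) r *
    (wsumd (ksums lam k.+1) (dmin k.+1 P) (@cnt R _ r.+1 i) / den k.+1 r.+1 P).

Lemma moment_extE L g : g \is unitarymx -> L = g *m i_diag lam *m invmx g ->
  twist (flag_of_orbit lam L) = flag_of (iota_inv g) -> nzminors (iota_inv g) ->
  moment_ext (realify L) = moment_map lam L /\ dens (realify L) != 0.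
Proof.
move=> gu LE tw nz.
have dE k : dmin k (realify L) = (fun J => absmin k (iota_inv g) 0 J ^+ 2).
  by apply/funext => J; rewrite LE dmin_absmin.
split.
  apply/mxrowP => k; rewrite mxrowK submxrow_moment_map (moment_component_mmu (krange k) tw nz).
  apply/rowP => i; rewrite !mxE; apply: eq_bigr => r _.
  by rewrite /den dE -!wsum_sq.
apply/prodf_neq0 => k _; apply/prodf_neq0 => r _.
rewrite /den dE -wsum_sq gt_eqF// wsum1_gt0//; first exact: ksums_decr (krange k).
exact: absmin_pos.
Qed.

Lemma smooth_moment_map :
  smooth_on [set realify L | L in orbit_nz lam] (fun P => moment_map lam (complexify P)).
Proof.
have Cdens k : isCk k setT dens.
  rewrite /dens.
  apply: (isCk_prod _ openT) => i _; apply: (isCk_prod _ openT) => r _; exact: isCk_wsumd.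
have oA : open [set P | dens P != 0].
  have -> : [set P | dens P != 0] = dens @^-1` [set x | x != 0] by [].
  by apply: open_comp; [move=> P _; exact: (Cdens 0%N)|exact: open_neq].
have nzE L : orbit_nz lam L -> moment_ext (realify L) = moment_map lam L /\ dens (realify L) != 0.
  move=> nzL; have [g [gu LE _ tw nz]] := orbit_nz_repr n_gt0 lam_decr nzL.
  exact: moment_extE gu LE tw nz.
move=> _ [L nzL <-]; exists [set P | dens P != 0], moment_ext; split=> //.
- by have [] := nzE L nzL.
- move=> m; rewrite /moment_ext; apply: isCk_mxrow => // k.
  have sub : [set P | dens P != 0] `<=` setT by [].
  apply: isCk_mx => // i0 j; rewrite ord1.
  have H : isCk m [set P | dens P != 0] (fun P =>
      \sum_(r < 'C(n, k.+1)) gap (ksums lam k.+1) r *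
      (wsumd (ksums lam k.+1) (dmin k.+1 P) (@cnt R _ r.+1 j) * (den k.+1 r.+1 P)^-1)).
    apply: isCk_sum => // r _; apply: isCkM => //; first exact: isCk_cst.
    apply: isCkM => //; first by apply: sub_isCk sub _; exact: isCk_wsumd.
    apply: isCkV => //; last by apply: sub_isCk sub _; exact: isCk_wsumd.
    by move=> P /prodf_neq0/(_ k isT)/prodf_neq0/(_ r isT).
  by apply: (eq_isCk oA _ H) => P _; rewrite mxE.
- by move=> _ _ [L' nzL' <-]; rewrite realifyK; have [] := nzE L' nzL'.
Qed.

Lemma moment_map_continuous :
  {within [set realify L | L in orbit_nz lam],
    continuous (fun P => moment_map lam (complexify P))}.
Proof.
apply/subspace_continuousP => P SP.
have [A [g [oA AP sg gE]]] := smooth_moment_map SP.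
change (moment_map lam (complexify Q) @[Q --> within [set realify L | L in orbit_nz lam] (nbhs P)]
  --> moment_map lam (complexify P)).
rewrite -(gE _ AP SP).
have gP : g @ within [set realify L | L in orbit_nz lam] (nbhs P) --> g P.
  by apply: cvg_within_filter; exact: (sg 0%N).
apply: cvg_trans gP; apply: near_eq_cvg.
have nA : nbhs P A by exact: open_nbhs_nbhs.
by rewrite near_withinE; apply: filterS nA => Q AQ SQ; rewrite gE.
Qed.

End Assembly.

(** * The inverse map *)

Section Inverse.
Variables (R : realType) (n : nat) (lam : 'rV[R]_n).
Hypotheses (n_gt0 : (0 < n)%N) (lam_decr : strictly_decreasing lam)
  (lam_sums : forall k, (0 < k < n)%N -> injective (fun j : 'I_'C(n, k) => ksums lam k 0 j)).
Local Notation C := R[i].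
Local Notation "z ^*" := (Num.conj z).
Local Notation M := (\sum_(k < n.-1) 'C(n, k.+1))%N.

Definition setof (s : seq nat) : {set 'I_n} := [set i : 'I_n | val i \in s]%SET.

Lemma sort_sseq s : uniq s -> all (fun i => i < n)%N s -> sort leq s = sseq (setof s).
Proof.
move=> us ls; apply: sorted_ltn_eq; rewrite ?sseq_sorted ?sort_uniq//.
  by rewrite ltn_sorted_uniq_leq sort_uniq us (sort_sorted leq_total).
move=> i; rewrite mem_sort; apply/idP/idP => h.
  by have hi := allP ls i h; rewrite (mem_sseq _ (Ordinal hi)) inE.
by have hi := allP (sseq_lt _) i h; move: h; rewrite (mem_sseq _ (Ordinal hi)) inE.
Qed.

Lemma card_setof s : uniq s -> all (fun i => i < n)%N s -> #|setof s| = size s.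
Proof. by move=> us ls; rewrite -size_sseq -sort_sseq// size_sort. Qed.

Lemma setof_sseq (I : {set 'I_n}) : setof (sseq I) = I.
Proof. by apply/setP => i; rewrite inE mem_sseq. Qed.

(** The number of orderings of the J-th subset, left as a cardinality: the proof needs only its
    positivity and the partition of the injective maps by their images. *)
Definition mult k (J : 'I_'C(n, k)) : R :=
  #|[set f : {ffun 'I_k -> 'I_n} | uniq (fseq f) && (setof (fseq f) == kth lam k J)]%SET|%:R.

Lemma mult_gt0 k J : 0 < @mult k J.
Proof.
rewrite ltr0n; apply/card_gt0P.
have [f fE] := fseq_onto (sseq_lt (kth lam k J)).
move: f fE; rewrite size_sseq card_kth => f fE.
by exists f; rewrite inE fE setof_sseq eqxx (sorted_uniq ltn_trans ltnn (sseq_sorted _)).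
Qed.

Lemma nrm2_absmin k (h : 'M[C]_n) : h \is unitarymx -> (k <= n)%N ->
  nrm2 (@mult k) (absmin lam k h) = k`!%:R.
Proof.
move=> hu kn; apply: (@complexI R); rewrite [RHS]rmorph_nat -(unitary_minors_norm hu kn).
rewrite (bigID (fun f : {ffun 'I_k -> 'I_n} => uniq (fseq f)))/= [X in _ + X]big1 ?addr0; last first.
  by move=> f /mnr_dup ->; rewrite normr0 expr0n.
rewrite (partition_big (fun f : {ffun 'I_k -> 'I_n} => setof (fseq f)) (fun I => #|I| == k))/=; last first.
  by move=> f uf; rewrite card_setof ?size_fseq ?fseq_lt.
have E I (f : {ffun 'I_k -> 'I_n}) : uniq (fseq f) && (setof (fseq f) == I) ->
    `|mnr (ent h) (fseq f)| ^+ 2 = (csq (mnr (ent h) (sseq I)))%:C%C.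
  move=> /andP[uf /eqP <-]; rewrite csqE -sort_sseq ?fseq_lt//.
  have [b bE] := mnr_sort C (fseq f); rewrite -[fseq f in LHS]cat0s bE cat0s.
  by rewrite normrM normrX normrN1 expr1n mul1r.
under eq_bigr => I _ do rewrite (eq_bigr _ (E I)) -rmorph_sum /=.
rewrite -rmorph_sum /=; congr (_%:C%C).
rewrite (sum_kth lam); apply: eq_bigr => J _.
by rewrite mxE Re_norm_sq sumr_const mulr_natl /mult cardsE.
Qed.

(* The open set of vectors to which the reconstruction of a twisted flag from
   its moments extends. *)
Definition recdom : set 'rV[R]_M := [set v | forall k : 'I_n.-1,
  [set mmu_nrm (ksums lam k.+1) (@mult k.+1) y | y in @pos_orthant R _]
    (submxrow v k + const_mx (k.+1)`!%:R)].

Lemma isCk_submxrow m (k : 'I_n.-1) :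
  isCk m setT (fun v : 'rV[R]_M => submxrow v k + const_mx (k.+1)`!%:R).
Proof.
apply: isCk_mx openT _ => i j.
have H := isCkD openT (isCk_coord i (tagnat.Rank k j) openT (isCk_id m [set: 'rV[R]_M]))
  (isCk_cst m setT ((k.+1)`!%:R : R)).
by apply: (eq_isCk openT _ H) => v _; rewrite !mxE.
Qed.

Lemma open_recdom : open recdom.
Proof.
rewrite openE => v Av; rewrite /interior.
apply: (filter_forall (f := fun (k : 'I_n.-1) w => [set mmu_nrm (ksums lam k.+1) (@mult k.+1) y |
    y in @pos_orthant R _] (submxrow w k + const_mx (k.+1)`!%:R)) (F := nbhs v)).
move=> k; have oB := mmu_image_open (ksums_decr lam_sums (krange n_gt0 k)) (@mult_gt0 k.+1).
have Ck := isCk_submxrow 0 k.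
exact: (Ck v I _ (open_nbhs_nbhs (conj oB (Av k)))).
Qed.

(** * Reconstruction of L from its moments when the arguments are fixed *)

Section FixedArguments.
Variable S : set 'M[C]_n.
Hypotheses (S_nz : S `<=` orbit_nz lam) (S_arg : fixes_arguments lam S).

Definition representative g L := [/\ S L, g \is unitarymx, L = g *m i_diag lam *m invmx g,
  last_pos g & twist (flag_of_orbit lam L) = flag_of (iota_inv g) /\ nzminors (iota_inv g)].

Lemma representative_exists L : S L -> exists g, representative g L.
Proof.
by move=> SL; have [g [gu LE gp tw nz]] := orbit_nz_repr n_gt0 lam_decr (S_nz SL); exists g.
Qed.

(** One function [F], smooth on the open set [recdom], has to serve for all representatives over S.
    Closure under sums, products and conjugation reduces the recovery of L to that of the minors. *)
Definition recoverable (q : 'M[C]_n -> C) := exists F : 'rV[R]_M -> C,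
  (forall k, isCkC recdom k F) /\
  forall g L, representative g L -> q g = F (moment_map lam L).

Lemma eq_recoverable q q' : (forall g L, representative g L -> q' g = q g) ->
  recoverable q -> recoverable q'.
Proof. by move=> E [F [CF FE]]; exists F; split=> // g L gL; rewrite (E g L)// (FE g L). Qed.

Lemma recoverable_cst c : recoverable (fun=> c).
Proof. by exists (fun=> c); split=> // k; exact: isCkC_cst. Qed.

Lemma recoverableM q r : recoverable q -> recoverable r -> recoverable (fun h => q h * r h).
Proof.
move=> [F [CF FE]] [G [CG GE]]; exists (fun v => F v * G v); split=> [k|g L gL].
  exact: (isCkCM open_recdom (CF k) (CG k)).
by rewrite (FE g L)// (GE g L).
Qed.

Lemma recoverable_conj q : recoverable q -> recoverable (fun h => (q h)^*).
Proof.
move=> [F [CF FE]]; exists (fun v => (F v)^*); split=> [k|g L gL].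
  exact: (isCkC_conj open_recdom (CF k)).
by rewrite (FE g L).
Qed.

Lemma recoverable_sum (I : Type) (r : seq I) (q : I -> 'M[C]_n -> C) :
  (forall i, recoverable (q i)) -> recoverable (fun h => \sum_(i <- r) q i h).
Proof.
move=> /choice[F FP]; exists (fun v => \sum_(i <- r) F i v); split=> [k|g L gL].
  by apply: (isCkC_sum open_recdom) => i _; case: (FP i).
by apply: eq_bigr => i _; case: (FP i) => _ /(_ g L) ->.
Qed.

Lemma last_minor_gt0 g L k : representative g L -> (k <= n)%N ->
  0 < mnr (ent (iota_inv g)) (iota (n - k) k).
Proof.
move=> [_ gu _ gp [_ nz]] kn; apply: (twist_last_gt0 gu); first by rewrite subnK.
- by have := gp (n - k)%N (leq_subr _ _); rewrite subKn.
- by have := gp n (leqnn n); rewrite subnn.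
- rewrite nz ?iota_ltn_sorted//; apply/allP => i; rewrite mem_iota; lia.
Qed.

(** The moments cover only sizes below n; the remaining minor is positive and of modulus 1. *)
Lemma det_eq1 g L : representative g L -> mnr (ent (iota_inv g)) (iota 0 n) = 1.
Proof.
move=> gL; have := last_minor_gt0 gL (leqnn n); rewrite subnn => d0.
have gu : g \is unitarymx by case: gL.
rewrite -[LHS]gtr0_norm//; apply/eqP; rewrite -sqrp_eq1 ?normr_ge0// normCK.
rewrite (mnrE _ (size_iota 0 n)); set A := \matrix_(_, _) _.
have -> : A = iota_inv g by apply/matrixP => i j; rewrite mxE nth_iota// add0n ent_ord.
have /unitarymxP/(congr1 determinant) := iota_inv_unitary gu.
by rewrite det_mulmx det_map_mx det_tr det1 => ->.
Qed.

Lemma recoverable_kth (k : 'I_n.-1) (J : 'I_'C(n, k.+1)) :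
  recoverable (fun g => mnr (ent (iota_inv g)) (sseq (kth lam k.+1 J))).
Proof.
have [theta thP] := S_arg.
(* The reference set of the last k+1 rows: its minor is positive, so [theta I0] is exactly the phase
   of the common factor, and dividing by it leaves the phase of the minor itself. *)
pose I0 := perm_prefix (w0 n) k.+1.
have kn : (k.+1 <= n)%N by have := ltn_ord k; lia.
pose nu := ksums lam k.+1.
have nu_decr : strictly_decreasing nu := ksums_decr lam_sums (krange n_gt0 k).
pose y (v : 'rV[R]_M) := mmu_inv nu (@mult k.+1) (submxrow v k + const_mx (k.+1)`!%:R).
exists (fun v => (y v 0 J)%:C%C * (theta (kth lam k.+1 J) / theta I0)); split=> [m|g L gL].
  apply: (isCkCM open_recdom); last exact: isCkC_cst.
  apply: isCkC_real.
  have oB := mmu_image_open nu_decr (@mult_gt0 k.+1).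
  apply: (isCk_comp (g := fun z => mmu_inv nu (@mult k.+1) z 0 J) open_recdom oB).
  - by move=> v; exact.
  - by apply: sub_isCk (isCk_submxrow m k).
  - by apply: (isCk_coord 0 J oB); exact: (smooth_mmu_inv nu_decr (@mult_gt0 k.+1) m).
have [SL gu LE gp [tw nz]] := gL; set h := iota_inv g in tw nz *.
have hu : h \is unitarymx by exact: iota_inv_unitary.
(* The missing scale is the known constant (k+1)!, the value of [nrm2] on minors of a unitary
   matrix. *)
have yE : y (moment_map lam L) = absmin lam k.+1 h.
  rewrite /y submxrow_moment_map (moment_component_mmu lam_sums (krange n_gt0 k) tw nz).
  rewrite -(nrm2_absmin hu kn) -/(mmu_nrm _ _ _) mmu_invK//; first exact: mult_gt0.
  exact: absmin_pos.
rewrite yE mxE Re_norm.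
have [c c0 cP] := thP L SL k.+1 (krange n_gt0 k).
have [d [d0 dP]] := plucker_scale h; rewrite -tw in dP.
have mI (I : {set 'I_n}) : #|I| = k.+1 -> theta I = phase (c * d k.+1) * phase (mnr (ent h) (sseq I)).
  move=> Ik; rewrite -(cP I Ik) dP Ik /phase !normrM !invfM; ring.
have th0 : theta I0 = phase (c * d k.+1).
  rewrite mI ?card_perm_prefix// sseq_w0//.
  have h0 := last_minor_gt0 gL kn; rewrite -/h in h0.
  by rewrite /phase (gtr0_norm h0) divff ?mulr1// gt_eqF.
have z0 : c * d k.+1 != 0 by rewrite mulf_neq0 ?d0.
rewrite th0 mI ?card_kth//; set z := c * d k.+1 in z0 *; set m := mnr _ _.
have m0 : m != 0 by rewrite nz ?sseq_sorted ?sseq_lt.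
have pz : phase z != 0 by rewrite mulf_neq0 ?invr_eq0 ?normr_eq0.
by rewrite [phase z * _]mulrC mulfK// /phase mulrC divfK// normr_eq0.
Qed.

Lemma recoverable_set (I : {set 'I_n}) : recoverable (fun g => mnr (ent (iota_inv g)) (sseq I)).
Proof.
have In : (#|I| <= n)%N := card_set_ord I.
have [I0|I0] := posnP #|I|.
  have -> : sseq I = [::] by apply/eqP; rewrite -size_eq0 size_sseq I0.
  by apply: (eq_recoverable _ (recoverable_cst 1)) => g L _; rewrite mnr_nil.
move: In; rewrite leq_eqVlt => /orP[/eqP Ien|Iltn].
  have -> : sseq I = iota 0 n.
    by apply: (@sorted_last_interval n 0 n); rewrite ?size_sseq ?sseq_sorted ?sseq_lt.
  by apply: (eq_recoverable _ (recoverable_cst 1)) => g L; exact: det_eq1.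
have kn : (#|I|.-1 < n.-1)%N by lia.
have [J <-] := kth_onto lam (esym (prednK I0)).
exact: (recoverable_kth (k := Ordinal kn)).
Qed.

Lemma recoverable_minor s : all (fun i => i < n)%N s ->
  recoverable (fun g => mnr (ent (iota_inv g)) s).
Proof.
move=> ls; have [us|us] := boolP (uniq s); last first.
  by apply: (eq_recoverable _ (recoverable_cst 0)) => g L _; rewrite mnr_dup.
have [b bE] := mnr_sort C s.
apply: (eq_recoverable _ (recoverableM (recoverable_cst ((-1) ^+ b)) (recoverable_set (setof s)))).
by move=> g L _; rewrite -sort_sseq// -[s in LHS]cat0s bE cat0s.
Qed.

Lemma recoverable_entry (i a : 'I_n) : recoverable (fun g => iota_inv g i a).
Proof.
apply: (eq_recoverable _ (recoverableM (recoverable_cst (a`!%:R)^-1) (recoverable_sum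
  (index_enum {ffun 'I_a -> 'I_n}) (fun f => recoverableM
  (recoverable_conj (recoverable_minor (fseq_lt f)))
  (recoverable_minor (s := rcons (fseq f) i) _))))); last first.
  by move=> f; rewrite all_rcons ltn_ord fseq_lt.
move=> g L [_ gu _ _ _]; rewrite -(unitary_entry _ _ (iota_inv_unitary gu)) ent_ord.
by rewrite -[iota_inv g i a *+ _]mulr_natl mulKf// pnatr_eq0 -lt0n fact_gt0.
Qed.

Lemma recover_entry (i j : 'I_n) : exists F : 'rV[R]_M -> C,
  (forall k, isCkC recdom k F) /\ forall L, S L -> L i j = F (moment_map lam L).
Proof.
(* The expansion of g (i Diag(lam)) g^-1 in the entries of g, which are conjugate entries of iota(g)
   with the signs of [iota_invE]; the signs in l square to 1. *)
have [F [CF FE]] := recoverable_sum (index_enum 'I_n) (fun l => recoverableM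
  (recoverable_cst ((-1) ^+ i * (-1) ^+ j * ilam lam l))
  (recoverableM (recoverable_conj (recoverable_entry l i)) (recoverable_entry l j))).
exists F; split=> // L SL; have [g gL] := representative_exists SL.
rewrite -(FE g L gL); have [_ gu -> _ _] := gL.
rewrite (invmx_unitary gu) i_diagE mul_mx_diag mxE; apply: eq_bigr => l _.
rewrite !(iota_invE _ _ gu) !mxE !rmorphM !rmorphXn !rmorphN1 /= conjCK /ilam.
have sq (m : nat) : (-1) ^+ m * (-1) ^+ m = 1 :> C by rewrite -exprMn mulrNN mulr1 expr1n.
transitivity (((-1) ^+ i * (-1) ^+ i) * ((-1) ^+ j * (-1) ^+ j) * ((-1) ^+ l * (-1) ^+ l)
  * (g i l * (Complex 0 1 * (lam 0 l)%:C%C) * (g j l)^*)); last by ring.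
by rewrite !sq !mul1r.
Qed.

Lemma moment_map_diffeo :
  diffeo_onto_image [set realify L | L in S] (fun P => moment_map lam (complexify P)).
Proof.
split.
  move=> P [L SL LP]; have [] := smooth_moment_map n_gt0 lam_decr lam_sums (x := P).
    by exists L => //; exact: S_nz.
  move=> A [f [oA AP sf fE]]; exists A, f; split=> // Q AQ [L' SL' LQ].
  by apply: fE => //; exists L' => //; exact: S_nz.
have /choice[F FP] : forall i : 'I_n, exists Fi : 'I_n -> 'rV[R]_M -> C, forall j,
    (forall k, isCkC recdom k (Fi j)) /\ forall L, S L -> L i j = Fi j (moment_map lam L).
  by move=> i; have /choice[Fi FiP] := recover_entry i; exists Fi.
pose G v : 'M[R]_n * 'M[R]_n := realify (\matrix_(i, j) F i j v).
exists G.
  move=> _ [L SL <-]; rewrite realifyK /G; congr realify; apply/matrixP => i j.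
  by rewrite mxE; case: (FP i j) => _ ->.
move=> _ [_ [L SL <-] <-]; exists recdom, G; rewrite realifyK; split=> //.
- exact: open_recdom.
- move=> k; have [g gL] := representative_exists SL.
  have [_ gu _ _ [tw nz]] := gL; rewrite submxrow_moment_map.
  rewrite (moment_component_mmu lam_sums (krange n_gt0 k) tw nz).
  exists (absmin lam k.+1 (iota_inv g)); first exact: absmin_pos.
  by rewrite /mmu_nrm nrm2_absmin ?iota_inv_unitary//; have := ltn_ord k; lia.
- move=> m; apply: (isCk_pair open_recdom).
    apply: (isCk_mx open_recdom) => i j; have [/(_ m)[H _] _] := FP i j.
    by apply: (eq_isCk open_recdom _ H) => v _; rewrite !mxE.
  apply: (isCk_mx open_recdom) => i j; have [/(_ m)[_ H] _] := FP i j.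
  by apply: (eq_isCk open_recdom _ H) => v _; rewrite !mxE.
Qed.

End FixedArguments.

Lemma orbit_pos_nz : orbit_pos lam `<=` orbit_nz lam.
Proof.
move=> L pL; split; first by case: pL.
have [g [_ _ _ tw ps]] := orbit_pos_repr n_gt0 lam_decr pL.
have [c [c0 cP]] := plucker_scale (iota_inv g).
move=> I; rewrite tw cP mulf_neq0 ?c0 ?card_set_ord// gt_eqF// ps ?sseq_sorted ?sseq_lt//.
Qed.

Lemma orbit_pos_args : fixes_arguments lam (orbit_pos lam).
Proof.
exists (fun=> 1) => L pL k /andP[_ /ltnW kn].
have [g [_ _ _ tw ps]] := orbit_pos_repr n_gt0 lam_decr pL.
have [c [c0 cP]] := plucker_scale (iota_inv g).
exists (c k)^-1; first by rewrite invr_eq0 c0.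
move=> I Ik; rewrite tw cP Ik mulKf ?c0//.
have p := ps _ (sseq_sorted I) (sseq_lt I).
by rewrite /phase gtr0_norm// divff// gt_eqF.
Qed.

End Inverse.

Theorem proposition7p3 (R : realType) (n : nat) (lam : 'rV[R]_n)
    (n_gt0 : (0 < n)%N)
    (lam_decr : strictly_decreasing lam)
    (lam_sums : forall k, (0 < k < n)%N ->
       injective (fun j : 'I_'C(n, k) => ksums lam k 0 j)) :
  [/\ forall L, orbit_nz lam L -> forall k : 'I_n.-1,
        permutohedron (ksums lam k.+1) (submxrow (moment_map lam L) k),
      {within [set realify L | L in orbit_nz lam],
        continuous (fun P => moment_map lam (complexify P))},
      forall S : set 'M[R[i]]_n, S `<=` orbit_nz lam -> fixes_arguments lam S ->
        diffeo_onto_image [set realify L | L in S]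
          (fun P => moment_map lam (complexify P))
    & orbit_pos lam `<=` orbit_nz lam /\
      diffeo_onto_image [set realify L | L in orbit_pos lam]
        (fun P => moment_map lam (complexify P))].
Proof.
split.
- exact: moment_map_permutohedron.
- exact: moment_map_continuous.
- exact: moment_map_diffeo.
- split; first exact: orbit_pos_nz.
  by apply: moment_map_diffeo => //; [exact: orbit_pos_nz|exact: orbit_pos_args].
Qed.
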